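(* Suppose that no algorithm solves every Dictionary Matching instance in $o(n/\sqrt{\log n})$ time. Denote $K:=\max(2,\lceil\log_2 n\rceil)$. Then the following hold for data structures for suffix array queries over binary texts of length $n$: (1) For every choice $B=B(n)\in[2..K]$ satisfying $B=o(\sqrt K/\log K)$, no algorithm taking $o(n/\sqrt{\log n})$ time can construct the data structure with space usage $O(n\log_B K)$ bits and query time $O(B\log_B K)$. (2) For every choice $B=B(n)\in[2..K]$, no algorithm taking $o(n/\sqrt{\log n})$ time can construct the data structure with space usage $O(Bn\log_B K)$ bits and query time $O(\log_B K)$. (3) No algorithm taking $o(n/\sqrt{\log n})$ time can construct the data structure with space usage $O(n(1+\log\log n))$ bits and query time $O(1+\log\log n)$. (4) For every fixed $\epsilon\in(0,1/2)$, no algorithm taking $o(n/\sqrt{\log n})$ time can construct the data structure with space usage $O(n)$ bits and query time $O((\log n)^\epsilon)$. (5) For every fixed $\epsilon\in(0,1)$, no algorithm taking $o(n/\sqrt{\log n})$ time can construct the data structure with space usage $O(n(\log n)^\epsilon)$ bits and query time $O(1)$.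
   Context: Logarithms without base are binary; $[a..b]=\{k\in\mathbb Z:a\le k\le b\}$; strings are indexed from $1$. Dictionary Matching problem: let $n\ge2$ and $k,m\ge1$ be integers with $k=\Theta(n/\log n)$ and $m=\Theta(\log n)$. The input consists of the packed representation of a text $T\in\{0,1\}^n$ and the packed representations of a collection $\mathcal D=\{P_1,\dots,P_k\}\subseteq\{0,1\}^m$ of patterns. The output is YES if some $P_i$ occurs in $T$ as a substring, and NO otherwise. The model is the word RAM with word size $w=c\log n$, $c\ge2$ constant (standard arithmetic and bitwise word operations take $O(1)$ time). For a text $T$ of length $n$, $\mathrm{SA}_T[i]$ is the starting position of the lexicographically $i$th smallest suffix of $T$ (a proper prefix of a string is smaller than the string). A data structure for suffix array queries is constructed from the packed representation of a binary text $T$ of length $n$ and, given $i\in[1..n]$, returns $\mathrm{SA}_T[i]$. ''The data structure with space usage $S$ and query time $Q$'' means a data structure for suffix array queries that works for every binary text of length $n$ with these bounds. The packed representation of a binary string with word size $w$ stores $w$ consecutive bits per word (earlier bits in lower-order positions), with unused bits of the last word set to $0$. *)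

(* Defs.v *)
From HB Require Import structures.
From mathcomp Require Import all_boot all_order all_algebra.
From mathcomp Require Import all_classical all_reals all_analysis.

Set Implicit Arguments.
Unset Strict Implicit.
Unset Printing Implicit Defensive.

Import Order.TTheory GRing.Theory Num.Theory.
Import numFieldNormedType.Exports.

Local Open Scope nat_scope.

(** * Word RAM

    A deterministic word RAM with word size [w]: the contents of all registers
    and memory cells are naturals below [2 ^ w]. A program uses finitely many
    registers and finitely many arrays (those it mentions); every array has
    [2 ^ w] cells and is indexed by words (an address is a word tagged with one
    of constantly many array names). Memory is not initialized: an
    algorithm has to work whatever the cells outside its input contain. *)

Inductive word_op : Type :=
  OAdd | OSub | OMul | ODiv | OMod | OAnd | OOr | OXor | OShl | OShr | OEq | OLt.

Inductive cmd : Type :=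
  | Const of nat & nat              (* [Const x v]:      x := v          *)
  | Op of nat & word_op & nat & nat (* [Op x o y z]:     x := y o z      *)
  | Read of nat & nat & nat         (* [Read x a y]:     x := a[y]       *)
  | Write of nat & nat & nat        (* [Write a x y]:    a[x] := y       *)
  | Skip
  | Seq of cmd & cmd
  | If of nat & cmd & cmd           (* tests whether the register is nonzero *)
  | While of nat & cmd.             (* loops while the register is nonzero   *)

Record state : Type := State {
  reg : nat -> nat;
  mem : nat -> nat -> nat }.

Definition state_wf (w : nat) (s : state) : Prop :=
  (forall x, reg s x < 2 ^ w) /\ (forall a j, mem s a j < 2 ^ w).

Definition set_reg (s : state) (x v : nat) : state :=
  State (fun y => if y == x then v else reg s y) (mem s).

Definition set_mem (s : state) (a j v : nat) : state :=
  State (reg s)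
    (fun a' j' => if (a' == a) && (j' == j) then v else mem s a' j').

(* Arithmetic is modulo [2 ^ w]; division by zero follows [divn] and [modn]. *)
Definition eval_op (w : nat) (o : word_op) (x y : nat) : nat :=
  match o with
  | OAdd => (x + y) %% 2 ^ w
  | OSub => (x + (2 ^ w - y)) %% 2 ^ w
  | OMul => (x * y) %% 2 ^ w
  | ODiv => x %/ y
  | OMod => x %% y
  | OAnd => Nat.land x y
  | OOr => Nat.lor x y
  | OXor => Nat.lxor x y
  | OShl => (x * 2 ^ y) %% 2 ^ w
  | OShr => x %/ 2 ^ y
  | OEq => x == y
  | OLt => x < y
  end.

(* [run w p s t s']: with word size [w], program [p] started in state [s] halts
   in state [s'] after [t] steps; every instruction and every test is one
   step. *)
Inductive run (w : nat) : cmd -> state -> nat -> state -> Prop :=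
  | run_const x v s :
      run w (Const x v) s 1 (set_reg s x (v %% 2 ^ w))
  | run_op x o y z s :
      run w (Op x o y z) s 1 (set_reg s x (eval_op w o (reg s y) (reg s z)))
  | run_read x a y s :
      run w (Read x a y) s 1 (set_reg s x (mem s a (reg s y)))
  | run_write a x y s :
      run w (Write a x y) s 1 (set_mem s a (reg s x) (reg s y))
  | run_skip s : run w Skip s 1 s
  | run_seq p q s t s1 u s2 :
      run w p s t s1 -> run w q s1 u s2 -> run w (Seq p q) s (t + u) s2
  | run_if_true x p q s t s1 :
      reg s x != 0 -> run w p s t s1 -> run w (If x p q) s t.+1 s1
  | run_if_false x p q s t s1 :
      reg s x = 0 -> run w q s t s1 -> run w (If x p q) s t.+1 s1
  | run_while_true x p s t s1 u s2 :
      reg s x != 0 -> run w p s t s1 -> run w (While x p) s1 u s2 ->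
      run w (While x p) s (t + u).+1 s2
  | run_while_false x p s :
      reg s x = 0 -> run w (While x p) s 1 s.

(** * Packed strings *)

Definition num_words (w len : nat) : nat := (len + w.-1) %/ w.

(* Earlier bits are in lower-order positions; the default [false] of [nth]
   zeroes the unused bits of the last word. *)
Definition packed_word (w : nat) (s : seq bool) (j : nat) : nat :=
  \sum_(b < w) nth false s (j * w + b) * 2 ^ b.

Definition stores_packed (w : nat) (s : state) (a start : nat)
    (str : seq bool) : Prop :=
  forall j, j < num_words w (size str) ->
    mem s a (start + j) = packed_word w str j.

(** * Suffix arrays *)

(* Positions and ranks count from 1. [seqlexi bool] is [seq bool] with the
   lexicographic order, in which a proper prefix of a string is smaller. *)
Definition suffix_le (T : seq bool) (p q : nat) : bool :=
  ((drop p.-1 T : seqlexi bool) <= (drop q.-1 T : seqlexi bool))%O.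

Definition suffix_array (T : seq bool) (i : nat) : nat :=
  nth 0 (sort (suffix_le T) (iota 1 (size T))) i.-1.

(** * Asymptotic quantities *)

Section Quantities.
Variable R : realType.
Local Open Scope classical_set_scope.
Local Open Scope ring_scope.

Definition logb (b x : R) : R := ln x / ln b.
Definition log2 (x : R) : R := logb 2 x.

Definition word_size (c : R) (n : nat) : nat :=
  `|Num.ceil (c * log2 n%:R)|%N.

Definition little_o (f : nat -> nat) (g : nat -> R) : Prop :=
  (fun n => (f n)%:R : R^o) =o_\oo (fun n => g n : R^o).

Definition big_O (f : nat -> nat) (g : nat -> R) : Prop :=
  (fun n => (f n)%:R : R^o) =O_\oo (fun n => g n : R^o).

Definition n_over_sqrt_log (n : nat) : R := n%:R / Num.sqrt (log2 n%:R).

End Quantities.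

Definition ceil_log (n : nat) : nat := maxn 2 (up_log 2 n).

(** * Dictionary Matching *)

(* The constants [a] and [b] are those hidden in [k = Theta(n / log n)] and
   [m = Theta(log n)]. The last three conditions say that the parameters fit
   into words and that the dictionary fits into an array; for given [a] and
   [b] they fail for at most finitely many [n]. *)
Definition dm_params (R : realType) (c a b : R) (n k m : nat) : Prop :=
  let w := word_size c n in
  [/\ 2 <= n, 1 <= k & 1 <= m] /\
  [/\ (a * (n%:R / log2 n%:R) <= k%:R <= b * (n%:R / log2 n%:R))%R &
      (a * log2 n%:R <= m%:R <= b * log2 n%:R)%R] /\
  [/\ k < 2 ^ w, m < 2 ^ w & k * num_words w m <= 2 ^ w].

(* Registers 0, 1, 2, 3 hold [n], [w], [k], [m]; array 0 holds the text and
   array 1 the patterns, each of them starting at a word boundary. *)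
Definition dm_input (w n k m : nat) (T : n.-tuple bool)
    (D : k.-tuple (m.-tuple bool)) (s : state) : Prop :=
  [/\ state_wf w s,
      [/\ reg s 0 = n, reg s 1 = w, reg s 2 = k & reg s 3 = m],
      stores_packed w s 0 0 T &
      forall i : 'I_k, stores_packed w s 1 (i * num_words w m) (tnth D i)].

Definition dm_answer (n k m : nat) (T : n.-tuple bool)
    (D : k.-tuple (m.-tuple bool)) : bool :=
  [exists i : 'I_k, infix (tnth D i) T].

(* Some algorithm solves every instance in [o(n / sqrt (log n))] time,
   leaving the answer (1 for YES, 0 for NO) in register 0. *)
Definition dm_solvable (R : realType) (c a b : R) : Prop :=
  exists (p : cmd) (time : nat -> nat),
    little_o time (@n_over_sqrt_log R) /\
    forall (n k m : nat), dm_params c a b n k m ->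
    forall (T : n.-tuple bool) (D : k.-tuple (m.-tuple bool)) (s : state),
      dm_input (word_size c n) T D s ->
      exists (t : nat) (s' : state),
        [/\ run (word_size c n) p s t s', t <= time n &
            reg s' 0 = dm_answer T D].

(** * Data structures for suffix array queries *)

(* Registers 0, 1 hold [n], [w]; array 0 holds the text. *)
Definition sa_input (w n : nat) (T : n.-tuple bool) (s : state) : Prop :=
  [/\ state_wf w s, reg s 0 = n, reg s 1 = w & stores_packed w s 0 0 T].

Definition same_cells (a len : nat) (s s' : state) : Prop :=
  forall j, j < len -> mem s a j = mem s' a j.

(* The first [len] cells of array 2 in [s] are a data structure for [T]: the
   program [query] answers each query on it in at most [qtime] steps, without
   relying on anything else in memory and leaving the data structure intact.
   A query receives [n], [w], [i] in registers 0, 1, 2 and returns its result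
   in register 0. *)
Definition sa_answers (w : nat) (query : cmd) (qtime n : nat)
    (T : n.-tuple bool) (len : nat) (s : state) : Prop :=
  forall (i : nat) (s1 : state),
    1 <= i <= n -> state_wf w s1 -> same_cells 2 len s s1 ->
    [/\ reg s1 0 = n, reg s1 1 = w & reg s1 2 = i] ->
    exists (t : nat) (s2 : state),
      [/\ run w query s1 t s2, t <= qtime, same_cells 2 len s s2 &
          reg s2 0 = suffix_array T i].

(* Some algorithm constructs, in [o(n / sqrt (log n))] time and for every
   binary text of length [n], a data structure with space usage
   [O(space n)] bits and query time [O(qtime n)]. *)
Definition sa_constructible (R : realType) (c : R)
    (space qtime : nat -> R) : Prop :=
  exists (build query : cmd) (tb sb tq : nat -> nat),
    [/\ little_o tb (@n_over_sqrt_log R), big_O sb space & big_O tq qtime] /\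
    forall (n : nat), 2 <= n ->
    forall (T : n.-tuple bool) (s : state),
      sa_input (word_size c n) T s ->
      exists (t len : nat) (s' : state),
        [/\ run (word_size c n) build s t s', t <= tb n,
            len * word_size c n <= sb n &
            sa_answers (word_size c n) query (tq n) T len s'].

(* Main.v *)
Require Import Defs.
From mathcomp Require Import all_boot all_order all_algebra.
From mathcomp Require Import all_classical all_reals all_analysis.
From Stdlib Require PeanoNat.
From mathcomp Require Import zify ring lra.

(** Sort the patterns by a radix sort whose digits are blocks of [delta log n]
    bits for a small constant [delta]; this takes [O(n / log n)] time. Then
    sweep the suffix array of the text. For each pattern in turn, a pointer moves in strides of
    [Theta(log n)] ranks while the suffix found there is smaller than the
    pattern, and a binary search inside the last stride locates the pattern.
    A comparison costs one query and [O(1)] word operations, and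
    [O(n log log n / log n)] comparisons are made. Hence a data structure with
    query time [q] that is built in [o(n / sqrt (log n))] time solves Dictionary
    Matching in [o(n / sqrt (log n))] time as soon as
    [q log log n = o(sqrt (log n))], whatever its size. All five query times
    are that small. *)

Set Implicit Arguments.
Unset Strict Implicit.
Unset Printing Implicit Defensive.

Import Order.TTheory GRing.Theory Num.Theory.
Local Open Scope nat_scope.

(** * Word RAM *)

(** A separate binary search over all [n] ranks for each of the [n / log n] patterns would make
    about [n] queries. Sorting makes the insertion points monotone, so the pointer never returns and
    only [log log n] further probes per pattern remain. The stride is the least power of two not
    below the word size, so that it can be halved. A digit must be short enough for [2 ^ d] buckets
    to stay within [O(n / log n)], yet long enough for a pattern to have boundedly many digits;
    [w / 2 ^ e + 1] bits with a large constant [e] achieve both. Packed words hold earlier bits in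
    lower positions, so their numerical order is not lexicographic. A table of reversed [d]-bit
    words repairs this, and strings are sorted and compared digit by digit. [build] and [query] are
    arbitrary programs on the same machine, so whatever must survive them is kept in registers and
    arrays that they do not mention. The algorithm is written in a language with bounded loops only,
    whose execution is a function and whose cost is read off the syntax; one compiler proof carries
    it to the RAM. *)

Lemma bitwise_ltn (f : nat -> nat -> nat) (w x y : nat) :
  (forall u v k, Nat.shiftr (f u v) k = f (Nat.shiftr u k) (Nat.shiftr v k)) ->
  f 0 0 = 0 -> x < 2 ^ w -> y < 2 ^ w -> f x y < 2 ^ w.
Proof.
move=> fS f0 xw yw.
have pw : PeanoNat.Nat.pow 2 w = 2 ^ w.
  by elim: w {xw yw} => //= w IH; rewrite expnS -IH /=; lia.
have sh0 u : u < 2 ^ w -> Nat.shiftr u w = 0.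
  rewrite PeanoNat.Nat.shiftr_div_pow2 => uw; apply: PeanoNat.Nat.div_small.
  by apply/ssrnat.ltP; move: uw; rewrite -pw.
(* Shifting by [w] turns both arguments, hence also the result, into 0; so the result has no bit
   from position [w] on. *)
have := fS x y w; rewrite (sh0 _ xw) (sh0 _ yw) f0 PeanoNat.Nat.shiftr_div_pow2.
move/PeanoNat.Nat.div_small_iff => H; rewrite -pw; apply/ssrnat.ltP/H.
by apply/eqP; rewrite -lt0n pw expn_gt0.
Qed.

Lemma eval_op_ltn (w : nat) (o : word_op) (x y : nat) :
  0 < w -> x < 2 ^ w -> y < 2 ^ w -> eval_op w o x y < 2 ^ w.
Proof.
move=> w_gt0 xw yw.
have b1 (b : bool) : b < 2 ^ w.
  by apply: leq_ltn_trans (leq_b1 b) _; rewrite -{1}(expn0 2) ltn_exp2l.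
case: o => /=; rewrite ?ltn_mod ?expn_gt0 //.
- exact: leq_ltn_trans (leq_div _ _) xw.
- exact: leq_ltn_trans (leq_mod _ _) xw.
- by apply: bitwise_ltn => //; exact: PeanoNat.Nat.shiftr_land.
- by apply: bitwise_ltn => //; exact: PeanoNat.Nat.shiftr_lor.
- by apply: bitwise_ltn => //; exact: PeanoNat.Nat.shiftr_lxor.
- exact: leq_ltn_trans (leq_div _ _) xw.
Qed.

Lemma set_reg_wf (w : nat) (s : state) (x v : nat) :
  v < 2 ^ w -> state_wf w s -> state_wf w (set_reg s x v).
Proof. by move=> vw [sr sm]; split=> //= y; case: eqP. Qed.

Lemma set_mem_wf (w : nat) (s : state) (a j v : nat) :
  v < 2 ^ w -> state_wf w s -> state_wf w (Defs.set_mem s a j v).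
Proof. by move=> vw [sr sm]; split=> //= b i; case: ifP. Qed.

Lemma run_wf (w : nat) (p : cmd) (s : state) (t : nat) (s' : state) :
  0 < w -> run w p s t s' -> state_wf w s -> state_wf w s'.
Proof.
move=> w_gt0; elim=> {p s t s'} //; try by move=> *; auto.
- by move=> x v s swf; apply: set_reg_wf => //; rewrite ltn_mod expn_gt0.
- by move=> x o y z s swf; apply: set_reg_wf => //; apply: eval_op_ltn => //; case: swf.
- by move=> x a y s swf; apply: set_reg_wf => //; case: swf.
- by move=> a x y s swf; apply: set_mem_wf => //; case: swf.
Qed.

Fixpoint assigned_regs (p : cmd) : seq nat :=
  match p with
  | Const x _ | Op x _ _ _ | Read x _ _ => [:: x]
  | Write _ _ _ | Skip => [::]
  | Seq p q | If _ p q => assigned_regs p ++ assigned_regs q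
  | While _ p => assigned_regs p
  end.

Fixpoint written_arrays (p : cmd) : seq nat :=
  match p with
  | Write a _ _ => [:: a]
  | Const _ _ | Op _ _ _ _ | Read _ _ _ | Skip => [::]
  | Seq p q | If _ p q => written_arrays p ++ written_arrays q
  | While _ p => written_arrays p
  end.

(** With [run_mem], the frame property of unknown programs: the names that occur in [build] and
    [query] limit what they can change. *)
Lemma run_regs (w : nat) (p : cmd) (s : state) (t : nat) (s' : state) (x : nat) :
  run w p s t s' -> x \notin assigned_regs p -> reg s' x = reg s x.
Proof.
elim=> {p s t s'} //=; try by move=> *; auto.
- by move=> y v s; rewrite inE; case: eqP.
- by move=> y o z z' s; rewrite inE; case: eqP.
- by move=> y a z s; rewrite inE; case: eqP.
- move=> p q s t s1 u s2 _ IHp _ IHq; rewrite mem_cat negb_or => /andP[xp xq].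
  by rewrite IHq ?IHp.
- by move=> y p q s t s1 _ _ IHp; rewrite mem_cat negb_or => /andP[xp xq]; rewrite IHp.
- by move=> y p q s t s1 _ _ IHp; rewrite mem_cat negb_or => /andP[xp xq]; rewrite IHp.
- by move=> y p s t s1 u s2 _ _ IHp _ IHq xp; rewrite IHq ?IHp.
Qed.

Lemma run_mem (w : nat) (p : cmd) (s : state) (t : nat) (s' : state) (a : nat) :
  run w p s t s' -> a \notin written_arrays p -> Defs.mem s' a = Defs.mem s a.
Proof.
elim=> {p s t s'} //=; try by move=> *; auto.
- by move=> b x y s; rewrite inE => ab; apply/funext => j; case: eqP ab.
- move=> p q s t s1 u s2 _ IHp _ IHq; rewrite mem_cat negb_or => /andP[xp xq].
  by rewrite IHq ?IHp.
- by move=> y p q s t s1 _ _ IHp; rewrite mem_cat negb_or => /andP[xp xq]; rewrite IHp.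
- by move=> y p q s t s1 _ _ IHp; rewrite mem_cat negb_or => /andP[xp xq]; rewrite IHp.
- by move=> y p s t s1 u s2 _ _ IHp _ IHq xp; rewrite IHq ?IHp.
Qed.

(** * Compiling a total language *)

Inductive expr : Type :=
  | EVar of nat
  | ENum of nat
  | EOp of word_op & expr & expr
  | EGet of nat & expr.

(* [HFor x y c] runs [c] as many times as the value of variable [y] at the
   start says, with the iteration number in [x]; so execution is a function.
   [HQuery] calls the query algorithm. *)
Inductive hcmd : Type :=
  | HSkip
  | HSet of nat & expr
  | HStore of nat & expr & expr
  | HSeq of hcmd & hcmd
  | HIf of expr & hcmd & hcmd
  | HFor of nat & nat & hcmd
  | HQuery of nat & expr.

Fixpoint eval (w : nat) (e : expr) (s : state) : nat :=
  match e with
  | EVar x => reg s x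
  | ENum v => v %% 2 ^ w
  | EOp o e1 e2 => eval_op w o (eval w e1 s) (eval w e2 s)
  | EGet a e => Defs.mem s a (eval w e s)
  end.

Fixpoint hexec (w : nat) (g : nat -> nat) (c : hcmd) (s : state) : state :=
  match c with
  | HSkip => s
  | HSet x e => set_reg s x (eval w e s)
  | HStore a e1 e2 => Defs.set_mem s a (eval w e1 s) (eval w e2 s)
  | HSeq c1 c2 => hexec w g c2 (hexec w g c1 s)
  | HIf e c1 c2 => if eval w e s != 0 then hexec w g c1 s else hexec w g c2 s
  | HFor x y c => iteri (reg s y) (fun i s => hexec w g c (set_reg s x i)) s
  | HQuery x e => set_reg s x (g (eval w e s))
  end.

Fixpoint expr_cost (e : expr) : nat :=
  match e with
  | EVar _ | ENum _ => 1
  | EOp _ e1 e2 => expr_cost e1 + expr_cost e2 + 1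
  | EGet _ e => expr_cost e + 1
  end.

(** The constants count the instructions and tests emitted by [comp]. A loop has 4 instructions of
    set-up and a last failing test, and 4 steps per iteration besides its body; a query call has 8
    steps around the query itself. *)
Fixpoint hcost (tq : nat) (r : nat -> nat) (c : hcmd) : nat :=
  match c with
  | HSkip => 1
  | HSet _ e => expr_cost e + 1
  | HStore _ e1 e2 => expr_cost e1 + expr_cost e2 + 1
  | HSeq c1 c2 => hcost tq r c1 + hcost tq r c2
  | HIf e c1 c2 => expr_cost e + 1 + maxn (hcost tq r c1) (hcost tq r c2)
  | HFor _ y c => 5 + r y * (hcost tq r c + 4)
  | HQuery _ e => expr_cost e + tq + 8
  end.

Fixpoint hassigned (c : hcmd) : seq nat :=
  match c with
  | HSkip | HStore _ _ _ => [::]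
  | HSet x _ | HQuery x _ => [:: x]
  | HSeq c1 c2 | HIf _ c1 c2 => hassigned c1 ++ hassigned c2
  | HFor x _ c => x :: hassigned c
  end.

Fixpoint hwritten (c : hcmd) : seq nat :=
  match c with
  | HSkip | HSet _ _ | HQuery _ _ => [::]
  | HStore a _ _ => [:: a]
  | HSeq c1 c2 | HIf _ c1 c2 => hwritten c1 ++ hwritten c2
  | HFor _ _ c => hwritten c
  end.

Fixpoint loop_bounds (c : hcmd) : seq nat :=
  match c with
  | HSkip | HSet _ _ | HQuery _ _ | HStore _ _ _ => [::]
  | HSeq c1 c2 | HIf _ c1 c2 => loop_bounds c1 ++ loop_bounds c2
  | HFor _ y c => y :: loop_bounds c
  end.

(* Under this condition the bounds of all loops can be read off the initial
   state, as [hcost] does. *)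
Definition fixed_bounds (c : hcmd) : bool :=
  all (fun y => y \notin hassigned c) (loop_bounds c).

Lemma iteri_ind (X : Type) (P : nat -> X -> Prop) (f : nat -> X -> X)
    (k : nat) (x : X) :
  P 0 x -> (forall i y, i < k -> P i y -> P i.+1 (f i y)) -> P k (iteri k f x).
Proof.
move=> P0 PS; suff H i : i <= k -> P i (iteri i f x) by exact: H.
by elim: i => //= i IH ik; apply: PS => //; apply/IH/ltnW.
Qed.

Lemma hexec_reg (w : nat) (g : nat -> nat) (c : hcmd) (s : state) (x : nat) :
  x \notin hassigned c -> reg (hexec w g c s) x = reg s x.
Proof.
elim: c s => //=.
- by move=> y e s; rewrite inE; case: eqP.
- move=> c1 IH1 c2 IH2 s; rewrite mem_cat negb_or => /andP[x1 x2].
  by rewrite IH2 ?IH1.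
- move=> e c1 IH1 c2 IH2 s; rewrite mem_cat negb_or => /andP[x1 x2].
  by case: ifP; rewrite ?IH1 ?IH2.
- move=> y z c IH s; rewrite inE negb_or => /andP[xy xc].
  apply: (@iteri_ind _ (fun _ s' => reg s' x = reg s x)) => // i s' _ <-.
  by rewrite IH //= (negPf xy).
- by move=> y e s; rewrite inE; case: eqP.
Qed.

Lemma hexec_mem (w : nat) (g : nat -> nat) (c : hcmd) (s : state) (a : nat) :
  a \notin hwritten c -> Defs.mem (hexec w g c s) a = Defs.mem s a.
Proof.
elim: c s => //=.
- by move=> b e e' s; rewrite inE => ab; apply/funext => j; case: eqP ab.
- move=> c1 IH1 c2 IH2 s; rewrite mem_cat negb_or => /andP[x1 x2].
  by rewrite IH2 ?IH1.
- move=> e c1 IH1 c2 IH2 s; rewrite mem_cat negb_or => /andP[x1 x2].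
  by case: ifP; rewrite ?IH1 ?IH2.
- move=> y z c IH s ac.
  by apply: (@iteri_ind _ (fun _ s' => Defs.mem s' a = Defs.mem s a)) => // i s' _ <-; rewrite IH.
Qed.

Lemma hcost_eq (tq : nat) (r r' : nat -> nat) (c : hcmd) :
  {in loop_bounds c, r =1 r'} -> hcost tq r c = hcost tq r' c.
Proof.
elim: c => //=.
- move=> c1 IH1 c2 IH2 rr'; rewrite IH1 ?IH2 // => x xc; apply: rr';
  by rewrite mem_cat xc ?orbT.
- move=> e c1 IH1 c2 IH2 rr'; rewrite IH1 ?IH2 // => x xc; apply: rr';
  by rewrite mem_cat xc ?orbT.
- move=> x y c IH rr'; rewrite IH => [|z zc]; last by rewrite rr' // inE zc orbT.
  by rewrite rr' // mem_head.
Qed.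

Section Compile.
Variables (F : nat) (am : nat -> nat) (q : cmd).

(* Variable [x] lives in register [F + 2x] and temporary [t] in [F + 2t + 1];
   temporaries 0 and 1 permanently hold [n] and [w] for the query calls. *)
Definition rvar (x : nat) : nat := F + x.*2.
Definition rtmp (t : nat) : nat := F + t.*2.+1.

Fixpoint comp_expr (t : nat) (e : expr) : cmd :=
  match e with
  | EVar x => Op (rtmp t) OOr (rvar x) (rvar x)
  | ENum v => Const (rtmp t) v
  | EOp o e1 e2 =>
      Seq (comp_expr t e1)
        (Seq (comp_expr t.+1 e2) (Op (rtmp t) o (rtmp t) (rtmp t.+1)))
  | EGet a e => Seq (comp_expr t e) (Read (rtmp t) (am a) (rtmp t))
  end.

(** The query algorithm promises nothing, not even termination, for ranks outside [[1..n]], so the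
    call is guarded. One comparison [v - 1 < n] suffices, since [0 - 1] wraps around to [2 ^ w - 1],
    which is at least [n]. *)
Definition comp_query (t x : nat) : cmd :=
  Seq (Const (rtmp t.+1) 1)
    (Seq (Op (rtmp t.+1) OSub (rtmp t) (rtmp t.+1))
    (Seq (Op (rtmp t.+1) OLt (rtmp t.+1) (rtmp 0))
    (If (rtmp t.+1)
      (Seq (Op 0 OOr (rtmp 0) (rtmp 0))
      (Seq (Op 1 OOr (rtmp 1) (rtmp 1))
      (Seq (Op 2 OOr (rtmp t) (rtmp t))
      (Seq q (Op (rvar x) OOr 0 0)))))
      (Const (rvar x) 0)))).

(** [t] is the first free temporary. A loop keeps its bound, its counter, the constant 1 and the
    outcome of the test in [t] to [t + 3]; its body is compiled from [t + 4] on and cannot disturb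
    them. *)
Fixpoint comp (t : nat) (c : hcmd) : cmd :=
  match c with
  | HSkip => Skip
  | HSet x e =>
      Seq (comp_expr t e) (Op (rvar x) OOr (rtmp t) (rtmp t))
  | HStore a e1 e2 =>
      Seq (comp_expr t e1)
        (Seq (comp_expr t.+1 e2) (Write (am a) (rtmp t) (rtmp t.+1)))
  | HSeq c1 c2 => Seq (comp t c1) (comp t c2)
  | HIf e c1 c2 => Seq (comp_expr t e) (If (rtmp t) (comp t c1) (comp t c2))
  | HFor x y c =>
      Seq (Op (rtmp t) OOr (rvar y) (rvar y))
      (Seq (Const (rtmp t.+1) 0)
      (Seq (Const (rtmp t.+2) 1)
      (Seq (Op (rtmp t.+3) OLt (rtmp t.+1) (rtmp t))
      (While (rtmp t.+3)
        (Seq (Op (rvar x) OOr (rtmp t.+1) (rtmp t.+1))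
        (Seq (comp t.+4 c)
        (Seq (Op (rtmp t.+1) OAdd (rtmp t.+1) (rtmp t.+2))
             (Op (rtmp t.+3) OLt (rtmp t.+1) (rtmp t)))))))))
  | HQuery x e => Seq (comp_expr t e) (comp_query t x)
  end.

Definition view (s : state) : state :=
  State (fun x => reg s (rvar x)) (fun a => Defs.mem s (am a)).

Lemma rvar_eq (x y : nat) : (rvar x == rvar y) = (x == y).
Proof. by rewrite /rvar eqn_add2l -!muln2 eqn_pmul2r. Qed.

Lemma rtmp_eq (x y : nat) : (rtmp x == rtmp y) = (x == y).
Proof. by rewrite /rtmp eqn_add2l eqSS -!muln2 eqn_pmul2r. Qed.

Lemma rvar_rtmp (x t : nat) : (rvar x == rtmp t) = false.
Proof. by apply/eqP; rewrite /rvar /rtmp; lia. Qed.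

Lemma view_set_tmp (s : state) (t v : nat) :
  view (set_reg s (rtmp t) v) = view s.
Proof. by rewrite /view /=; congr State; apply/funext => x; rewrite rvar_rtmp. Qed.

Lemma view_set_var (s : state) (x v : nat) :
  view (set_reg s (rvar x) v) = set_reg (view s) x v.
Proof. by rewrite /view /=; congr State; apply/funext => y; rewrite rvar_eq. Qed.

Lemma view_set_mem (s : state) (a j v : nat) : injective am ->
  view (Defs.set_mem s (am a) j v) = Defs.set_mem (view s) a j v.
Proof.
move=> am_inj; rewrite /view /=; congr State.
by apply/funext => b; apply/funext => i; rewrite (inj_eq am_inj).
Qed.

Lemma orr_diag (w x : nat) : eval_op w OOr x x = x.
Proof. exact: PeanoNat.Nat.lor_diag. Qed.

(** There is no move instruction; the OR of a register with itself takes its place. *)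
Lemma run_copy (w x y : nat) (s : state) :
  run w (Op x OOr y y) s 1 (set_reg s x (reg s y)).
Proof. by have := run_op w x OOr y y s; rewrite orr_diag. Qed.

(** The last clause preserves the value of a left operand in [rtmp t] while the right operand is
    evaluated from [t.+1] on. *)
Lemma comp_expr_run (w t : nat) (e : expr) (s : state) :
  exists s', [/\ run w (comp_expr t e) s (expr_cost e) s',
    view s' = view s, Defs.mem s' = Defs.mem s,
    reg s' (rtmp t) = eval w e (view s) &
    forall r, (forall u, t <= u -> r != rtmp u) -> reg s' r = reg s r].
Proof.
have rneq t0 r : (forall u, t0 <= u -> r != rtmp u) -> (r == rtmp t0) = false.
  by move=> H; apply/negbTE/H.
elim: e t s => [x|v|o e1 IH1 e2 IH2|a e IH] t s /=.
- eexists; split; first exact: run_op.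
  + exact: view_set_tmp. + by [].
  + by rewrite /= eqxx; exact: PeanoNat.Nat.lor_diag.
  + by move=> r /rneq /= ->.
- eexists; split; first exact: run_const.
  + exact: view_set_tmp. + by [].
  + by rewrite /= eqxx.
  + by move=> r /rneq /= ->.
- have [s1 [r1 v1 m1 e1E f1]] := IH1 t s.
  have [s2 [r2 v2 m2 e2E f2]] := IH2 t.+1 s1.
  eexists; split.
  + rewrite -addnA; apply: run_seq r1 _; apply: run_seq r2 _; exact: run_op.
  + by rewrite view_set_tmp v2.
  + by rewrite /= m2.
  + rewrite /= eqxx e2E v1 f2 ?e1E // => u tu; rewrite rtmp_eq; lia.
  + move=> r ru /=; rewrite (rneq t) // f2 ?f1 // => u tu; apply: ru; exact: ltnW.
- have [s1 [r1 v1 m1 e1E f1]] := IH t s.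
  eexists; split.
  + apply: run_seq r1 _; exact: run_read.
  + by rewrite view_set_tmp v1.
  + by [].
  + by rewrite /= eqxx m1 e1E.
  + by move=> r ru /=; rewrite (rneq t) // f1.
Qed.

End Compile.

(** * Correctness of the compiler *)

Section Simulation.
Variables (F : nat) (am : nat -> nat) (q : cmd) (w n tq len : nat).
Variables (ds : state) (f : nat -> nat).
Hypotheses (w_gt0 : 0 < w) (F_ge3 : 3 <= F).
Hypothesis am_inj : injective am.
Hypothesis am_neq2 : forall a, am a != 2.
Hypothesis q_regs : forall x, x \in assigned_regs q -> x < F.
Hypothesis q_mem : forall a, am a \notin written_arrays q.
Hypothesis q_spec : forall (i : nat) (s1 : state),
  1 <= i <= n -> state_wf w s1 -> same_cells 2 len ds s1 ->
  [/\ reg s1 0 = n, reg s1 1 = w & reg s1 2 = i] ->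
  exists (t : nat) (s2 : state),
    [/\ run w q s1 t s2, t <= tq, same_cells 2 len ds s2 & reg s2 0 = f i].

Let stmp := rtmp F.
Let svar := rvar F.
Let sview := view F am.

Definition oracle (i : nat) : nat := if 1 <= i <= n then f i else 0.

(** What a query call requires at any moment: the data structure is intact, and [n] and [w] are at
    hand in temporaries 0 and 1. *)
Definition ready (s : state) : Prop :=
  [/\ state_wf w s, same_cells 2 len ds s, reg s (stmp 0) = n
    & reg s (stmp 1) = w].

Lemma rtmp_neq (r x : nat) : r < 3 -> (stmp x == r) = false.
Proof. by move=> r3; apply/eqP; rewrite /stmp /rtmp; lia. Qed.

Lemma ready_var (s : state) (x v : nat) :
  v < 2 ^ w -> ready s -> ready (set_reg s (svar x) v).
Proof.
move=> vw [swf sc s0 s1]; split => //=; first exact: set_reg_wf.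
- by rewrite eq_sym rvar_rtmp.
- by rewrite eq_sym rvar_rtmp.
Qed.

Lemma ready_tmp (s : state) (t v : nat) :
  2 <= t -> v < 2 ^ w -> ready s -> ready (set_reg s (stmp t) v).
Proof.
move=> t2 vw [swf sc s0 s1]; split => //=; first exact: set_reg_wf.
- by rewrite rtmp_eq ltn_eqF // ltnW.
- by rewrite rtmp_eq ltn_eqF.
Qed.

Lemma ready_mem (s : state) (a j v : nat) :
  v < 2 ^ w -> ready s -> ready (Defs.set_mem s (am a) j v).
Proof.
move=> vw [swf sc s0 s1]; split => //=; first exact: set_mem_wf.
by move=> i il; rewrite /= eq_sym (negPf (am_neq2 a)) sc.
Qed.

Lemma ready_reg_ltn (s : state) (r : nat) : ready s -> reg s r < 2 ^ w.
Proof. by case=> [[+ _] _ _ _]; apply. Qed.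

Lemma one_mod_word : 1 %% 2 ^ w = 1.
Proof. by rewrite modn_small // -{1}(expn0 2) ltn_exp2l. Qed.

Lemma expr_run (t : nat) (e : expr) (s : state) : 2 <= t -> ready s ->
  exists s', [/\ run w (comp_expr F am t e) s (expr_cost e) s',
    sview s' = sview s, reg s' (stmp t) = eval w e (sview s),
    (forall u, u < t -> reg s' (stmp u) = reg s (stmp u)) & ready s'].
Proof.
move=> t2 [swf sc s0 s1].
have [s' [r v m eE fr]] := comp_expr_run F am w t e s.
have fr' u : u < t -> reg s' (stmp u) = reg s (stmp u).
  by move=> ut; rewrite fr // => u' tu'; rewrite rtmp_eq; lia.
exists s'; split => //; split.
- exact: run_wf r swf.
- by move=> j jl; rewrite m sc.
- by rewrite fr' // ltnW.
- by rewrite fr'.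
Qed.

Lemma query_run (t x : nat) (s : state) : 2 <= t -> ready s ->
  exists t' s', [/\ run w (comp_query F q t x) s t' s', t' <= tq + 8,
    sview s' = set_reg (sview s) x (oracle (reg s (stmp t))),
    (forall u, u < t -> reg s' (stmp u) = reg s (stmp u)) & ready s'].
Proof.
move=> t2 rs; set v := reg s (stmp t).
have vw : v < 2 ^ w by exact: ready_reg_ltn.
have nw : n < 2 ^ w by case: (rs) => _ _ <- _; exact: ready_reg_ltn.
set s1 := set_reg s (stmp t.+1) (1 %% 2 ^ w).
have rs1 : ready s1 by apply: ready_tmp => //; rewrite ?ltn_mod ?expn_gt0 // ltnW.
set s2 := set_reg s1 (stmp t.+1) (eval_op w OSub (reg s1 (stmp t)) (reg s1 (stmp t.+1))).
have rs2 : ready s2.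
  by apply: ready_tmp => //; [exact: ltnW | apply: eval_op_ltn => //; exact: ready_reg_ltn].
set s3 := set_reg s2 (stmp t.+1) (eval_op w OLt (reg s2 (stmp t.+1)) (reg s2 (stmp 0))).
have rs3 : ready s3.
  by apply: ready_tmp => //; [exact: ltnW | apply: eval_op_ltn => //; exact: ready_reg_ltn].
have ne u : u <= t -> (stmp u == stmp t.+1) = false.
  by move=> ut; rewrite rtmp_eq; lia.
have guard : reg s3 (stmp t.+1) = (1 <= v <= n) :> nat.
  have n0 : reg s (stmp 0) = n by case: rs.
  rewrite /s3 /s2 /s1 /= !eqxx !ne ?leq0n // n0 one_mod_word -/v.
  congr nat_of_bool; case: (posnP v) => [->|v0].
    by rewrite add0n modn_small ?ltn_subrL ?expn_gt0 //; lia.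
  have -> : v + (2 ^ w - 1) = v.-1 + 2 ^ w by have := expn_gt0 2 w; lia.
  by rewrite modnDr modn_small; lia.
have v3 : sview s3 = sview s by rewrite /sview !view_set_tmp.
have k3 u : u < t -> reg s3 (stmp u) = reg s (stmp u).
  by move=> ut; rewrite /= !ne // ltnW.
have fin s' z t' : z < 2 ^ w -> z = oracle v -> t' <= tq + 8 ->
    run w (comp_query F q t x) s t' (set_reg s' (svar x) z) ->
    sview s' = sview s -> (forall u, u < t -> reg s' (stmp u) = reg s (stmp u)) ->
    state_wf w s' -> same_cells 2 len ds s' ->
  exists t' s', [/\ run w (comp_query F q t x) s t' s', t' <= tq + 8,
    sview s' = set_reg (sview s) x (oracle v),
    (forall u, u < t -> reg s' (stmp u) = reg s (stmp u)) & ready s'].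
  move=> zw zE t'q r vE kE wf' sc'; exists t'; eexists; split; first exact: r.
  - by [].
  - by rewrite /sview view_set_var zE -/sview vE.
  - by move=> u ut; rewrite /= eq_sym rvar_rtmp kE.
  - apply: ready_var => //; case: rs => _ _ r0 r1; split => //.
      by rewrite kE // ltnW.
    by rewrite kE.
case: (boolP (1 <= v <= n)) guard => vn guard; last first.
  apply: (fin s3 0 5) => //; try by [case: rs3 | rewrite /oracle (negPf vn) | lia].
  apply: (@run_seq _ _ _ _ 1 s1 4); first exact: run_const.
  apply: (@run_seq _ _ _ _ 1 s2 3); first exact: run_op.
  apply: (@run_seq _ _ _ _ 1 s3 2); first exact: run_op.
  apply: run_if_false => //.
  by have := run_const w (svar x) 0 s3; rewrite mod0n.
set s4 := set_reg s3 0 (reg s3 (stmp 0)).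
set s5 := set_reg s4 1 (reg s4 (stmp 1)).
set s6 := set_reg s5 2 (reg s5 (stmp t)).
have wf6 : state_wf w s6.
  have wf4 : state_wf w s4 by apply: set_reg_wf; case: rs3 => // -[].
  have wf5 : state_wf w s5 by apply: set_reg_wf => //; case: wf4.
  by apply: set_reg_wf => //; case: wf5.
have [||t7 [s7 [r7 t7q sc7 o7]]] := @q_spec v s6 vn wf6.
- by case: rs3.
- have s3n : reg s3 (stmp 0) = n by case: rs3.
  have s3w : reg s3 (stmp 1) = w by case: rs3.
  have s3v : reg s3 (stmp t) = v by rewrite /s3 /s2 /s1 /= !ne.
  by rewrite /s6 /s5 /s4; move: (s3) s3n s3w s3v => S; rewrite /= !rtmp_neq.
have s7s6 z : 3 <= z -> F <= z -> reg s7 z = reg s3 z.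
  move=> z3 zF; rewrite (run_regs r7); last first.
    by apply/negP => /q_regs; rewrite ltnNge zF.
  by rewrite /s6 /s5 /s4; move: (s3) => S; case: z z3 {zF} => [|[|[|z]]].
have k7 u : u < t -> reg s7 (stmp u) = reg s (stmp u).
  move=> ut; rewrite s7s6 ?k3 //; rewrite /stmp /rtmp; first lia.
  exact: leq_addr.
apply: (fin s7 (f v) (3 + (1 + (3 + (t7 + 1))))) => //.
- by rewrite -o7; case: (run_wf w_gt0 r7 wf6).
- by rewrite /oracle vn.
- by lia.
- apply: (@run_seq _ _ _ _ 1 s1); first exact: run_const.
  apply: (@run_seq _ _ _ _ 1 s2); first exact: run_op.
  apply: (@run_seq _ _ _ _ 1 s3); first exact: run_op.
  apply: run_if_true; first by rewrite guard.
  apply: (@run_seq _ _ _ _ 1 s4); first exact: run_copy.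
  apply: (@run_seq _ _ _ _ 1 s5); first exact: run_copy.
  apply: (@run_seq _ _ _ _ 1 s6); first exact: run_copy.
  apply: run_seq r7 _.
  by rewrite -o7; exact: run_copy.
- rewrite -v3 /sview /view; congr State; last first.
    by apply/funext => a; rewrite (run_mem r7).
  by apply/funext => y; rewrite s7s6 //= /rvar; lia.
- exact: run_wf r7 wf6.
Qed.

Lemma comp_run (c : hcmd) (t : nat) (s : state) :
  2 <= t -> fixed_bounds c -> ready s ->
  exists t' s', [/\ run w (comp F am q t c) s t' s',
    t' <= hcost tq (reg (sview s)) c,
    sview s' = hexec w oracle c (sview s),
    (forall u, u < t -> reg s' (stmp u) = reg s (stmp u)) & ready s'].
Proof.
elim: c t s => [|x e|a e1 e2|c1 IH1 c2 IH2|e c1 IH1 c2 IH2|x y c IH|x e] t s t2 /= fb rs.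
- by exists 1, s; split => //; exact: run_skip.
- have [s1 [r1 v1 e1E f1 rs1]] := expr_run e t2 rs.
  eexists; eexists; split.
  + apply: run_seq r1 _; exact: run_op.
  + by [].
  + by rewrite /sview view_set_var -/sview v1 orr_diag e1E.
  + by move=> u ut /=; rewrite eq_sym rvar_rtmp f1.
  + by apply: ready_var => //; rewrite orr_diag; exact: ready_reg_ltn.
- have [s1 [r1 v1 e1E f1 rs1]] := expr_run e1 t2 rs.
  have [s2 [r2 v2 e2E f2 rs2]] := expr_run e2 (leqW t2) rs1.
  eexists; eexists; split.
  + apply: run_seq r1 _; apply: run_seq r2 _; exact: run_write.
  + by rewrite addnA.
  + by rewrite /sview view_set_mem // -/sview v2 v1 e2E v1 f2 // e1E.
  + by move=> u ut /=; rewrite f2 ?f1 // ltnW.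
  + by apply: ready_mem => //; exact: ready_reg_ltn.
- have fb1 : fixed_bounds c1.
    apply/allP => z zc; have := allP fb z; rewrite /= !mem_cat zc => /(_ isT).
    by rewrite negb_or => /andP[].
  have fb2 : fixed_bounds c2.
    apply/allP => z zc; have := allP fb z; rewrite /= !mem_cat zc orbT => /(_ isT).
    by rewrite negb_or => /andP[].
  have [t1 [s1 [r1 l1 v1 f1 rs1]]] := IH1 t s t2 fb1 rs.
  have [t2' [s2 [r2 l2 v2 f2 rs2]]] := IH2 t s1 t2 fb2 rs1.
  exists (t1 + t2'), s2; split => //.
  + exact: run_seq r1 r2.
  + apply: leq_add => //; apply: leq_trans l2 _; rewrite v1.
    rewrite (@hcost_eq _ _ (reg (sview s))) // => z zc; apply: hexec_reg.
    have := allP fb z; rewrite /= !mem_cat zc orbT => /(_ isT).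
    by rewrite negb_or => /andP[].
  + by rewrite v2 v1.
  + by move=> u ut; rewrite f2 ?f1.
- have fb1 : fixed_bounds c1.
    apply/allP => z zc; have := allP fb z; rewrite /= !mem_cat zc => /(_ isT).
    by rewrite negb_or => /andP[].
  have fb2 : fixed_bounds c2.
    apply/allP => z zc; have := allP fb z; rewrite /= !mem_cat zc orbT => /(_ isT).
    by rewrite negb_or => /andP[].
  have [s1 [r1 v1 eE f1 rs1]] := expr_run e t2 rs.
  case: ifP => eval0.
  + have [t1 [s2 [r2 l2 v2 f2 rs2]]] := IH1 t s1 t2 fb1 rs1.
    exists (expr_cost e + t1.+1), s2; split => //.
    * by apply: run_seq r1 _; apply: run_if_true => //; rewrite eE.
    * by rewrite -addnA leq_add2l add1n ltnS (leq_trans l2) // v1 leq_maxl.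
    * by rewrite v2 v1.
    * by move=> u ut; rewrite f2 ?f1.
  + have [t1 [s2 [r2 l2 v2 f2 rs2]]] := IH2 t s1 t2 fb2 rs1.
    exists (expr_cost e + t1.+1), s2; split => //.
    * by apply: run_seq r1 _; apply: run_if_false => //; rewrite eE; apply/eqP/negbFE.
    * by rewrite -addnA leq_add2l add1n ltnS (leq_trans l2) // v1 leq_maxr.
    * by rewrite v2 v1.
    * by move=> u ut; rewrite f2 ?f1.
- have fbc : fixed_bounds c.
    apply/allP => z zc; have := allP fb z; rewrite /= !inE zc orbT => /(_ isT).
    by rewrite negb_or => /andP[].
  have bfix z : z \in y :: loop_bounds c -> (z == x) = false /\ z \notin hassigned c.
    move=> zc; have := allP fb z zc.
    by rewrite /= !inE negb_or => /andP[/negbTE -> ->].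
  set N := reg (sview s) y.
  have Nw : N < 2 ^ w by exact: (ready_reg_ltn (svar y) rs).
  set g := fun i s0 => hexec w oracle c (set_reg s0 x i).
  set body := Seq _ (Seq (comp F am q t.+4 c) _).
  set T := hcost tq (reg (sview s)) c.
  have t2' : 2 <= t.+4 by lia.
  (* Induction on the number [k] of iterations left, with [i] done. *)
  have loop k i s1 : i + k = N -> ready s1 ->
      [/\ reg s1 (stmp t) = N, reg s1 (stmp t.+1) = i, reg s1 (stmp t.+2) = 1
        & reg s1 (stmp t.+3) = (i < N)] ->
      sview s1 = iteri i g (sview s) ->
      (forall u, u < t -> reg s1 (stmp u) = reg s (stmp u)) ->
    exists t' s', [/\ run w (While (stmp t.+3) body) s1 t' s',
      t' <= 1 + k * (T + 4), sview s' = iteri N g (sview s),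
      (forall u, u < t -> reg s' (stmp u) = reg s (stmp u)) & ready s'].
    elim: k i s1 => [|k IHk] i s1 ikN rs1 [a0 a1 a2 a3] vs1 ks1.
      exists 1, s1; split => //; last by rewrite vs1 -ikN addn0.
      by apply: run_while_false; rewrite a3 -ikN addn0 ltnn.
    have iN : i < N by lia.
    set s2 := set_reg s1 (svar x) i.
    have rs2 : ready s2 by apply: ready_var => //; exact: ltn_trans Nw.
    have [t3 [s3 [r3 l3 v3 f3 rs3]]] := IH t.+4 s2 t2' fbc rs2.
    have f23 u : u < t.+4 -> reg s3 (stmp u) = reg s1 (stmp u).
      by move=> ut; rewrite f3 //= eq_sym rvar_rtmp.
    set s4 := set_reg s3 (stmp t.+1) (eval_op w OAdd (reg s3 (stmp t.+1)) (reg s3 (stmp t.+2))).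
    set s5 := set_reg s4 (stmp t.+3) (eval_op w OLt (reg s4 (stmp t.+1)) (reg s4 (stmp t))).
    have rs4 : ready s4.
      by apply: ready_tmp => //; [lia | apply: eval_op_ltn => //; exact: ready_reg_ltn].
    have rs5 : ready s5.
      by apply: ready_tmp => //; [apply: eval_op_ltn => //; exact: ready_reg_ltn].
    have ne u u' : (stmp u == stmp u') = (u == u') by exact: rtmp_eq.
    have n5 u : u != t.+3 -> reg s5 (stmp u) = reg s4 (stmp u).
      by rewrite /s5; move: (s4) => S /=; rewrite ne => /negbTE ->.
    have n4 u : u < t.+4 -> u != t.+1 -> reg s4 (stmp u) = reg s1 (stmp u).
      by move=> /f23 <-; rewrite /s4; move: (s3) => S /=; rewrite ne => /negbTE ->.
    have c5 : reg s4 (stmp t.+1) = i.+1.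
      rewrite /s4; move: (s3) f23 => S f23 /=; rewrite eqxx !f23 ?a1 ?a2 ?addn1 ?modn_small //; lia.
    have c4 : reg s4 (stmp t) = N by rewrite n4 ?a0 //; lia.
    have [||||t6 [s6 [r6 l6 v6 f6 rs6]]] := IHk i.+1 s5 _ rs5.
    + by lia.
    + split.
      * by rewrite n5 ?c4 //; lia.
      * by rewrite n5 ?c5 //; lia.
      * by rewrite n5 ?n4 ?a2 //; lia.
      * by rewrite -c5 -[X in _ < X]c4 /s5; move: (s4) => S /=; rewrite eqxx.
    + by rewrite /s5 /s4 /sview !view_set_tmp -/sview v3 /s2 /sview view_set_var -/sview vs1.
    + by move=> u ut; rewrite n5 ?n4 ?ks1 //; lia.
    exists ((1 + (t3 + (1 + 1))) + t6).+1, s6; split => //; last first.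
      (* Bounds of inner loops are never assigned, so they have their initial values in every
         iteration, and each iteration costs at most [T + 4]. *)
      move: l3; rewrite (@hcost_eq _ _ (reg (sview s))) -/T; first by lia.
      move=> z zc; have [zx zh] : (z == x) = false /\ z \notin hassigned c.
        by apply: bfix; rewrite inE zc orbT.
      rewrite /s2 /sview view_set_var -/(sview s1) vs1.
      rewrite [LHS]/= zx.
      by apply: (@iteri_ind _ (fun _ s' => reg s' z = reg (sview s) z)) => // j s' _ <-;
        rewrite /g hexec_reg //= zx.
    apply: run_while_true (r6); first by rewrite a3 iN.
    apply: (@run_seq _ _ _ _ 1 s2).
      by rewrite /s2 -a1; exact: run_copy.
    by apply: run_seq r3 _; apply: (@run_seq _ _ _ _ 1 s4); exact: run_op.
  set s1 := set_reg s (stmp t) N.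
  set s2 := set_reg s1 (stmp t.+1) 0.
  set s3 := set_reg s2 (stmp t.+2) 1.
  set s4 := set_reg s3 (stmp t.+3) (0 < N).
  have w1 : 1 < 2 ^ w by rewrite -{1}(expn0 2) ltn_exp2l.
  have rs4 : ready s4.
    do 4?[apply: ready_tmp => //; try lia] => //.
  have ne u u' : (stmp u == stmp u') = (u == u') by exact: rtmp_eq.
  have [||||t5 [s5 [r5 l5 v5 f5 rs5]]] := loop N 0 s4 _ rs4.
  + by [].
  + by rewrite /s4 /s3 /s2 /s1 /= !ne !eqSS !eqxx; split; rewrite ?(ltn_eqF, gtn_eqF) //; lia.
  + by rewrite /s4 /s3 /s2 /s1 /sview !view_set_tmp.
  + by move=> u ut; rewrite /s4 /s3 /s2 /s1 /= !ne !ltn_eqF //; lia.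
  exists (1 + (1 + (1 + (1 + t5)))), s5; split => //.
  + apply: (@run_seq _ _ _ _ 1 s1).
      exact: run_copy.
    apply: (@run_seq _ _ _ _ 1 s2).
      by have := run_const w (stmp t.+1) 0 s1; rewrite mod0n.
    apply: (@run_seq _ _ _ _ 1 s3).
      by have := run_const w (stmp t.+2) 1 s2; rewrite one_mod_word.
    apply: (@run_seq _ _ _ _ 1 s4) => //.
    have -> : s4 = set_reg s3 (stmp t.+3) (eval_op w OLt (reg s3 (stmp t.+1)) (reg s3 (stmp t))).
      rewrite /s4; congr set_reg; rewrite /s3 /s2 /s1 /= !ne !eqSS !eqxx.
      by rewrite !(ltn_eqF, gtn_eqF) //; lia.
    exact: run_op.
- have [s1 [r1 v1 eE f1 rs1]] := expr_run e t2 rs.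
  have [t3 [s3 [r3 l3 v3 f3 rs3]]] := query_run x t2 rs1.
  exists (expr_cost e + t3), s3; split => //.
  + exact: run_seq r1 r3.
  + by lia.
  + by rewrite v3 v1 eE.
  + by move=> u ut; rewrite f3 ?f1.
Qed.
End Simulation.

(** * Numbers read off bit strings *)

(* Values of the first [M] bits of a string, padded with zeros: [msb] reads the
   first bit as the most significant one, [lsb] as the least significant one. *)
Fixpoint msb (M : nat) (s : seq bool) : nat :=
  if M is M'.+1 then head false s * 2 ^ M' + msb M' (behead s) else 0.

Fixpoint lsb (M : nat) (s : seq bool) : nat :=
  if M is M'.+1 then head false s + 2 * lsb M' (behead s) else 0.

Lemma msb_ltn (M : nat) (s : seq bool) : msb M s < 2 ^ M.
Proof.
elim: M s => [|M IH] s /=; first by rewrite expn0.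
by have := IH (behead s); rewrite expnS; case: (head _ _); lia.
Qed.

Lemma lsb_ltn (M : nat) (s : seq bool) : lsb M s < 2 ^ M.
Proof.
elim: M s => [|M IH] s /=; first by rewrite expn0.
by have := IH (behead s); rewrite expnS; case: (head _ _); lia.
Qed.

Lemma msb_nil (M : nat) : msb M [::] = 0.
Proof. by elim: M => //= M ->. Qed.

Lemma lsb_nil (M : nat) : lsb M [::] = 0.
Proof. by elim: M => //= M ->. Qed.

Lemma drop_behead_S (M : nat) (s : seq bool) : drop M.+1 s = drop M (behead s).
Proof. by case: s. Qed.

Lemma msb_add (a b : nat) (s : seq bool) :
  msb (a + b) s = msb a s * 2 ^ b + msb b (drop a s).
Proof.
elim: a s => [|a IH] s; first by rewrite add0n mul0n add0n drop0.
by rewrite addSn /= IH drop_behead_S expnD; lia.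
Qed.

Lemma lsb_add (a b : nat) (s : seq bool) :
  lsb (a + b) s = lsb a s + 2 ^ a * lsb b (drop a s).
Proof.
elim: a s => [|a IH] s; first by rewrite add0n expn0 mul1n add0n drop0.
by rewrite addSn /= IH drop_behead_S expnS; lia.
Qed.

Lemma packed_wordE (w : nat) (s : seq bool) (j : nat) :
  packed_word w s j = lsb w (drop (j * w) s).
Proof.
rewrite /packed_word; under eq_bigr do rewrite -nth_drop.
move: (drop _ _) => u; elim: w u => [|w IH] u; first by rewrite big_ord0.
rewrite big_ord_recl /= expn0 muln1 nth0 -IH big_distrr /=; congr addn.
by apply: eq_bigr => i _; rewrite /bump /= add1n expnS nth_behead; lia.
Qed.

Lemma lsb_take (M L : nat) (s : seq bool) : lsb M (take L s) = lsb (minn M L) s.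
Proof.
elim: M L s => [|M IH] [|L] s //=; first by rewrite take0 lsb_nil.
by rewrite minnSS; case: s => [|x s] /=; rewrite ?lsb_nil // IH.
Qed.

Lemma lsb_modn (M L : nat) (s : seq bool) : L <= M -> lsb M s %% 2 ^ L = lsb L s.
Proof.
move=> LM; rewrite -(subnKC LM) lsb_add addnC mulnC modnMDl modn_small //.
exact: lsb_ltn.
Qed.

Lemma lsb_divn (M L : nat) (s : seq bool) :
  L <= M -> lsb M s %/ 2 ^ L = lsb (M - L) (drop L s).
Proof.
move=> LM; rewrite -{1}(subnKC LM) lsb_add addnC mulnC divnMDl ?expn_gt0 //.
by rewrite divn_small ?addn0 // lsb_ltn.
Qed.

Lemma lsb0_msb0 (M : nat) (s : seq bool) : lsb M s = 0 -> msb M s = 0.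
Proof.
elim: M s => //= M IH s H; rewrite IH; last lia.
by move: H; case: (head _ _).
Qed.

Lemma msb_take1 (M : nat) (s : seq bool) : msb M.+1 (take M s) = 2 * msb M s.
Proof.
elim: M s => [|M IH] s; first by rewrite take0 msb_nil.
case: s => [|x s]; first by rewrite !msb_nil.
have beS k y u : msb k.+1 (y :: u) = y * 2 ^ k + msb k u by [].
by rewrite take_cons !beS IH expnS; lia.
Qed.

(* Recurrence filling the bit-reversal table [lsb d s |-> msb d s]. *)
Lemma msb_lsb_rec (d : nat) (s : seq bool) (u := take d (behead s)) :
  lsb d.+1 u = lsb d.+1 s %/ 2 /\
  msb d.+1 s = (lsb d.+1 s %% 2) * 2 ^ d + msb d.+1 u %/ 2.
Proof.
split; last first.
  rewrite msb_take1 /= mulKn //; congr (_ * _ + _).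
  by case: (head _ _); lia.
by rewrite lsb_take (minn_idPr (leqnSn d)) /=; case: (head _ _); lia.
Qed.

Lemma extract_bits (w q L x : nat) (s : seq bool) :
  x = lsb w (drop (q %/ w * w) s) -> q %% w + L <= w ->
  (x %/ 2 ^ (q %% w)) %% 2 ^ L = lsb L (drop q s).
Proof.
move=> -> qL; rewrite lsb_divn; last lia.
by rewrite drop_drop addnC -divn_eq lsb_modn //; lia.
Qed.

(** The high bits of [x] from position [q %% w] on become the low ones, and the left shift, taken
    modulo [2 ^ w], puts the first [q %% w] bits of [y] exactly above them. The sum has no carry and
    is the word that starts at bit [q]. *)
Lemma extract_bits_cross (w q L x y : nat) (s : seq bool) :
  0 < w -> L <= w ->
  x = lsb w (drop (q %/ w * w) s) -> y = lsb w (drop ((q %/ w).+1 * w) s) ->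
  (x %/ 2 ^ (q %% w) + (y * 2 ^ (w - q %% w)) %% 2 ^ w) %% 2 ^ w %% 2 ^ L
  = lsb L (drop q s).
Proof.
move=> w0 Lw -> ->; have qw : q %% w < w by rewrite ltn_mod.
rewrite lsb_divn; last exact: ltnW.
rewrite drop_drop [q %% w + _]addnC -divn_eq.
have -> Y : (Y * 2 ^ (w - q %% w)) %% 2 ^ w = (Y %% 2 ^ (q %% w)) * 2 ^ (w - q %% w).
  by rewrite muln_modl -expnD subnKC // ltnW.
rewrite lsb_modn; last exact: ltnW.
have -> : (q %/ w).+1 * w = (w - q %% w) + q.
  by rewrite mulSn {3}(divn_eq q w); lia.
rewrite -drop_drop [_ * 2 ^ (w - _)]mulnC -lsb_add subnK; last exact: ltnW.
by rewrite lsb_modn // lsb_modn.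
Qed.

(** Padding with zeros hides only the length. If the values agree, then [s] is a proper prefix of
    [t] when it is shorter, and [t] is a prefix of [s] otherwise; so the sizes settle a tie. *)
Lemma lexi_ltn_msb (M : nat) (s t : seq bool) : size t <= M ->
  ((s : seqlexi bool) < t)%O =
  (msb M (take (size t) s) < msb M t) ||
  ((msb M (take (size t) s) == msb M t) && (size s < size t)).
Proof.
elim: M s t => [|M IH] s [|y t] //= tM; first by rewrite ltxis0.
  by rewrite ltxis0 take0 msb_nil ltnn andbF.
case: s => [|x s] /=.
  rewrite msb_nil mul0n add0n ltxi0s; by case: (y * 2 ^ M + msb M t).
rewrite ltxi_cons ltnS IH //; set u := msb M _; set v := msb M t.
have := msb_ltn M (take (size t) s); have := msb_ltn M t; rewrite -/u -/v.
by case: x; case: y => //=; rewrite ?mul1n ?mul0n ?add0n ?ltn_add2l ?eqn_add2l //; lia.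
Qed.

Lemma msb_inj_prefix (M : nat) (s t : seq bool) : size t <= M ->
  msb M (take (size t) s) = msb M t -> size t <= size s -> prefix t s.
Proof.
elim: M s t => [|M IH] s [|y t] //= tM; case: s => [|x s] //= H; rewrite ltnS => ts.
have := msb_ltn M (take (size t) s); have := msb_ltn M t.
by move: H; case: x; case: y => //= H H1 H2; (try (rewrite IH //; lia)); lia.
Qed.

(** The strings with prefix [t] form an interval of the lexicographic order beginning at [t]. Hence
    only the first suffix not below a pattern has to be tested for an occurrence. *)
Lemma prefix_lexi_between (s s' t : seq bool) :
  ((t : seqlexi bool) <= s)%O -> ((s : seqlexi bool) <= s')%O ->
  prefix t s' -> prefix t s.
Proof.
elim: t s s' => [|y t IH] [|x s] [|x' s'] //; rewrite ?prefix_cons ?lexis0 //.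
rewrite !lexi_cons => /andP[yx H1] /andP[xx' H2] /= /andP[/eqP yx' H3].
move: yx xx' H1 H2; rewrite -yx'.
by case: y {yx'} ; case: x => //= _ _ H1 H2; exact: IH H1 H2 H3.
Qed.

Lemma lexi_prefix (s t : seq bool) :
  prefix t s -> ((t : seqlexi bool) <= s)%O.
Proof.
elim: t s => [|y t IH] [|x s] //= /andP[/eqP-> H].
by rewrite lexi_cons lexx IH.
Qed.

(** * Radix sort *)

Arguments eval_op : simpl never.
Arguments msb : simpl never.
Arguments lsb : simpl never.

Declare Scope prog_scope.
Delimit Scope prog_scope with P.
Notation "c1 ;; c2" := (HSeq c1 c2)
  (at level 69, right associativity) : prog_scope.
Notation "x <~ e" := (HSet x e) (at level 68, no associativity) : prog_scope.
Notation "'#' x" := (EVar x) (at level 1, format "# x") : prog_scope.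
Notation "x + y" := (EOp OAdd x y) : prog_scope.
Notation "x - y" := (EOp OSub x y) : prog_scope.
Notation "x * y" := (EOp OMul x y) : prog_scope.
Notation "x / y" := (EOp ODiv x y) : prog_scope.
Notation "x < y" := (EOp OLt x y) : prog_scope.

Section Ops.
Variables (w : nat) (g : nat -> nat).
Implicit Types s : state.

Lemma op_add x y : x + y < 2 ^ w -> eval_op w OAdd x y = x + y.
Proof. exact: modn_small. Qed.

Lemma op_sub x y : y <= x -> x < 2 ^ w -> eval_op w OSub x y = x - y.
Proof.
move=> yx xw; rewrite /eval_op addnBA; last by lia.
by rewrite addnC -addnBA // modnDl modn_small //; lia.
Qed.

Lemma op_mul x y : x * y < 2 ^ w -> eval_op w OMul x y = x * y.
Proof. exact: modn_small. Qed.

Lemma op_shl x y : x * 2 ^ y < 2 ^ w -> eval_op w OShl x y = x * 2 ^ y.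
Proof. exact: modn_small. Qed.

Lemma eval_num v s : v < 2 ^ w -> eval w (ENum v) s = v.
Proof. exact: modn_small. Qed.

Lemma hexec_seq c1 c2 s : hexec w g (HSeq c1 c2) s = hexec w g c2 (hexec w g c1 s).
Proof. by []. Qed.

Lemma hexec_set v x e s : eval w e s = v -> hexec w g (HSet x e) s = set_reg s x v.
Proof. by move=> /= ->. Qed.

Lemma hexec_true e c1 c2 s : eval w e s != 0 ->
  hexec w g (HIf e c1 c2) s = hexec w g c1 s.
Proof. by move=> /= ->. Qed.

Lemma hexec_false e c1 c2 s : eval w e s = 0 ->
  hexec w g (HIf e c1 c2) s = hexec w g c2 s.
Proof. by move=> /= ->. Qed.

Lemma hexec_for (P : nat -> state -> Prop) x y c s :
  P 0 s ->
  (forall i s', i < reg s y -> P i s' -> P i.+1 (hexec w g c (set_reg s' x i))) ->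
  P (reg s y) (hexec w g (HFor x y c) s).
Proof. by move=> P0 PS; apply: iteri_ind. Qed.

End Ops.

(* Variables and arrays are numerals rather than constants, so that comparing
   them computes. *)
Local Notation v_n := 0 (only parsing). Local Notation v_w := 1 (only parsing).
Local Notation v_k := 2 (only parsing). Local Notation v_m := 3 (only parsing).
Local Notation v_d := 4 (only parsing). Local Notation v_D := 5 (only parsing).
Local Notation v_nch := 6 (only parsing). Local Notation v_nw := 7 (only parsing).
Local Notation v_nwT := 8 (only parsing). Local Notation v_h := 9 (only parsing).
Local Notation v_S := 10 (only parsing). Local Notation v_nS := 11 (only parsing).

Local Notation c_base := 20 (only parsing). Local Notation c_pos := 21 (only parsing).
Local Notation c_rem := 22 (only parsing). Local Notation c_idx := 23 (only parsing).
Local Notation c_val := 24 (only parsing). Local Notation c_off := 25 (only parsing).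
Local Notation c_len := 26 (only parsing). Local Notation c_bit := 27 (only parsing).
Local Notation c_word := 28 (only parsing).

Local Notation a_text := 2 (only parsing). Local Notation a_pat := 3 (only parsing).
Local Notation a_rev := 4 (only parsing). Local Notation a_ord := 5 (only parsing).
Local Notation a_cnt := 6 (only parsing). Local Notation a_out := 7 (only parsing).

(* [c_val] := the digit number [c_idx] of the string of length [c_rem] that
   starts at bit [c_pos] after word [c_base] of array [a]. *)
Definition digit_prog (a : nat) : hcmd :=
  (c_off <~ #c_idx * #v_d ;;
   HIf (#c_off < #c_rem)
    (HIf (#v_d < #c_rem - #c_off) (c_len <~ #v_d) (c_len <~ #c_rem - #c_off) ;;
     c_bit <~ #c_pos + #c_off ;;
     c_word <~ #c_base + #c_bit / #v_w ;;
     c_bit <~ EOp OMod #c_bit #v_w ;;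
     c_val <~ EOp OShr (EGet a #c_word) #c_bit ;;
     HIf (#v_w < #c_bit + #c_len)
       (c_val <~ #c_val + EOp OShl (EGet a (#c_word + ENum 1)) (#v_w - #c_bit))
       HSkip ;;
     c_val <~ EGet a_rev (EOp OMod #c_val (EOp OShl (ENum 1) #c_len)))
    (c_val <~ ENum 0))%P.

(** Entry 0 is stored beforehand: the recurrence reads entry 0 when it computes entry 0 itself, and
    memory is not initialized. *)
Definition rev_prog : hcmd :=
  (HStore a_rev (ENum 0) (ENum 0) ;;
   HFor 12 v_D
     (HStore a_rev #12
        (EOp OShl (EOp OMod #12 (ENum 2)) (#v_d - ENum 1)
         + EOp OShr (EGet a_rev (EOp OShr #12 (ENum 1))) (ENum 1))))%P.

Definition stored (w a base : nat) (S : seq bool) (s : state) : Prop :=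
  forall j, j < num_words w (size S) ->
  Defs.mem s a (base + j) = packed_word w S j.

Definition rev_table (d : nat) (s : state) : Prop :=
  forall u, Defs.mem s a_rev (lsb d u) = msb d u.

Lemma num_words_ltn (w len q : nat) : 0 < w -> q < len -> q %/ w < num_words w len.
Proof.
move=> w0 qn; rewrite /num_words ltn_divLR //.
have := divn_eq (len + w.-1) w; have := ltn_pmod (len + w.-1) w0; lia.
Qed.

Lemma digit_prog_exec (w : nat) (g : nat -> nat) (a base p r j d : nat)
    (S : seq bool) (s : state) :
  0 < d < w -> size S < 2 ^ w -> base + num_words w (size S) <= 2 ^ w ->
  p + r <= size S -> j * d < 2 ^ w ->
  reg s v_w = w -> reg s v_d = d -> reg s c_base = base -> reg s c_pos = p ->
  reg s c_rem = r -> reg s c_idx = j ->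
  stored w a base S s -> rev_table d s ->
  reg (hexec w g (digit_prog a) s) c_val
  = msb d (drop (j * d) (take r (drop p S))).
Proof.
move=> /andP[d0 dw] Sw bw pr jd rw rd rb rp rr rj st rv.
have ww : w < 2 ^ w by exact: ltn_expl.
have w1 : 1 < 2 ^ w by apply: leq_ltn_trans ww; lia.
rewrite /digit_prog hexec_seq (@hexec_set _ _ (j * d)); last first.
  by rewrite /= rj rd op_mul.
case: (ltnP (j * d) r) => jr; last first.
  rewrite hexec_false; last by rewrite /= rr /eval_op /= ltnNge jr.
  rewrite (@hexec_set _ _ 0) ?eval_num ?expn_gt0 //=.
  by rewrite drop_oversize ?msb_nil // size_take; case: ifP => ?; lia.
rewrite hexec_true; last by rewrite /= rr /eval_op jr.
set L := minn d (r - j * d); set q := p + j * d.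
set s1 := set_reg s c_off (j * d).
have ev_rem : eval w (#c_rem - #c_off)%P s1 = r - j * d.
  by rewrite /= rr op_sub //; lia.
rewrite hexec_seq.
have -> : hexec w g (HIf (#v_d < #c_rem - #c_off)
    (c_len <~ #v_d) (c_len <~ #c_rem - #c_off))%P s1 = set_reg s1 c_len L.
  case: (ltnP d (r - j * d)) => dr.
    rewrite hexec_true; last by rewrite [eval _ _ _]/= -/(eval w (#c_rem - #c_off)%P s1) ev_rem rd /eval_op dr.
    by apply: hexec_set; rewrite /= rd /L (minn_idPl _) // ltnW.
  rewrite hexec_false; last first.
    by rewrite [eval _ _ _]/= -/(eval w (#c_rem - #c_off)%P s1) ev_rem rd /eval_op ltnNge dr.
  by apply: hexec_set; rewrite ev_rem /L (minn_idPr _).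
have Ld : L <= d by exact: geq_minl.
have Lr : L <= r - j * d by exact: geq_minr.
have L0 : 0 < L by rewrite /L leq_min d0 subn_gt0.
have qS : q < size S by rewrite /q; lia.
have qLS : q + L <= size S by rewrite /q; lia.
have w0 : 0 < w by lia.
have qw := num_words_ltn w0 qS.
rewrite hexec_seq (@hexec_set _ _ q); last first.
  by rewrite /= rp op_add //; exact: ltn_trans qS Sw.
rewrite hexec_seq (@hexec_set _ _ (base + q %/ w)); last first.
  by rewrite /= rb rw op_add // /eval_op; lia.
rewrite hexec_seq (@hexec_set _ _ (q %% w)); last by rewrite /= rw.
have rw' : q %% w < w by rewrite ltn_mod.
rewrite hexec_seq (@hexec_set _ _ (packed_word w S (q %/ w) %/ 2 ^ (q %% w))); last first.
  by rewrite /= st.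
have drE : drop (j * d) (take r (drop p S)) = take (r - j * d) (drop q S).
  by rewrite /q addnC -drop_drop [RHS]take_drop subnK // ltnW.
rewrite hexec_seq; set s2 := set_reg _ c_val _.
have ww2 : 2 * w <= 2 ^ w.
  by case: (w) w0 => // w' _; rewrite expnS leq_mul2l ltn_expl.
have ev_len : eval w (#c_bit + #c_len)%P s2 = q %% w + L.
  by rewrite /= op_add //; lia.
set c3 := HIf _ _ _; set s3 := hexec w g c3 s2.
have s3v : reg s3 c_val %% 2 ^ L = lsb L (drop q S).
  case: (leqP (q %% w + L) w) => qLw.
    rewrite /s3 hexec_false /=; last first.
      by rewrite -/(eval w (#c_bit + #c_len)%P s2) ev_len rw /eval_op ltnNge qLw.
    by apply: extract_bits => //; exact: packed_wordE.
  (* The last bit [q + L - 1] of the digit lies in the next word and inside the string, so that word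
     belongs to the packed string. *)
  have qw1 : (q %/ w).+1 < num_words w (size S).
    apply: leq_ltn_trans (num_words_ltn (q := q + L - 1) w0 _); last by lia.
    by rewrite leq_divRL //; have := divn_eq q w; lia.
  rewrite /s3 hexec_true; last first.
    by rewrite [eval _ _ _]/= -/(eval w (#c_bit + #c_len)%P s2) ev_len rw /eval_op qLw.
  rewrite (@hexec_set _ _ ((packed_word w S (q %/ w) %/ 2 ^ (q %% w) +
     (packed_word w S (q %/ w).+1 * 2 ^ (w - q %% w)) %% 2 ^ w) %% 2 ^ w)); last first.
    rewrite [LHS]/= rw op_sub //; last lia.
    rewrite (modn_small w1) (@op_add w (base + _)); last by lia.
    by rewrite -addnA addn1 st.
  by apply: extract_bits_cross => //; rewrite ?packed_wordE //; lia.
have [s3L s3m] : reg s3 c_len = L /\ Defs.mem s3 a_rev = Defs.mem s a_rev.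
  by split; [rewrite /s3 hexec_reg | rewrite /s3 hexec_mem].
move: s3 s3v s3L s3m => s3 s3v s3L s3m.
(* A short last digit needs no table of its own: its [L] bits give the same table index as the
   string cut there and padded with zeros to [d] bits. *)
rewrite (@hexec_set _ _ (msb d (take (r - j * d) (drop q S)))) ?drE //=.
rewrite s3L s3m (modn_small w1) op_shl ?mul1n ?ltn_exp2l //; last lia.
by rewrite -rv; congr (Defs.mem s a_rev _); rewrite lsb_take -/L -s3v.
Qed.

Lemma rev_prog_exec (w : nat) (g : nat -> nat) (d : nat) (s : state) :
  0 < d < w -> reg s v_d = d -> reg s v_D = 2 ^ d ->
  rev_table d (hexec w g rev_prog s).
Proof.
case: d => // d dw rd rD.
have ww : w < 2 ^ w by exact: ltn_expl.
have w1 : 1 < 2 ^ w by apply: leq_ltn_trans ww; lia.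
have w2 : 2 < 2 ^ w by apply: leq_ltn_trans ww; lia.
have dw2 : 2 ^ d.+1 < 2 ^ w by rewrite ltn_exp2l.
rewrite /rev_prog hexec_seq; set s0 := hexec _ _ _ s.
set c := HStore a_rev (EVar 12) _.
pose P i s' := (forall u, lsb d.+1 u < maxn 1 i ->
    Defs.mem s' a_rev (lsb d.+1 u) = msb d.+1 u) /\ reg s' v_d = d.+1.
have P0 : P 0 s0.
  split=> // u; rewrite ltnS leqn0 => /eqP u0.
  by rewrite u0 lsb0_msb0 // /s0 /= mod0n.
have [i s' |H _] := @hexec_for w g P 12 v_D c s0 P0; last first.
  by move=> u; apply: H; rewrite leq_max rD lsb_ltn orbT.
rewrite [reg s0 _]rD => iD [IH rd']; split; last by [].
move=> u; rewrite (maxn_idPr _) // ltnS leq_eqVlt => /orP[/eqP ui|ui]; last first.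
  by rewrite /= (ltn_eqF ui) IH // leq_max ui orbT.
rewrite /= ui eqxx (modn_small w1) (modn_small w2) rd' op_sub ?subn1 //; last first.
  exact: ltn_trans ww.
have [v1 v2] := msb_lsb_rec d u.
set u' := take d (behead u) in v1 v2; rewrite ui in v1 v2.
have -> : eval_op w OShr i 1 = lsb d.+1 u' by rewrite v1.
rewrite IH; last first.
  rewrite v1; case: (i) => // i'; rewrite leq_max; apply/orP; right; lia.
have e1 : i %% 2 * 2 ^ d <= 2 ^ d.
  by rewrite -[X in _ <= X]mul1n leq_mul2r -ltnS ltn_mod orbT.
have dd : 2 ^ d.+1 = 2 ^ d + 2 ^ d by rewrite expnS mul2n addnn.
have -> : eval_op w OMod i 2 = i %% 2 by [].
have -> : eval_op w OShr (msb d.+1 u') 1 = msb d.+1 u' %/ 2 by [].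
rewrite op_shl; last by apply: leq_ltn_trans e1 _; apply: leq_ltn_trans dw2; rewrite dd leq_addr.
by rewrite op_add -?v2 //; apply: ltn_trans (msb_ltn _ _) dw2.
Qed.

(** * Counting sort as a permutation of positions *)

Section CountingSort.
Variables (k : nat) (f : nat -> nat).

Definition count_lt (v : nat) : nat := count (fun b => f b < v) (iota 0 k).
Definition count_eq (v i : nat) : nat := count (fun b => f b == v) (iota 0 i).
(** The position that a stable counting sort by [f] gives to element [a]. *)
Definition rank (a : nat) : nat := count_lt (f a) + count_eq (f a) a.

Lemma count_ltS (v : nat) : count_lt v.+1 = count_lt v + count_eq v k.
Proof.
rewrite /count_lt /count_eq; elim: (iota 0 k) => //= b s ->.
by rewrite ltnS; case: ltngtP => _; lia.
Qed.

Lemma count_lt_leq (u v : nat) : u <= v -> count_lt u <= count_lt v.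
Proof. by move=> uv; apply: sub_count => b /= /leq_trans; apply. Qed.

Lemma count_lt_leqk (v : nat) : count_lt v <= k.
Proof. by rewrite -[X in _ <= X](size_iota 0) count_size. Qed.

Lemma count_eqS (v i : nat) : count_eq v i.+1 = count_eq v i + (f i == v).
Proof. by rewrite /count_eq -addn1 iotaD count_cat /= add0n addn0. Qed.

Lemma count_eq_leq (v i j : nat) : i <= j -> count_eq v i <= count_eq v j.
Proof. by move=> ij; rewrite /count_eq -(subnKC ij) iotaD count_cat leq_addr. Qed.

Lemma rank_ltn_count (a : nat) : a < k -> rank a < count_lt (f a).+1.
Proof.
move=> ak; rewrite count_ltS /rank ltn_add2l.
by apply: leq_trans (count_eq_leq _ ak); rewrite count_eqS eqxx addn1.
Qed.

Lemma rank_ltn (a : nat) : a < k -> rank a < k.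
Proof. by move=> ak; apply: leq_trans (rank_ltn_count ak) (count_lt_leqk _). Qed.

Lemma rank_mono (a b : nat) : a < k ->
  (f a < f b) || ((f a == f b) && (a < b)) -> rank a < rank b.
Proof.
move=> ak /orP[fab|/andP[/eqP fab ab]].
  apply: leq_trans (rank_ltn_count ak) _.
  exact: leq_trans (count_lt_leq fab) (leq_addr _ _).
rewrite /rank fab ltn_add2l; apply: leq_trans (count_eq_leq _ ab).
by rewrite count_eqS fab eqxx addn1.
Qed.

Lemma rank_inj (a b : nat) : a < k -> b < k -> rank a = rank b -> a = b.
Proof.
move=> ak bk rab; apply/eqP; apply: contraT => ab.
have [] : (f a < f b) || ((f a == f b) && (a < b)) \/
  (f b < f a) || ((f b == f a) && (b < a)) by lia.
- by move/(rank_mono ak); rewrite rab ltnn.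
- by move/(rank_mono bk); rewrite rab ltnn.
Qed.

Lemma rank_surj (p : nat) : p < k -> exists2 a, a < k & rank a = p.
Proof.
move=> pk; pose r (a : 'I_k) : 'I_k := Ordinal (rank_ltn (ltn_ord a)).
have r_inj : injective r.
  by move=> a b [] rab; apply: val_inj; exact: (rank_inj (ltn_ord a) (ltn_ord b) rab).
exists (invF r_inj (Ordinal pk)) => //.
by have := f_invF r_inj (Ordinal pk) => /(congr1 val).
Qed.

End CountingSort.

Definition sorting (k : nat) (key ord : nat -> nat) : Prop :=
  [/\ forall p, p < k -> ord p < k,
      forall x, x < k -> exists2 p, p < k & ord p = x &
      forall p q, p <= q -> q < k -> key (ord p) <= key (ord q)].

(** One pass of a radix sort that begins with the least significant digit. Since [key] stays below
    [B], different digits decide the order by [key']; among equal digits stability preserves the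
    earlier order by [key]. *)
Lemma sorting_rank (k B : nat) (digit key key' ord ord' : nat -> nat) :
  (forall x, x < k -> key' x = digit x * B + key x) ->
  (forall x, x < k -> key x < B) ->
  (forall a, a < k -> ord' (rank k (fun b => digit (ord b)) a) = ord a) ->
  sorting k key ord -> sorting k key' ord'.
Proof.
set f := fun b => digit (ord b) => key'E keyB ord'E [ordk ordS ordM].
split.
- move=> p /(rank_surj f)[a ak <-]; by rewrite ord'E ?ordk.
- move=> x /ordS[p pk <-]; exists (rank k f p); [exact: rank_ltn | exact: ord'E].
- move=> p q pq qk; have pk := leq_ltn_trans pq qk.
  have [a ak ap] := rank_surj f pk; have [b bk bq] := rank_surj f qk.
  rewrite -ap -bq !ord'E // !key'E ?ordk //.
  have := keyB _ (ordk _ ak).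
  have H : ~~ ((f b < f a) || ((f b == f a) && (b < a))).
    by apply/negP => /(rank_mono bk); rewrite ap bq ltnNge pq.
  have [fab|fab|fab] := ltngtP (f a) (f b).
  + have : (f a).+1 * B <= f b * B by rewrite leq_mul2r fab orbT.
    by rewrite -/(f a) -/(f b) mulSn; lia.
  + by move: H; rewrite fab.
  + rewrite -/(f a) -/(f b) fab leq_add2l => _; apply: ordM => //.
    by move: H; rewrite fab ltnn eqxx /= -leqNgt.
Qed.

(* Variable [x] holds the number of the pattern. *)
Definition pattern_digit (x : nat) : hcmd :=
  (c_base <~ #x * #v_nw ;; c_pos <~ ENum 0 ;; c_rem <~ #v_m ;;
   digit_prog a_pat)%P.

(* Registers 35: number of the pass, 36: loop counter, 37: pattern, 38: running
   sum of the counters, 39: current counter. *)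
Definition count_pass : hcmd :=
  (HFor 36 v_D (HStore a_cnt #36 (ENum 0)) ;;
   c_idx <~ #v_nch - ENum 1 - #35 ;;
   HFor 36 v_k
     (37 <~ EGet a_ord #36 ;; pattern_digit 37 ;;
      HStore a_cnt #c_val (EGet a_cnt #c_val + ENum 1)) ;;
   38 <~ ENum 0 ;;
   HFor 36 v_D
     (39 <~ EGet a_cnt #36 ;; HStore a_cnt #36 #38 ;; 38 <~ #38 + #39))%P.

Definition place_pass : hcmd :=
  (HFor 36 v_k
     (37 <~ EGet a_ord #36 ;; pattern_digit 37 ;;
      HStore a_out (EGet a_cnt #c_val) #37 ;;
      HStore a_cnt #c_val (EGet a_cnt #c_val + ENum 1)) ;;
   HFor 36 v_k (HStore a_ord #36 (EGet a_out #36)))%P.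

Definition sort_prog : hcmd :=
  (HFor 12 v_k (HStore a_ord #12 #12) ;;
   HFor 35 v_nch (count_pass ;; place_pass))%P.

(** [m_leq] and [m_gtn] together say that [nch] is [m / d] rounded up. So every digit starts inside
    the pattern, and its offset fits into a word. *)
Record sizes (w n k m d nch nw h : nat) (T : seq bool) (P : nat -> seq bool)
    : Prop := Sizes {
  n_ltn : n < 2 ^ w;
  k_ltn : k < 2 ^ w;
  m_ltn : m < 2 ^ w;
  m_gt0 : 0 < m;
  d_gt0 : 0 < d;
  d_ltn : d < w;
  h_ltn : h < w;
  nch_gt0 : 0 < nch;
  m_leq : m <= nch * d;
  m_gtn : (nch - 1) * d < m;
  nwE : nw = num_words w m;
  dict_leq : k * nw <= 2 ^ w;
  text_size : size T = n;
  pattern_size : forall i, i < k -> size (P i) = m }.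

(** All that stays fixed during sorting and searching lies in variables below 12 and arrays below 5;
    commands that change only later ones preserve it, which [env_hexec] checks by computation. *)
Record env (w n k m d nch nw h : nat) (T : seq bool) (P : nat -> seq bool)
    (s : state) : Prop := Env {
  env_n : reg s v_n = n;
  env_w : reg s v_w = w;
  env_k : reg s v_k = k;
  env_m : reg s v_m = m;
  env_d : reg s v_d = d;
  env_D : reg s v_D = 2 ^ d;
  env_nch : reg s v_nch = nch;
  env_nw : reg s v_nw = nw;
  env_h : reg s v_h = h;
  env_S : reg s v_S = 2 ^ h;
  env_text : stored w a_text 0 T s;
  env_pattern : forall i, i < k -> stored w a_pat (i * nw) (P i) s;
  env_rev : rev_table d s }.

Section Sort.
Variables (w n k m d nch nw h : nat) (T : seq bool) (P : nat -> seq bool).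
Hypothesis sz : sizes w n k m d nch nw h T P.
Variable g : nat -> nat.
Local Notation envs := (env w n k m d nch nw h T P).
Local Notation hex := (hexec w g).

Lemma env_hexec (c : hcmd) (s : state) :
  all (leq 12) (hassigned c) -> all (leq 5) (hwritten c) -> envs s -> envs (hex c s).
Proof.
move=> /allP hr /allP hm [*].
have rE x : x < 12 -> reg (hex c s) x = reg s x.
  by move=> x12; apply: hexec_reg; apply/negP => /hr; rewrite leqNgt x12.
have mE a : a < 5 -> Defs.mem (hex c s) a = Defs.mem s a.
  by move=> a5; apply: hexec_mem; apply/negP => /hm; rewrite leqNgt a5.
by constructor; rewrite ?rE // /stored /rev_table mE.
Qed.

Lemma env_set (x v : nat) (s : state) : 12 <= x -> envs s -> envs (set_reg s x v).
Proof. by do 12?[case: x => [//|x]] => _ [*]; constructor. Qed.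

Lemma word_gt1 : 1 < w.
Proof. by have := d_gt0 sz; have := d_ltn sz; lia. Qed.

Lemma two_ltn : 2 < 2 ^ w.
Proof. by rewrite -{1}(expn1 2) ltn_exp2l // word_gt1. Qed.

Lemma evaln (v : nat) : v <= 2 -> v %% 2 ^ w = v.
Proof. by move=> v2; rewrite modn_small //; apply: leq_ltn_trans two_ltn. Qed.

Definition digit (j x : nat) : nat := msb d (drop (j * d) (P x)).
(** The value of the last [i] digits: the key by which the patterns are sorted after [i] passes, and
    the part of a string that has been compared after [i] rounds of [compare_prog]. *)
Definition low_value (i : nat) (S : seq bool) : nat :=
  msb (i * d) (drop ((nch - i) * d) S).
Definition low_key (i x : nat) : nat := low_value i (P x).

Lemma low_valueS (i : nat) (S : seq bool) : i < nch ->
  low_value i.+1 S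
  = msb d (drop ((nch - 1 - i) * d) S) * 2 ^ (i * d) + low_value i S.
Proof.
move=> inch; rewrite /low_value mulSn msb_add drop_drop -mulSn -subnDA add1n.
by congr (_ + msb _ (drop (_ * d) _)); lia.
Qed.

Lemma pattern_digit_exec (x j i : nat) (s : state) :
  envs s ->
  reg s x = i -> i < k -> reg s c_idx = j -> j < nch ->
  reg (hex (pattern_digit x) s) c_val = digit j i.
Proof.
move=> [e1 e2 e3 e4 e5 e6 e7 e8 e9 eS et ep er] xi ik sj jn.
have inw : i * nw + nw <= 2 ^ w.
  by apply: leq_trans (dict_leq sz); rewrite -mulSnr leq_mul2r ik orbT.
have nw_gt0 : 0 < nw.
  by rewrite (nwE sz) /num_words divn_gt0; have := m_gt0 sz; have := d_ltn sz; lia.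
rewrite /pattern_digit hexec_seq (@hexec_set _ _ (i * nw)); last first.
  by rewrite /= xi e8 op_mul //; lia.
rewrite hexec_seq (@hexec_set _ _ 0); last by rewrite /= mod0n.
rewrite hexec_seq (@hexec_set _ _ m); last by rewrite /= e4.
have Psz := pattern_size sz ik.
have jdm : j * d < m.
  apply: leq_ltn_trans (m_gtn sz); rewrite leq_mul2r; apply/orP; right; lia.
rewrite (@digit_prog_exec w g a_pat (i * nw) 0 m j d (P i)) ?Psz //.
- by rewrite drop0 -Psz take_size.
- by rewrite (d_gt0 sz) (d_ltn sz).
- exact: m_ltn sz.
- by rewrite -(nwE sz).
- exact: ltn_trans jdm (m_ltn sz).
- exact: ep.
Qed.

Lemma load_digit_exec (a j : nat) (s : state)
    (s' := hex (pattern_digit 37) (hex (37 <~ EGet a_ord #36)%P s)) :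
  envs s -> reg s 36 = a -> Defs.mem s a_ord a < k -> reg s c_idx = j -> j < nch ->
  reg s' c_val = digit j (Defs.mem s a_ord a) /\ reg s' 37 = Defs.mem s a_ord a.
Proof.
move=> es s36 ak sj jn.
have s1_37 : reg (hex (37 <~ EGet a_ord #36)%P s) 37 = Defs.mem s a_ord a.
  by rewrite /= s36.
split; last by rewrite /s' hexec_reg.
by apply: pattern_digit_exec => //; apply: env_hexec.
Qed.

Lemma nch_ltn : nch < 2 ^ w.
Proof.
apply: leq_ltn_trans (m_ltn sz); rewrite -(subnK (nch_gt0 sz)) addn1.
by apply: leq_ltn_trans (m_gtn sz); rewrite leq_pmulr // (d_gt0 sz).
Qed.

Lemma digit_ltn (j x : nat) : digit j x < 2 ^ d.
Proof. exact: msb_ltn. Qed.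

Lemma count_pass_exec (i : nat) (s : state) (j := nch - 1 - i)
    (f := fun a => digit j (Defs.mem s a_ord a)) (s' := hex count_pass s) :
  envs s -> reg s 35 = i -> i < nch -> (forall a, a < k -> Defs.mem s a_ord a < k) ->
  [/\ envs s', Defs.mem s' a_ord = Defs.mem s a_ord, reg s' c_idx = j &
      forall v, v < 2 ^ d -> Defs.mem s' a_cnt v = count_lt k f v].
Proof.
move=> es s35 inch ordk.
have jn : j < nch by rewrite /j; lia.
have kw := k_ltn sz; have w2 := two_ltn; have dw : 2 ^ d < 2 ^ w.
  by rewrite ltn_exp2l // (d_ltn sz).
rewrite {}/s' /count_pass hexec_seq; set s1 := hexec _ _ _ s.
have [es1 o1 r1 c1] : [/\ envs s1, Defs.mem s1 a_ord = Defs.mem s a_ord,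
    reg s1 35 = i & forall v, v < 2 ^ d -> Defs.mem s1 a_cnt v = 0].
  split; [by rewrite /s1; apply: env_hexec | by rewrite /s1 hexec_mem | by rewrite /s1 hexec_reg |].
  rewrite -(env_D es).
  apply: (@hexec_for w g (fun i s' => forall v, v < i -> Defs.mem s' a_cnt v = 0)) => // b s' _ IH v.
  by rewrite ltnS leq_eqVlt => /orP[/eqP->|vb] /=; rewrite ?eqxx ?mod0n // (ltn_eqF vb) IH.
rewrite hexec_seq (@hexec_set _ _ j); last first.
  by rewrite /= (env_nch es1) r1 evaln // !op_sub //; have := nch_ltn; lia.
set s2 := set_reg s1 _ _.
have es2 : envs s2 by exact: env_set.
rewrite hexec_seq; set s3 := hexec _ _ _ s2.
have [es3 o3 j3 c3] : [/\ envs s3, Defs.mem s3 a_ord = Defs.mem s a_ord,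
    reg s3 c_idx = j & forall v, v < 2 ^ d -> Defs.mem s3 a_cnt v = count_eq f v k].
  rewrite -{2}(env_k es2).
  apply: (@hexec_for w g (fun b s' => [/\ envs s', Defs.mem s' a_ord = Defs.mem s a_ord,
    reg s' c_idx = j & forall v, v < 2 ^ d -> Defs.mem s' a_cnt v = count_eq f v b])) => // b s'.
  rewrite (env_k es2) => bk [es' o' j' c']; set t0 := set_reg s' 36 b.
  have et0 : envs t0 by exact: env_set.
  have := @load_digit_exec b j t0 et0 erefl; rewrite [Defs.mem t0 _]o' => /(_ (ordk _ bk) j' jn).
  rewrite -/(f b); set t2 := hex (pattern_digit 37) _ => -[t2v _].
  rewrite hexec_seq hexec_seq -/t2.
  have t2m a : a \in [:: a_ord; a_cnt] -> Defs.mem t2 a = Defs.mem s' a.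
    by rewrite !inE => /orP[]/eqP->; rewrite /t2 !hexec_mem.
  have et2 : envs t2 by rewrite /t2; do 2!apply: env_hexec => //.
  split.
  - exact: env_hexec.
  - by rewrite hexec_mem // t2m.
  - by rewrite hexec_reg // /t2 !hexec_reg.
  - move=> v vd; rewrite /= t2v t2m // evaln // count_eqS eq_sym; case: eqP => [<-|_].
      rewrite c' ?digit_ltn // op_add //.
      by apply: leq_ltn_trans kw; rewrite addn1; apply: leq_ltn_trans _ bk;
         rewrite -[X in _ <= X](size_iota 0) count_size.
    by rewrite addn0 c'.
rewrite hexec_seq (@hexec_set _ _ 0) ?evaln //; last by rewrite /= mod0n.
set s4 := set_reg s3 _ _.
have es4 : envs s4 by exact: env_set.
set s5 := hexec _ _ _ s4.
split; [by rewrite /s5; apply: env_hexec | by rewrite /s5 hexec_mem | by rewrite /s5 hexec_reg |].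
(* The prefix sums are formed in place: cells below the loop counter already hold starting
   positions, the others still hold frequencies. *)
suff [_ _ H] : [/\ envs s5, reg s5 38 = count_lt k f (2 ^ d) & forall v, v < 2 ^ d ->
    Defs.mem s5 a_cnt v = if v < 2 ^ d then count_lt k f v else count_eq f v k].
  by move=> v vd; rewrite H // vd.
rewrite -{1 3}(env_D es4).
apply: (@hexec_for w g (fun b s' => [/\ envs s', reg s' 38 = count_lt k f b & forall v, v < 2 ^ d ->
    Defs.mem s' a_cnt v = if v < b then count_lt k f v else count_eq f v k])) => [|b s'].
  by split=> //; rewrite /count_lt; under eq_count do rewrite ltn0; rewrite count_pred0.
rewrite (env_D es4) => bD [es' r' c']; split.
- by apply: env_hexec => //; apply: env_set.
- rewrite /= c' // ltnn r' op_add ?count_ltS //.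
  by rewrite -count_ltS; apply: leq_ltn_trans (count_lt_leqk _ _ _) kw.
- move=> v vd; rewrite /= ltnS; case: (ltngtP v b) => [vb|vb|->].
  + by rewrite c' // vb.
  + by rewrite c' // ltnNge (ltnW vb).
  + by rewrite r'.
Qed.
Lemma place_pass_exec (j : nat) (s : state)
    (f := fun a => digit j (Defs.mem s a_ord a)) (s' := hex place_pass s) :
  envs s -> reg s c_idx = j -> j < nch -> (forall a, a < k -> Defs.mem s a_ord a < k) ->
  (forall v, v < 2 ^ d -> Defs.mem s a_cnt v = count_lt k f v) ->
  envs s' /\ forall a, a < k -> Defs.mem s' a_ord (rank k f a) = Defs.mem s a_ord a.
Proof.
move=> es sj jn ordk cnt.
have kw := k_ltn sz; have w2 := two_ltn; have dw : 2 ^ d < 2 ^ w.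
  by rewrite ltn_exp2l // (d_ltn sz).
rewrite {}/s' /place_pass hexec_seq; set s1 := hexec _ _ _ s.
have [es1 o1 _ _ out1] : [/\ envs s1, Defs.mem s1 a_ord = Defs.mem s a_ord,
    reg s1 c_idx = j,
    forall v, v < 2 ^ d -> Defs.mem s1 a_cnt v = count_lt k f v + count_eq f v k &
    forall a, a < k -> Defs.mem s1 a_out (rank k f a) = Defs.mem s a_ord a].
  rewrite -{3 4}(env_k es).
  apply: (@hexec_for w g (fun b s' => [/\ envs s', Defs.mem s' a_ord = Defs.mem s a_ord,
    reg s' c_idx = j,
    forall v, v < 2 ^ d -> Defs.mem s' a_cnt v = count_lt k f v + count_eq f v b &
    forall a, a < b -> Defs.mem s' a_out (rank k f a) = Defs.mem s a_ord a])).
    by split=> // v vd; rewrite cnt // addn0.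
  move=> b s'; rewrite (env_k es) => bk [es' o' j' c' out']; set t0 := set_reg s' 36 b.
  have et0 : envs t0 by exact: env_set.
  have := @load_digit_exec b j t0 et0 erefl; rewrite [Defs.mem t0 _]o' => /(_ (ordk _ bk) j' jn).
  rewrite -/(f b); set t2 := hex (pattern_digit 37) _ => -[t2v t2x].
  rewrite hexec_seq hexec_seq -/t2 hexec_seq.
  have t2m a : a \in [:: a_ord; a_cnt; a_out] -> Defs.mem t2 a = Defs.mem s' a.
    by rewrite !inE => /or3P[]/eqP->; rewrite /t2 !hexec_mem.
  have et2 : envs t2 by rewrite /t2; do 2!apply: env_hexec => //.
  (* Each counter holds the next free place of its bucket. After the earlier elements with the same
     digit, this is the rank of [b]; ranks are distinct, so no earlier entry of the output is
     overwritten. *)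
  have rankE : Defs.mem t2 a_cnt (f b) = rank k f b.
    by rewrite t2m // c' ?digit_ltn.
  split.
  - by do 2!apply: env_hexec => //.
  - by rewrite !hexec_mem // t2m.
  - by rewrite !hexec_reg // /t2 !hexec_reg.
  - move=> v vd; rewrite /= t2v t2m // evaln // count_eqS eq_sym; case: eqP => [<-|_].
      rewrite c' ?digit_ltn // op_add ?addnA //.
      by apply: leq_ltn_trans kw; rewrite addn1; exact: rank_ltn.
    by rewrite addn0 c'.
  - move=> a; rewrite ltnS leq_eqVlt => /orP[/eqP->|ab].
      by rewrite /= t2v rankE t2x eqxx.
    rewrite /= t2v rankE t2m // ifN; first exact: out'.
    by apply/eqP => /(rank_inj (ltn_trans ab bk) bk) eab; rewrite eab ltnn in ab.
set s2 := hexec _ _ _ s1; have es2 : envs s2 by rewrite /s2; apply: env_hexec.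
split=> // a ak.
suff [H _] : (forall p, p < k -> Defs.mem s2 a_ord p = Defs.mem s1 a_out p) /\
    Defs.mem s2 a_out = Defs.mem s1 a_out.
  by rewrite H ?out1 //; exact: rank_ltn.
rewrite -{1}(env_k es1).
apply: (@hexec_for w g (fun b s' => (forall p, p < b -> Defs.mem s' a_ord p = Defs.mem s1 a_out p) /\
    Defs.mem s' a_out = Defs.mem s1 a_out)) => // b s' _ [IH o']; split=> // p.
by rewrite ltnS leq_eqVlt => /orP[/eqP->|pb] /=; rewrite ?eqxx ?o' // (ltn_eqF pb) IH.
Qed.

Lemma sort_prog_exec (s : state) (s' := hex sort_prog s) :
  envs s ->
  envs s' /\ sorting k (fun x => msb (nch * d) (P x)) (Defs.mem s' a_ord).
Proof.
move=> es; rewrite {}/s' /sort_prog hexec_seq; set s1 := hexec _ _ _ s.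
have es1 : envs s1 by rewrite /s1; apply: env_hexec.
have o1 : forall p, p < k -> Defs.mem s1 a_ord p = p.
  rewrite -(env_k es).
  apply: (@hexec_for w g (fun b s' => forall p, p < b -> Defs.mem s' a_ord p = p)) => // b s' _ IH p.
  by rewrite ltnS leq_eqVlt => /orP[/eqP->|pb] /=; rewrite ?eqxx // (ltn_eqF pb) IH.
set s2 := hexec _ _ _ s1.
suff [es2 s2s] : envs s2 /\ sorting k (low_key nch) (Defs.mem s2 a_ord).
  split=> //; move: s2s; rewrite /sorting => -[H1 H2 H3]; split=> // p q pq qk.
  by have := H3 p q pq qk; rewrite /low_key /low_value subnn !mul0n !drop0.
rewrite -{2}(env_nch es1).
apply: (@hexec_for w g (fun i s' => envs s' /\ sorting k (low_key i) (Defs.mem s' a_ord))) => [|i s'].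
  split=> //; split=> [p pk|x xk|p q _ _].
  - by rewrite o1.
  - by exists x => //; rewrite o1.
  - by rewrite /low_key /low_value !mul0n.
rewrite (env_nch es1) => inch [es' so']; set t0 := set_reg s' 35 i.
have ordk : forall a, a < k -> Defs.mem t0 a_ord a < k by case: so'.
have et0 : envs t0 by exact: env_set.
have [et1 ot1 jt1 ct1] := @count_pass_exec i t0 et0 erefl inch ordk.
rewrite hexec_seq; move: et1 ot1 jt1 ct1; set t1 := hexec _ _ _ t0 => et1 ot1 jt1 ct1.
have jn : nch - 1 - i < nch by lia.
have := @place_pass_exec _ t1 et1 jt1 jn; rewrite ot1 => /(_ ordk ct1)[et2 ot2].
split=> //; apply: sorting_rank ot2 so'.
- by move=> x xk; exact: low_valueS.
- by move=> x _; exact: msb_ltn.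
Qed.
End Sort.

(** * Searching the suffix array *)

(* Registers 30 and 31: start and length of the string; the same ones are used
   below for the suffix returned by a query, cut after [m] bits. *)
Definition text_digit : hcmd :=
  (c_base <~ ENum 0 ;; c_pos <~ #30 ;; c_rem <~ #31 ;; digit_prog a_text)%P.

(* The loop goes from the last digit to the first, so the latest difference
   decides. Register 32 holds [cmp_code] of the parts seen so far. *)
Definition compare_prog : hcmd :=
  (32 <~ ENum 0 ;;
   HFor 33 v_nch
     (c_idx <~ #v_nch - ENum 1 - #33 ;;
      text_digit ;; 34 <~ #c_val ;; pattern_digit 16 ;;
      HIf (#34 < #c_val) (32 <~ ENum 1)
        (HIf (#c_val < #34) (32 <~ ENum 2) HSkip)))%P.

(* Compares the suffix of rank [#17 + #18] with pattern number [#16]: sets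
   [#19] to whether that rank exists and the suffix is smaller, and [#15] to 1
   if the pattern is a prefix of the suffix. *)
Definition probe_prog : hcmd :=
  (19 <~ ENum 0 ;;
   HIf (#v_n - #17 < #18) HSkip
     (HQuery 30 (#17 + #18) ;;
      30 <~ #30 - ENum 1 ;;
      HIf (#v_m < #v_n - #30) (31 <~ #v_m) (31 <~ #v_n - #30) ;;
      compare_prog ;;
      HIf (EOp OEq #32 (ENum 1)) (19 <~ ENum 1)
        (HIf (EOp OEq #32 (ENum 0))
          (HIf (#31 < #v_m) (19 <~ ENum 1) (15 <~ ENum 1)) HSkip)))%P.

Section Search.
Variables (w n k m d nch nw h : nat) (T : seq bool) (P : nat -> seq bool).
Hypothesis sz : sizes w n k m d nch nw h T P.
Variable g : nat -> nat.
Hypothesis g_range : forall r, 0 < r <= n -> 0 < g r <= n.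
Local Notation envs := (env w n k m d nch nw h T P).
Local Notation hex := (hexec w g).

Definition ranked_suffix (r : nat) : seq bool := drop (g r).-1 T.
Definition below (i r : nat) : bool :=
  ((ranked_suffix r : seqlexi bool) < P i)%O.

Definition cmp_code (x y : nat) : nat :=
  if x < y then 1 else if y < x then 2 else 0.

Lemma num_words_leq (x : nat) : 0 < w -> num_words w x <= x.
Proof.
move=> w0; rewrite /num_words -ltnS ltn_divLR // mulSn.
have : x <= x * w by rewrite leq_pmulr.
lia.
Qed.

Lemma text_digit_exec (p r j : nat) (s : state) :
  envs s -> reg s 30 = p -> reg s 31 = r -> p + r <= n ->
  reg s c_idx = j -> j < nch ->
  reg (hex text_digit s) c_val = msb d (drop (j * d) (take r (drop p T))).
Proof.
move=> [e1 e2 e3 e4 e5 e6 e7 e8 e9 eS et ep er] sp sr pr sj jn.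
have w0 : 0 < w by have := word_gt1 sz; lia.
rewrite /text_digit hexec_seq (@hexec_set _ _ 0); last by rewrite /= mod0n.
rewrite hexec_seq (@hexec_set _ _ p) // hexec_seq (@hexec_set _ _ r) //.
have jdm : j * d < m.
  apply: leq_ltn_trans (m_gtn sz); rewrite leq_mul2r; apply/orP; right; lia.
have Tsz := text_size sz; have nw2 := n_ltn sz.
apply: (@digit_prog_exec w g a_text 0 p r j d T) => //; rewrite ?Tsz //.
- by rewrite (d_gt0 sz) (d_ltn sz).
- by apply: leq_trans (num_words_leq _ w0) (ltnW nw2).
- exact: ltn_trans jdm (m_ltn sz).
Qed.

Lemma compare_prog_exec (p r i : nat) (s : state) (U := take r (drop p T)) :
  envs s -> reg s 30 = p -> reg s 31 = r -> p + r <= n ->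
  reg s 16 = i -> i < k ->
  reg (hex compare_prog s) 32 = cmp_code (msb (nch * d) U) (msb (nch * d) (P i)).
Proof.
move=> es sp sr pr si ik; rewrite /compare_prog hexec_seq.
rewrite (@hexec_set _ _ 0); last by rewrite /= mod0n.
set s1 := set_reg s 32 0.
have es1 : envs s1 by exact: env_set.
pose Q t s' := [/\ envs s', reg s' 30 = p, reg s' 31 = r, reg s' 16 = i &
  reg s' 32 = cmp_code (low_value d nch t U) (low_value d nch t (P i))].
have Q0 : Q 0 s1 by split; rewrite // /low_value !mul0n.
set c := HSeq _ _.
have [t s'|_ _ _ _] := @hexec_for w g Q 33 v_nch c s1 Q0; last first.
  by rewrite (env_nch es1) /low_value subnn !mul0n !drop0.
rewrite (env_nch es1) => tn [es' p' r' i' c'].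
set s2 := set_reg s' 33 t.
have es2 : envs s2 by exact: env_set.
set j := nch - 1 - t; have jn : j < nch by rewrite /j; lia.
have cE : reg (hex c s2) 32 =
    cmp_code (low_value d nch t.+1 U) (low_value d nch t.+1 (P i)).
  rewrite /c hexec_seq (@hexec_set _ _ j); last first.
    rewrite /= (env_nch es') (evaln sz) // !op_sub //; have := nch_ltn sz; lia.
  set s3 := set_reg s2 c_idx j.
  have es3 : envs s3 by exact: env_set.
  rewrite hexec_seq; have := @text_digit_exec p r j s3 es3 p' r' pr erefl jn.
  set s4 := hexec _ _ text_digit s3 => s4v.
  have es4 : envs s4 by rewrite /s4; apply: env_hexec.
  rewrite hexec_seq (@hexec_set _ _ (msb d (drop (j * d) U))) //.
  set s5 := set_reg s4 34 _.
  have es5 : envs s5 by exact: env_set.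
  have s5i : reg s5 16 = i by rewrite /s5 [LHS]/= /s4 hexec_reg.
  have s5j : reg s5 c_idx = j by rewrite /s5 [LHS]/= /s4 hexec_reg.
  rewrite hexec_seq; have := @pattern_digit_exec _ _ _ _ _ _ _ _ _ _ sz g 16 j i s5 es5 s5i ik s5j jn.
  set s6 := hexec _ _ (pattern_digit 16) s5 => s6v.
  have s6t : reg s6 34 = msb d (drop (j * d) U) by rewrite /s6 hexec_reg.
  have s6c : reg s6 32 = cmp_code (low_value d nch t U) (low_value d nch t (P i)).
    by rewrite /s6 hexec_reg // /s5 [LHS]/= /s4 hexec_reg.
  move: s6 s6v s6t s6c => s6 s6v s6t s6c.
  rewrite /= s6t s6v (evaln sz) // (evaln sz) //.
  rewrite !low_valueS // -/j /digit.
  move: s6c; set x := msb d _; set y := msb d _; set u := low_value _ _ _ _.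
  set v := low_value _ _ _ _ => s6c.
  have ub : u < 2 ^ (t * d) by exact: msb_ltn.
  have vb : v < 2 ^ (t * d) by exact: msb_ltn.
  set B := 2 ^ (t * d) in ub vb *.
  rewrite /eval_op /cmp_code; case: (ltngtP x y) => xy /=.
  - have : x.+1 * B <= y * B by rewrite leq_mul2r xy orbT.
    by rewrite mulSn => H; rewrite ifT //; lia.
  - have : y.+1 * B <= x * B by rewrite leq_mul2r xy orbT.
    by rewrite mulSn => H; rewrite ifF ?ifT //; lia.
  - by rewrite s6c /cmp_code xy !ltn_add2l.
split=> //.
- by apply: env_hexec.
- by rewrite hexec_reg.
- by rewrite hexec_reg.
- by rewrite hexec_reg.
Qed.
End Search.

Section Probe.
Variables (w n k m d nch nw h : nat) (T : seq bool) (P : nat -> seq bool).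
Hypothesis sz : sizes w n k m d nch nw h T P.
Variable g : nat -> nat.
Hypothesis g_range : forall r, 0 < r <= n -> 0 < g r <= n.
Local Notation envs := (env w n k m d nch nw h T P).
Local Notation hex := (hexec w g).
Local Notation ranked_suffix := (ranked_suffix T g).
Local Notation below := (below T P g).

Definition found (i r : nat) : bool := prefix (P i) (ranked_suffix r).

Lemma below_cmp (i r : nat) (M := nch * d) : i < k ->
  below i r = (msb M (take m (ranked_suffix r)) < msb M (P i))
    || ((msb M (take m (ranked_suffix r)) == msb M (P i)) && (size (ranked_suffix r) < m)).
Proof.
by move=> ik; have Psz := pattern_size sz ik;
   rewrite /below (@lexi_ltn_msb M) Psz // (m_leq sz).
Qed.

(** With [below_cmp]: on a tie, a suffix shorter than [m] is below the pattern and any other starts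
    with it. One comparison thus serves both the search and the test for an occurrence. *)
Lemma found_cmp (i r : nat) (M := nch * d) : i < k ->
  found i r = (msb M (take m (ranked_suffix r)) == msb M (P i)) && (m <= size (ranked_suffix r)).
Proof.
move=> ik; have Psz := pattern_size sz ik.
apply/idP/andP => [pf|[/eqP eP ms]].
  by split; [move: pf; rewrite /found prefixE Psz => /eqP-> | rewrite -Psz size_prefix].
by apply: (@msb_inj_prefix M); rewrite Psz // (m_leq sz).
Qed.

Lemma probe_prog_exec (l st i : nat) (s : state) (s' := hex probe_prog s) :
  envs s -> reg s 17 = l -> reg s 18 = st -> reg s 16 = i -> i < k ->
  l <= n -> 0 < st ->
  reg s' 19 = (l + st <= n) && below i (l + st) :> nat /\
  reg s' 15 = if (l + st <= n) && found i (l + st) then 1 else reg s 15.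
Proof.
move=> es sl sst si ik ln st0.
have nw2 := n_ltn sz.
rewrite {}/s' /probe_prog hexec_seq (@hexec_set _ _ 0); last by rewrite /= mod0n.
set s1 := set_reg s 19 0.
have es1 : envs s1 by exact: env_set.
(* The test for [l + st <= n] is made as [st <= n - l], so that the sum is formed only when it fits
   into a word. *)
have range : eval w (#v_n - #17 < #18)%P s1 = ~~ (l + st <= n).
  rewrite /= (env_n es) sl sst op_sub // /eval_op -ltnNge; congr nat_of_bool; lia.
case: (boolP (l + st <= n)) => lst; last first.
  by rewrite hexec_true ?range ?lst.
rewrite hexec_false ?range ?lst // {range}.
set r := l + st.
have rn : 0 < r <= n by rewrite /r; lia.
have /andP[gr0 grn] := g_range rn.
rewrite hexec_seq; set s2 := hexec _ _ _ s1.
have s2E : s2 = set_reg s1 30 (g r).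
  by rewrite /s2 /= sl sst op_add //; lia.
have es2 : envs s2 by rewrite s2E; exact: env_set.
move: s2 s2E es2 => s2 s2E es2.
(* Suffix positions count from 1, bit positions of the text from 0. *)
set p := (g r).-1.
rewrite hexec_seq (@hexec_set _ _ p); last first.
  by rewrite s2E /= (evaln sz) // op_sub ?subn1 //; lia.
set s3 := set_reg s2 30 p.
have es3 : envs s3 by exact: env_set.
have ssz : size (ranked_suffix r) = n - p by rewrite size_drop (text_size sz).
set e := minn m (n - p).
rewrite hexec_seq; set s4 := hexec _ _ _ s3.
have s4E : s4 = set_reg s3 31 e.
  have nE : eval_op w OSub n p = n - p by rewrite op_sub //; lia.
  have [H|H] := ltnP m (n - p).
    have -> : e = m by rewrite /e (minn_idPl _) // ltnW.
    by rewrite /s4 /= (env_n es2) (env_m es2) nE /eval_op H.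
  have -> : e = n - p by rewrite /e (minn_idPr _).
  by rewrite /s4 /= (env_n es2) (env_m es2) nE /eval_op ltnNge H.
have es4 : envs s4 by rewrite s4E; exact: env_set.
have s4p : reg s4 30 = p by rewrite s4E.
have s4e : reg s4 31 = e by rewrite s4E.
have s4i : reg s4 16 = i by rewrite s4E /s3 s2E.
have pe : p + e <= n by rewrite /p /e; lia.
rewrite hexec_seq; have := compare_prog_exec sz g es4 s4p s4e pe s4i ik.
set s5 := hexec _ _ compare_prog s4 => s5c.
have s5e : reg s5 31 = e by rewrite /s5 hexec_reg.
have s5m : reg s5 v_m = m by rewrite /s5 hexec_reg // (env_m es4).
have s5a : reg s5 15 = reg s 15 by rewrite /s5 hexec_reg // s4E /s3 s2E.
have s5r : reg s5 19 = 0 by rewrite /s5 hexec_reg // s4E /s3 s2E.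
have takeE : take e (drop p T) = take m (ranked_suffix r).
  rewrite /e -ssz /minn; case: ifP => // H.
  by rewrite [RHS]take_oversize ?take_size //; lia.
rewrite takeE in s5c.
have eE : (e < m) = (size (ranked_suffix r) < m) by rewrite /e ssz; lia.
move: s5 s5c s5e s5m s5a s5r => s5 s5c s5e s5m s5a s5r.
rewrite below_cmp // found_cmp // (leqNgt m) -eE.
rewrite /= s5c s5e s5m !(evaln sz) // /cmp_code.
set x := msb _ (take _ _); set y := msb _ _.
by case: (ltngtP x y) => xy; rewrite /eval_op /= ?s5a ?s5r //; case: (e < m);
   rewrite /= ?s5a ?s5r ?(evaln sz).
Qed.
End Probe.

(** Register 17 is a lower bound for the number of suffixes below the pattern, to which halved
    strides are added while it remains one. The final probe inspects the next rank, where an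
    occurrence must show. *)
Definition refine_prog : hcmd :=
  (HFor 12 v_h
     (18 <~ EOp OShr #18 (ENum 1) ;; probe_prog ;;
      HIf #19 (17 <~ #17 + #18) HSkip) ;;
   18 <~ ENum 1 ;; probe_prog)%P.

(* Registers 13: pointer into the suffix array, 14: index into the sorted
   patterns, 15: answer. *)
Definition step_prog : hcmd :=
  HIf (#14 < #v_k)%P
    (16 <~ EGet a_ord #14 ;; 17 <~ #13 ;; 18 <~ #v_S ;; probe_prog ;;
     HIf #19 (13 <~ #13 + #v_S) (refine_prog ;; 14 <~ #14 + ENum 1))%P
    HSkip.

Arguments probe_prog : simpl never.
Arguments refine_prog : simpl never.

(* Each step either advances [#13] by a stride or finishes a pattern, so the
   two loops together suffice. A single loop could overflow its bound. *)
Definition main_prog : hcmd :=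
  (13 <~ ENum 0 ;; 14 <~ ENum 0 ;; 15 <~ ENum 0 ;;
   HFor 40 v_nS step_prog ;; HFor 40 v_k step_prog)%P.

(** A downward closed set of ranks is an initial segment of [[1..n]], so membership compares the
    rank with the size of the set. *)
Lemma count_downclosed (p : pred nat) (n r : nat) :
  (forall r r', 0 < r -> r <= r' -> r' <= n -> p r' -> p r) ->
  0 < r <= n -> p r = (r <= count p (iota 1 n)).
Proof.
elim: n => [|n IH] pd; first by case: r.
have -> : iota 1 n.+1 = iota 1 n ++ [:: n.+1] by rewrite -[n.+1]addn1 iotaD add1n addn1.
rewrite count_cat /= addn0 => /andP[r0 rn].
have cn : count p (iota 1 n) <= n by rewrite -[X in _ <= X](size_iota 1) count_size.
case: (boolP (p n.+1)) => pn.
  have -> : count p (iota 1 n) = n.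
    rewrite -[RHS](size_iota 1); apply/eqP; rewrite -all_count; apply/allP => x.
    by rewrite mem_iota => xn; apply: pd pn => //; lia.
  by rewrite addn1 rn; apply: pd pn => //; lia.
rewrite addn0; move: rn; rewrite leq_eqVlt => /orP[/eqP rn|rn].
  by rewrite rn (negPf pn); lia.
apply: IH => [x y x0 xy yn|]; last by rewrite r0.
by apply: pd => //; exact: ltnW.
Qed.

(** * Invariants and correctness of the sweep *)

Section Main.
Variables (w n k m d nch nw h : nat) (T : seq bool) (P : nat -> seq bool).
Hypothesis sz : sizes w n k m d nch nw h T P.
Variable g : nat -> nat.
Hypothesis g_range : forall r, 0 < r <= n -> 0 < g r <= n.
Hypothesis g_sorted : forall r r', 0 < r -> r <= r' -> r' <= n ->
  ((ranked_suffix T g r : seqlexi bool) <= ranked_suffix T g r')%O.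
Hypothesis g_surj : forall p, 0 < p <= n -> exists2 r, 0 < r <= n & g r = p.
Local Notation envs := (env w n k m d nch nw h T P).
Local Notation hex := (hexec w g).
Local Notation ranked_suffix := (ranked_suffix T g).
Local Notation below := (below T P g).
Local Notation found := (found T P g).

Definition num_below (i : nat) : nat := count (below i) (iota 1 n).

Lemma belowE (i r : nat) : 0 < r -> (r <= n) && below i r = (r <= num_below i).
Proof.
move=> r0; case: (leqP r n) => rn /=.
  apply: (@count_downclosed (below i) n r) => [x y x0 xy yn|]; last by rewrite r0.
  by apply: le_lt_trans; exact: g_sorted.
apply/esym/negbTE; rewrite -ltnNge; apply: leq_ltn_trans rn.
by rewrite -[X in _ <= X](size_iota 1) count_size.
Qed.

Lemma num_below_leq (i : nat) : num_below i <= n.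
Proof. by rewrite -[X in _ <= X](size_iota 1) count_size. Qed.

(** Larger patterns are inserted no earlier. This is why sorting the patterns lets one pointer serve
    them all without moving back. *)
Lemma num_below_mono (i j : nat) : i < k -> j < k ->
  msb (nch * d) (P i) <= msb (nch * d) (P j) -> num_below i <= num_below j.
Proof.
move=> ik jk ij; apply: sub_count => r.
by rewrite /mem /= !(below_cmp sz) //; lia.
Qed.

Lemma found_infix (i r : nat) : found i r -> infix (P i) T.
Proof.
rewrite /found /ranked_suffix => /prefixP[s' E].
by apply/infixP; exists (take (g r).-1 T), s'; rewrite -E cat_take_drop.
Qed.

(** The suffix that starts at an occurrence has some rank [r] above [num_below i]. The suffix of
    rank [num_below i + 1] then lies between the pattern and that suffix, hence it also starts with
    the pattern. *)
Lemma infix_found (i : nat) : i < k -> infix (P i) T ->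
  (num_below i < n) && found i (num_below i).+1.
Proof.
move=> ik /infixP[s1 [s2 TE]].
have Psz := pattern_size sz ik; have m0 := m_gt0 sz.
have s1n : 0 < (size s1).+1 <= n.
  by rewrite -(text_size sz) TE !size_cat Psz /= -addn1 leq_add2l addn_gt0 m0.
have [r rn gr] := g_surj s1n.
have fr : found i r.
  by rewrite /found /ranked_suffix gr TE drop_size_cat // prefix_prefix.
have r0 : 0 < r by case/andP: rn.
have nb x : 0 < x -> ~~ below i x = ((P i : seqlexi bool) <= ranked_suffix x)%O.
  by move=> x0; rewrite /below -leNgt.
have rC : num_below i < r.
  rewrite ltnNge -belowE //; apply/negP => /andP[_]; apply/negP.
  by rewrite nb //; exact: lexi_prefix.
have Cn : num_below i < n by case/andP: rn => _; exact: leq_trans rC.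
rewrite Cn /=; apply: prefix_lexi_between fr; last by apply: g_sorted; case/andP: rn.
rewrite -nb //; apply/negP => H.
have := belowE i (ltn0Sn (num_below i)); rewrite Cn H ltnn //.
Qed.

(** A probe may hit an occurrence before its pattern is finished, so answer 1 promises some
    occurring pattern, not one among the first [idx]. *)
Definition verdict (ord : nat -> nat) (idx : nat) (s : state) : Prop :=
  reg s 15 = 1 /\ (exists2 i, i < k & infix (P i) T) \/
  reg s 15 = 0 /\ (forall q, q < idx -> ~~ infix (P (ord q)) T).

Lemma probe_exec (ord : nat -> nat) (idx l st i : nat) (s : state)
    (s' := hex probe_prog s) :
  envs s -> reg s 17 = l -> reg s 18 = st -> reg s 16 = i -> i < k ->
  l <= n -> 0 < st -> verdict ord idx s ->
  [/\ envs s', reg s' 19 = (l + st <= num_below i) :> nat, verdict ord idx s' &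
      (l + st <= n) && found i (l + st) -> reg s' 15 = 1].
Proof.
move=> es sl sst si ik ln st0 vs.
have [p19 p15] := probe_prog_exec sz g_range es sl sst si ik ln st0.
split.
- by apply: env_hexec.
- by rewrite p19 belowE // addn_gt0 st0 orbT.
- rewrite /verdict p15; case: ifP => [/andP[_ /found_infix f]|//].
  by left; split => //; exists i.
- by rewrite p15 => ->.
Qed.
Lemma refine_prog_exec (ord : nat -> nat) (idx l i : nat) (s : state)
    (s' := hex refine_prog s) :
  envs s -> reg s 17 = l -> reg s 18 = 2 ^ h -> reg s 16 = i -> i < k ->
  l <= num_below i < l + 2 ^ h -> verdict ord idx s ->
  [/\ envs s', verdict ord idx s' & infix (P i) T -> reg s' 15 = 1].
Proof.
move=> es sl sS si ik lC vs; have nw2 := n_ltn sz; have w2 := two_ltn sz.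
rewrite {}/s' /refine_prog hexec_seq; set s1 := hexec _ _ _ s.
have [es1 s1i vs1 s1l] : [/\ envs s1, reg s1 16 = i, verdict ord idx s1 &
    reg s1 17 = num_below i].
  (* Every round halves the range that contains the insertion point; after [h] rounds a single value
     is left. *)
  pose Q t s' := [/\ envs s', reg s' 16 = i, verdict ord idx s' &
    reg s' 18 = 2 ^ (h - t) /\
    reg s' 17 <= num_below i < reg s' 17 + 2 ^ (h - t)].
  suff : Q h s1.
    by rewrite /Q subnn expn0 => -[? ? ? [_ H]]; split => //; lia.
  rewrite -{1}(env_h es); apply: hexec_for; first by rewrite /Q subn0 sl.
  rewrite (env_h es) => t s' th [es' i' v' [st' l']].
  set t0 := set_reg s' 12 t.
  have stE : 2 ^ (h - t) = 2 * 2 ^ (h - t.+1).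
    by rewrite -expnS; congr (2 ^ _); lia.
  rewrite hexec_seq (@hexec_set _ _ (2 ^ (h - t.+1))); last first.
    by rewrite /= st' (evaln sz) // /eval_op expn1 stE mulKn.
  set t1 := set_reg t0 18 _.
  have et1 : envs t1 by do 2!apply: env_set => //.
  have t1l : reg t1 17 <= n by have := num_below_leq i; rewrite /t1 /=; lia.
  have vt1 : verdict ord idx t1 by [].
  have := probe_exec et1 erefl erefl i' ik t1l (expn_gt0 2 _) vt1.
  rewrite hexec_seq; set t2 := hexec _ _ probe_prog t1 => -[et2 r2 v2 _].
  have [t2l t2s t2i] : [/\ reg t2 17 = reg s' 17, reg t2 18 = 2 ^ (h - t.+1) & reg t2 16 = i].
    by rewrite /t2 !hexec_reg.
  move: t2 et2 r2 v2 t2l t2s t2i => t2 et2.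
  rewrite [reg t1 17]/= [reg t1 18]/= => r2 v2 t2l t2s t2i.
  case: (leqP (reg s' 17 + 2 ^ (h - t.+1)) (num_below i)) r2 => H r2.
    rewrite hexec_true /= ?r2 // t2l t2s op_add; last by have := num_below_leq i; lia.
    by split=> //; first exact: env_set; split=> //=; rewrite ?t2s //; lia.
  by rewrite hexec_false //; split=> //; split=> //; rewrite t2l; lia.
rewrite hexec_seq (@hexec_set _ _ 1); last by rewrite /= (evaln sz).
set s2 := set_reg s1 18 1; have es2 : envs s2 by exact: env_set.
have vs2 : verdict ord idx s2 by [].
have [es3 _ v3 H3] := probe_exec es2 s1l erefl s1i ik (num_below_leq i) isT vs2.
split=> // /(infix_found ik); rewrite -addn1; exact: H3.
Qed.

(** A potential argument: [q] counts the strides taken and register 14 the finished patterns, and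
    each step raises one of the two until all patterns are finished. As the pointer [q * 2 ^ h]
    never exceeds [n], the number of steps is bounded. *)
Definition progress (ord : nat -> nat) (it : nat) (s : state) : Prop :=
  [/\ envs s, Defs.mem s a_ord = ord, reg s 14 <= k,
      verdict ord (reg s 14) s &
      exists q, [/\ reg s 13 = q * 2 ^ h, reg s 13 <= n,
        reg s 14 < k -> reg s 13 <= num_below (ord (reg s 14)) &
        reg s 14 = k \/ it <= q + reg s 14]].

Lemma step_prog_exec (ord : nat -> nat) (it : nat) (s : state) :
  sorting k (fun x => msb (nch * d) (P x)) ord ->
  progress ord it s -> progress ord it.+1 (hex step_prog s).
Proof.
move=> [ordk _ ordM] [es so idxk vs [q [loq lon loC prog]]].
have nw2 := n_ltn sz; have w2 := two_ltn sz; have kw := k_ltn sz.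
rewrite /step_prog; case: (ltnP (reg s 14) k) => idx; last first.
  rewrite hexec_false; last by rewrite /= (env_k es) /eval_op ltnNge idx.
  rewrite -[hex HSkip s]/s; split => //; exists q; split => //; left; lia.
rewrite hexec_true; last by rewrite /= (env_k es) /eval_op idx.
set i := ord (reg s 14); have ik : i < k by exact: ordk.
rewrite hexec_seq (@hexec_set _ _ i); last by rewrite /= so.
rewrite hexec_seq (@hexec_set _ _ (reg s 13)) //.
rewrite hexec_seq (@hexec_set _ _ (2 ^ h)); last by rewrite /= (env_S es).
set s1 := set_reg _ 18 _.
have es1 : envs s1 by do 3!apply: env_set => //.
have vs1 : verdict ord (reg s 14) s1 by [].
have := probe_exec es1 erefl erefl erefl ik lon (expn_gt0 2 _) vs1.
rewrite hexec_seq; set s2 := hexec _ _ probe_prog s1 => -[es2 r2 v2 _].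
have [x13 x14 [x16 x17 x18] xo] : [/\ reg s2 13 = reg s 13, reg s2 14 = reg s 14,
    [/\ reg s2 16 = i, reg s2 17 = reg s 13 & reg s2 18 = 2 ^ h] &
    Defs.mem s2 a_ord = ord].
  by rewrite /s2 !hexec_reg // hexec_mem.
move: s2 es2 r2 v2 x13 x14 x16 x17 x18 xo => s2 es2.
rewrite [reg s1 17]/= [reg s1 18]/= => r2 v2 x13 x14 x16 x17 x18 xo.
case: (leqP (reg s 13 + 2 ^ h) (num_below i)) r2 => H r2.
  have Hn := leq_trans H (num_below_leq i).
  rewrite hexec_true /= ?r2 // x13 (env_S es2) op_add; last by lia.
  split; rewrite /= ?x14 //; first exact: env_set.
  by exists q.+1; rewrite mulSn -loq [2 ^ h + _]addnC.
rewrite hexec_false; last by rewrite /= r2.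
rewrite hexec_seq.
have lC : reg s 13 <= num_below i < reg s 13 + 2 ^ h by rewrite loC.
have := refine_prog_exec es2 x17 x18 x16 ik lC v2.
set s3 := hexec _ _ refine_prog s2 => -[es3 v3 H3].
have [y13 y14 yo] : [/\ reg s3 13 = reg s 13, reg s3 14 = reg s 14 &
    Defs.mem s3 a_ord = ord].
  by rewrite /s3 !hexec_reg // hexec_mem.
move: s3 es3 v3 H3 y13 y14 yo => s3 es3 v3 H3 y13 y14 yo.
have nE : eval w (#14 + ENum 1)%P s3 = (reg s 14).+1.
  by rewrite /= y14 (evaln sz) // op_add ?addn1 //; lia.
rewrite (hexec_set _ _ nE).
split; rewrite /= //; first exact: env_set.
- case: v3 => [[v3 ex]|[v3 all]]; [by left | right; split=> // p].
  rewrite ltnS leq_eqVlt => /orP[/eqP->|/all //].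
  by apply/negP => /H3; rewrite v3.
- exists q; rewrite y13; split=> //; last by case: prog => ?; [lia | right; lia].
  (* The next pattern is not smaller, so the pointer is also a lower bound for its insertion
     point. *)
  move=> idx'; apply: leq_trans (loC idx) _; apply: num_below_mono => //; first exact: ordk.
  exact: ordM.
Qed.

Lemma main_prog_exec (nS : nat) (s : state) (s' := hex main_prog s) :
  envs s -> reg s v_nS = nS -> n < nS * 2 ^ h ->
  sorting k (fun x => msb (nch * d) (P x)) (Defs.mem s a_ord) ->
  (reg s' 15 = 1 /\ exists2 i, i < k & infix (P i) T) \/
  (reg s' 15 = 0 /\ forall i, i < k -> ~~ infix (P i) T).
Proof.
move=> es snS nnS so; set ord := Defs.mem s a_ord in so *.
rewrite {}/s' /main_prog hexec_seq (@hexec_set _ _ 0); last by rewrite /= mod0n.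
rewrite hexec_seq (@hexec_set _ _ 0); last by rewrite /= mod0n.
rewrite hexec_seq (@hexec_set _ _ 0); last by rewrite /= mod0n.
set s1 := set_reg _ 15 0.
have es1 : envs s1 by do 3!apply: env_set => //.
have p1 : progress ord 0 s1.
  split=> //; first by right.
  by exists 0; split=> //; right.
have setP it x s0 : progress ord it s0 -> progress ord it (set_reg s0 40 x).
  by case=> *; split=> //; exact: env_set.
rewrite hexec_seq; set s2 := hexec _ _ _ s1.
have p2 : progress ord nS s2.
  have <- : reg s1 v_nS = nS by [].
  apply: (@hexec_for w g (progress ord)) => // i t _ pt.
  by apply: step_prog_exec => //; exact: setP.
set s3 := hexec _ _ _ s2.
have [_ _ k3 v3 [q [e13 l13 _ pr]]] : progress ord (nS + k) s3.
  have k2 : reg s2 v_k = k by case: p2 => -[].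
  rewrite -{1}k2; apply: (@hexec_for w g (fun i => progress ord (nS + i))).
    by rewrite addn0.
  by move=> i t _ pt; rewrite addnS; apply: step_prog_exec => //; exact: setP.
have qS : q < nS.
  by rewrite -(ltn_pmul2r (expn_gt0 2 h)) -e13; exact: leq_ltn_trans nnS.
have e14 : reg s3 14 = k by case: pr => //; lia.
case: v3 => [|[v3 all]]; [by left | right; split=> // i ik].
case: so => _ /(_ i ik)[p pk <-] _; apply: all; rewrite e14 //.
Qed.
End Main.

(** * The Dictionary Matching algorithm *)

(** For want of a logarithm instruction, [v_h] is counted up until [2 ^ v_h] reaches [w]. The
    quotients of the form [(x - 1) / y + 1] round up, the one for [v_nS] exceeds [n / v_S]. *)
Definition param_prog (e : nat) : hcmd :=
  (v_d <~ #v_w / ENum (2 ^ e) + ENum 1 ;;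
   v_D <~ EOp OShl (ENum 1) #v_d ;;
   v_nch <~ (#v_m - ENum 1) / #v_d + ENum 1 ;;
   v_nw <~ (#v_m - ENum 1) / #v_w + ENum 1 ;;
   v_nwT <~ (#v_n - ENum 1) / #v_w + ENum 1 ;;
   v_h <~ ENum 0 ;;
   HFor 12 v_w
     (HIf (EOp OShl (ENum 1) #v_h < #v_w) (v_h <~ #v_h + ENum 1) HSkip) ;;
   v_S <~ EOp OShl (ENum 1) #v_h ;;
   v_nS <~ #v_n / #v_S + ENum 1)%P.

(** [build] may destroy its input, while the search reads the text and the patterns afterwards; so
    both are copied to arrays that it does not mention. *)
Definition copy_prog : hcmd :=
  (HFor 12 v_nwT (HStore a_text #12 (EGet 0 #12)) ;;
   HFor 12 v_k
     (HFor 35 v_nw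
        (HStore a_pat (#12 * #v_nw + #35) (EGet 1 (#12 * #v_nw + #35)))))%P.

Lemma num_wordsE (w len : nat) : 0 < w -> 0 < len ->
  num_words w len = (len - 1) %/ w + 1.
Proof.
move=> w0 l0; rewrite /num_words.
have -> : len + w.-1 = 1 * w + (len - 1) by lia.
by rewrite divnMDl // addnC.
Qed.

(* A power of two exceeding the word size is reduced to 0, and then the
   quotient is 0. *)
Definition digit_size (e w : nat) : nat := w %/ (2 ^ e %% 2 ^ w) + 1.

Lemma digit_size_ltn (e w : nat) : 1 < e -> 1 < w -> digit_size e w < w.
Proof.
move=> e1 w1; rewrite /digit_size; case: (ltnP e w) => ew; last first.
  suff -> : 2 ^ e %% 2 ^ w = 0 by rewrite divn0; lia.
  by apply/eqP; rewrite -/(dvdn _ _) dvdn_exp2l.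
rewrite modn_small ?ltn_exp2l //.
have : w %/ 2 ^ e <= w %/ 4 by apply: leq_div2l => //; rewrite -[4]/(2 ^ 2) leq_exp2l.
by move: ew e1 w1; lia.
Qed.

Lemma up_log_word_ltn (w : nat) : 0 < w -> up_log 2 w < w.
Proof. by case: w => // w _; rewrite ltnS up_log_min // ltn_expl. Qed.

Lemma param_prog_exec (e w n k m : nat) (g : nat -> nat) (s : state)
    (d := digit_size e w) (s' := hexec w g (param_prog e) s) :
  1 < e -> 1 < w -> n < 2 ^ w -> k < 2 ^ w -> m < 2 ^ w -> 0 < n -> 0 < m ->
  [/\ reg s v_n = n, reg s v_w = w, reg s v_k = k & reg s v_m = m] ->
  [/\ [/\ reg s' v_n = n, reg s' v_w = w, reg s' v_k = k & reg s' v_m = m],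
    [/\ reg s' v_d = d, reg s' v_D = 2 ^ d, reg s' v_nch = (m - 1) %/ d + 1,
        reg s' v_nw = num_words w m & reg s' v_nwT = num_words w n] &
    [/\ reg s' v_h = up_log 2 w, reg s' v_S = 2 ^ up_log 2 w
      & reg s' v_nS = n %/ 2 ^ up_log 2 w + 1]].
Proof.
move=> e1 w1 nw kw mw n0 m0 [sn sw sk sm].
have dw := digit_size_ltn e1 w1; rewrite -/d in dw.
have ww : w < 2 ^ w by exact: ltn_expl.
have w0 : 0 < w by exact: ltnW.
have one : 1 %% 2 ^ w = 1 by rewrite modn_small //; exact: ltn_trans w1 ww.
have d0 : 0 < d by rewrite /d /digit_size addn1.
have hw := up_log_word_ltn w0; set h := up_log 2 w in hw *.
have kp : [/\ reg s' v_n = n, reg s' v_w = w, reg s' v_k = k & reg s' v_m = m].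
  by rewrite /s' !hexec_reg.
have ltS x y : 0 < x -> x < 2 ^ w -> (x - 1) %/ y + 1 < 2 ^ w.
  by move=> x0 xw; have := leq_div (x - 1) y; lia.
have wd : w %/ (2 ^ e %% 2 ^ w) + 1 < 2 ^ w by exact: ltn_trans dw ww.
split=> //; rewrite {kp}/s' /param_prog.
all: rewrite hexec_seq (@hexec_set _ _ d); last by rewrite /= sw one op_add.
all: rewrite hexec_seq (@hexec_set _ _ (2 ^ d)); last
  by rewrite /= one op_shl ?mul1n // ltn_exp2l.
all: rewrite hexec_seq (@hexec_set _ _ ((m - 1) %/ d + 1)); last
  by rewrite /= one sm op_sub // op_add // ltS.
all: rewrite hexec_seq (@hexec_set _ _ (num_words w m)); last
  by rewrite /= one sm sw op_sub // op_add ?num_wordsE // ltS.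
all: rewrite hexec_seq (@hexec_set _ _ (num_words w n)); last
  by rewrite /= one sn sw op_sub // op_add ?num_wordsE // ltS.
all: rewrite hexec_seq (@hexec_set _ _ 0); last by rewrite /= mod0n.
all: set s1 := set_reg _ v_h 0; rewrite hexec_seq; set s2 := hexec _ _ _ s1.
  by rewrite !hexec_reg.
have s2h : reg s2 v_h = h.
  pose Q i t := reg t v_w = w /\ reg t v_h = minn i h.
  have Q0 : Q 0 s1 by rewrite /Q min0n.
  rewrite /s2; set c := HIf _ _ _.
  have [i t|_] := @hexec_for w g Q 12 v_w c s1 Q0; last first.
    by rewrite [reg s1 _]sw (minn_idPr (ltnW hw)).
  rewrite [reg s1 _]sw => iw [tw th]; split; first by rewrite /c hexec_reg.
  have thh : minn i h < w by rewrite gtn_min iw.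
  have sh : eval w (EOp OShl (ENum 1) #v_h)%P (set_reg t 12 i) = 2 ^ minn i h.
    by rewrite /= one th op_shl ?mul1n // ltn_exp2l.
  have ih : (2 ^ minn i h < w) = (i < h).
    case: (ltnP i h) => ih.
      rewrite ltnNge; apply/negP => /(up_log_min (ltnSn 1)).
      by rewrite -/h leqNgt ih.
    by rewrite ltnNge up_logP.
  have guard : eval w (EOp OShl (ENum 1) #v_h < #v_w)%P (set_reg t 12 i) = (i < h).
    by rewrite -ih -sh /= tw.
  case: (ltnP i h) guard => ih' guard.
    rewrite /c hexec_true ?guard // (@hexec_set _ _ (minn i h).+1) //=.
      by lia.
    by rewrite one th op_add ?addn1 //; exact: leq_ltn_trans thh ww.
  by rewrite /c hexec_false ?guard //= th; lia.
have s2n : reg s2 v_n = n by rewrite /s2 hexec_reg.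
move: s2 s2h s2n => s2 s2h s2n.
rewrite hexec_seq (@hexec_set _ _ (2 ^ h) v_S); last
  by rewrite /= s2h one op_shl ?mul1n // ltn_exp2l.
rewrite (@hexec_set _ _ (n %/ 2 ^ h + 1)) //.
rewrite /= s2n one op_add //.
have : n %/ 2 ^ h <= n %/ 2 by apply: leq_div2l => //; rewrite -{1}(expn1 2) leq_exp2l // up_log_gt0.
by rewrite /eval_op; lia.
Qed.

Lemma copy_prog_exec (w k nw nwT : nat) (g : nat -> nat) (s : state)
    (s' := hexec w g copy_prog s) :
  k * nw <= 2 ^ w ->
  [/\ reg s v_k = k, reg s v_nw = nw & reg s v_nwT = nwT] ->
  (forall j, j < nwT -> Defs.mem s' a_text j = Defs.mem s 0 j) /\
  (forall j, j < k * nw -> Defs.mem s' a_pat j = Defs.mem s 1 j).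
Proof.
move=> knw [sk snw snwT]; rewrite {}/s' /copy_prog hexec_seq.
set s1 := hexec _ _ _ s.
have text1 j : j < nwT -> Defs.mem s1 a_text j = Defs.mem s 0 j.
  suff [_ H] : Defs.mem s1 0 = Defs.mem s 0 /\
      forall j, j < reg s v_nwT -> Defs.mem s1 a_text j = Defs.mem s 0 j.
    by rewrite -snwT; exact: H.
  apply: (@hexec_for w g (fun i t => Defs.mem t 0 = Defs.mem s 0 /\
    forall j, j < i -> Defs.mem t a_text j = Defs.mem s 0 j)) => // i t _ [t0 IH].
  split=> // p; rewrite ltnS leq_eqVlt => /orP[/eqP->|pi] /=.
    by rewrite eqxx t0.
  by rewrite (ltn_eqF pi) IH.
set s2 := hexec _ _ _ s1; split=> [j jn|]; first by rewrite /s2 hexec_mem // text1.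
have s1k : reg s1 v_k = k by rewrite /s1 hexec_reg.
have s1nw : reg s1 v_nw = nw by rewrite /s1 hexec_reg.
have s11 : Defs.mem s1 1 = Defs.mem s 1 by rewrite /s1 hexec_mem.
suff [_ _ H] : [/\ reg s2 v_nw = nw, Defs.mem s2 1 = Defs.mem s 1 &
    forall j, j < reg s1 v_k * nw -> Defs.mem s2 a_pat j = Defs.mem s 1 j].
  by rewrite -s1k.
apply: (@hexec_for w g (fun i t => [/\ reg t v_nw = nw, Defs.mem t 1 = Defs.mem s 1 &
  forall j, j < i * nw -> Defs.mem t a_pat j = Defs.mem s 1 j])) => // i t.
rewrite s1k => ik [tnw t1 IH].
set t0 := set_reg t 12 i; set t2 := hexec _ _ _ t0.
have inw : i * nw + nw <= 2 ^ w.
  by apply: leq_trans knw; rewrite -mulSnr leq_mul2r ik orbT.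
suff [t2nw _ t21 H] : [/\ reg t2 v_nw = nw, reg t2 12 = i, Defs.mem t2 1 = Defs.mem s 1 &
    forall j, j < i * nw + reg t0 v_nw -> Defs.mem t2 a_pat j = Defs.mem s 1 j].
  by split=> // j; rewrite mulSnr -{2}tnw; exact: H.
apply: (@hexec_for w g (fun x t => [/\ reg t v_nw = nw, reg t 12 = i, Defs.mem t 1 = Defs.mem s 1 &
    forall j, j < i * nw + x -> Defs.mem t a_pat j = Defs.mem s 1 j])).
  by split=> // j; rewrite addn0; exact: IH.
rewrite [reg t0 _]tnw => x u xnw [unw u12 u1 IHu]; split=> // j.
rewrite /= u12 unw op_mul; last lia.
rewrite op_add; last lia.
by rewrite addnS ltnS leq_eqVlt => /orP[/eqP->|jx]; rewrite ?eqxx ?u1 // (ltn_eqF jx) IHu.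
Qed.

Lemma suffix_array_range (n : nat) (T : seq bool) (r : nat) :
  size T = n -> 0 < r <= n -> 0 < suffix_array T r <= n.
Proof.
move=> Tn rn; rewrite /suffix_array.
have : nth 0 (sort (suffix_le T) (iota 1 (size T))) r.-1 \in iota 1 n.
  by rewrite -(mem_sort (suffix_le T)) Tn mem_nth // size_sort size_iota; lia.
by rewrite mem_iota; lia.
Qed.

Lemma suffix_array_surj (n : nat) (T : seq bool) (p : nat) :
  size T = n -> 0 < p <= n -> exists2 r, 0 < r <= n & suffix_array T r = p.
Proof.
move=> Tn pn; set S := sort (suffix_le T) (iota 1 (size T)).
have pS : p \in S by rewrite mem_sort mem_iota Tn; lia.
exists (index p S).+1; last by rewrite /suffix_array nth_index.
have : index p S < size S by rewrite index_mem.
by rewrite size_sort size_iota Tn.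
Qed.

Lemma suffix_array_sorted (n : nat) (T : seq bool) (r r' : nat) :
  size T = n -> 0 < r -> r <= r' -> r' <= n ->
  suffix_le T (suffix_array T r) (suffix_array T r').
Proof.
move=> Tn r0 rr r'n; rewrite /suffix_array.
apply: sorted_leq_nth => [y x z|x||||]; rewrite ?inE ?size_sort ?size_iota; try lia.
- exact: le_trans.
- exact: lexx.
- by apply: sort_sorted => x y; exact: le_total.
Qed.

Definition solve_prog : hcmd := (rev_prog ;; sort_prog ;; main_prog)%P.

Lemma solve_prog_exec (w n k m d nch nw h nS : nat) (T : seq bool)
    (P : nat -> seq bool) (s : state)
    (s' := hexec w (oracle n (suffix_array T)) solve_prog s) :
  sizes w n k m d nch nw h T P ->
  [/\ reg s v_n = n, reg s v_w = w, reg s v_k = k & reg s v_m = m] ->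
  [/\ reg s v_d = d, reg s v_D = 2 ^ d, reg s v_nch = nch & reg s v_nw = nw] ->
  [/\ reg s v_h = h, reg s v_S = 2 ^ h & reg s v_nS = nS] ->
  n < nS * 2 ^ h ->
  stored w a_text 0 T s -> (forall i, i < k -> stored w a_pat (i * nw) (P i) s) ->
  (reg s' 15 = 1 /\ exists2 i, i < k & infix (P i) T) \/
  (reg s' 15 = 0 /\ forall i, i < k -> ~~ infix (P i) T).
Proof.
move=> sz [sn sw sk sm] [sd sD snch snw] [sh sS snS] nnS st sp.
set g := oracle n (suffix_array T) in s' *.
have gE r : 0 < r <= n -> g r = suffix_array T r by rewrite /g /oracle => ->.
have Tn := text_size sz.
rewrite {}/s' /solve_prog hexec_seq; set s1 := hexec _ _ rev_prog s.
have es1 : env w n k m d nch nw h T P s1.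
  have mE a : a \notin hwritten rev_prog -> Defs.mem s1 a = Defs.mem s a.
    exact: hexec_mem.
  constructor; rewrite ?/stored ?mE //; rewrite ?hexec_reg //.
  by apply: rev_prog_exec => //; rewrite (d_gt0 sz) (d_ltn sz).
have [es2 so] := sort_prog_exec sz g es1.
rewrite hexec_seq; set s2 := hexec _ _ sort_prog s1 in es2 so *.
apply: (main_prog_exec sz _ _ _ es2 (nS := nS)) => //.
- by move=> r rn; rewrite gE //; exact: suffix_array_range.
- move=> r r' r0 rr r'n; rewrite /ranked_suffix !gE; try lia.
  exact: (suffix_array_sorted Tn).
- move=> p pn; have [r rn <-] := suffix_array_surj Tn pn.
  by exists r => //; rewrite gE.
- by rewrite /s2 hexec_reg // /s1 hexec_reg.
Qed.

(** * The assembled program *)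

Section Assembly.
Variables (build query : cmd).

(** One bound for register and array names alike. Adding 4 also keeps clear of the input registers 0
    to 3 and of array 2, which holds the data structure. *)
Definition fresh : nat :=
  (\max_(x <- assigned_regs build ++ assigned_regs query ++
    written_arrays build ++ written_arrays query) x) + 4.

Lemma ltn_fresh (x : nat) :
  x \in assigned_regs build ++ assigned_regs query ++
    written_arrays build ++ written_arrays query -> x < fresh.
Proof.
move=> xs; rewrite /fresh.
have : x <= \max_(x <- assigned_regs build ++ assigned_regs query ++
    written_arrays build ++ written_arrays query) x by exact: leq_bigmax_seq.
lia.
Qed.

(* Arrays 0 and 1 hold the input until it has been copied. *)
Definition input_array (a : nat) : nat := if a < 2 then a else fresh + a.
Definition work_array (a : nat) : nat := fresh + a.

Definition load_prog : cmd :=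
  let v := rvar fresh in let t := rtmp fresh in
  Seq (Op (v 0) OOr 0 0) (Seq (Op (v 1) OOr 1 1)
  (Seq (Op (v 2) OOr 2 2) (Seq (Op (v 3) OOr 3 3)
  (Seq (Op (t 0) OOr 0 0) (Op (t 1) OOr 1 1))))).

(* The part before [build] issues no query; [Const 0 0] is a dummy for the
   query algorithm. *)
Definition dm_program (e : nat) : cmd :=
  let v := rvar fresh in let t := rtmp fresh in
  Seq load_prog
  (Seq (comp fresh input_array (Const 0 0) 2 (param_prog e))
  (Seq (comp fresh input_array (Const 0 0) 2 copy_prog)
  (Seq (Op 0 OOr (t 0) (t 0)) (Seq (Op 1 OOr (t 1) (t 1))
  (Seq build
  (Seq (comp fresh work_array query 2 solve_prog)
  (Op 0 OOr (v 15) (v 15)))))))).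

Lemma input_array_inj : injective input_array.
Proof.
have F4 : 4 <= fresh by exact: leq_addl.
by move=> a b; rewrite /input_array; case: (ltnP a 2); case: (ltnP b 2); lia.
Qed.

Lemma work_array_inj : injective work_array.
Proof. exact: addnI. Qed.

(** Entry [x] is the value of variable [x] after [param_prog]. All loop bounds are among these
    variables, so the cost can be stated without reference to a state. *)
Definition loop_sizes (e w n k m : nat) : nat -> nat :=
  let d := digit_size e w in
  nth 0 [:: n; w; k; m; d; 2 ^ d; (m - 1) %/ d + 1; num_words w m;
    num_words w n; up_log 2 w; 2 ^ up_log 2 w; n %/ 2 ^ up_log 2 w + 1].

(** The 9 steps are the six copies of [load_prog], the two that hand [n] and [w] to [build], and the
    one that delivers the answer. The query time 1 belongs to the dummy query. *)
Definition dm_cost (e w n k m tb tq : nat) : nat :=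
  let r := loop_sizes e w n k m in
  9 + hcost 1 r (param_prog e) + hcost 1 r copy_prog + tb
  + hcost tq r solve_prog.

Lemma load_prog_run (w : nat) (s : state) : 0 < w -> state_wf w s ->
  exists s', [/\ run w load_prog s 6 s', state_wf w s',
    Defs.mem s' = Defs.mem s,
    forall x, x < 4 -> reg s' (rvar fresh x) = reg s x &
    reg s' (rtmp fresh 0) = reg s 0 /\ reg s' (rtmp fresh 1) = reg s 1].
Proof.
have F4 : 4 <= fresh by exact: leq_addl.
have vN x y : y < 4 -> (y == rvar fresh x) = false.
  by move=> y4; apply/eqP; rewrite /rvar; lia.
have tN x y : y < 4 -> (y == rtmp fresh x) = false.
  by move=> y4; apply/eqP; rewrite /rtmp; lia.
have tv x y : (rtmp fresh x == rvar fresh y) = false.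
  by rewrite eq_sym rvar_rtmp.
move=> w0 swf; pose copy x y t := set_reg t x (reg t y).
pose s' := copy (rtmp fresh 1) 1 (copy (rtmp fresh 0) 0 (copy (rvar fresh 3) 3
  (copy (rvar fresh 2) 2 (copy (rvar fresh 1) 1 (copy (rvar fresh 0) 0 s))))).
have r : run w load_prog s 6 s'.
  by do 5![apply: (@run_seq _ _ _ _ 1); first exact: run_copy]; exact: run_copy.
exists s'; split => //; first exact: run_wf r swf.
- move=> x x4; rewrite /= !(rvar_eq, rvar_rtmp, vN) //.
  by case: x x4 => [|[|[|[|x]]]].
- by rewrite /= !(tv, rtmp_eq, vN, tN).
Qed.

Lemma dm_program_run (e w n k m tb tq : nat) (T : n.-tuple bool)
    (D : k.-tuple (m.-tuple bool)) (s : state) :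
  1 < e -> 1 < w -> 0 < n -> n < 2 ^ w -> k < 2 ^ w -> 0 < m -> m < 2 ^ w ->
  k * num_words w m <= 2 ^ w ->
  (forall s0, sa_input w T s0 -> exists (t len : nat) (s' : state),
     [/\ run w build s0 t s', t <= tb & sa_answers w query tq T len s']) ->
  dm_input w T D s ->
  exists (t : nat) (s' : state),
    [/\ run w (dm_program e) s t s', t <= dm_cost e w n k m tb tq &
        reg s' 0 = dm_answer T D].
Proof.
move=> e1 w1 n0 nw kw m0 mw dict bld [swf [s0 s1 s2 s3] sT sD].
have w0 : 0 < w by exact: ltnW.
have F4 : 4 <= fresh by exact: leq_addl.
have F3 : 3 <= fresh by exact: ltnW.
have [p [rp pwf pm pv [pt0 pt1]]] := load_prog_run w0 swf.
set r := loop_sizes e w n k m.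
pose P i := oapp (fun j => tval (tnth D j)) [::] (insub i).
have PE (i : 'I_k) : P i = tnth D i by rewrite /P valK.
have am2 a : input_array a != 2.
  by rewrite /input_array; case: ifP => a2; lia.
(* Before [build] there is no data structure yet; one with no cells and the constant answer 0 meets
   the interface of the simulation. *)
have dspec : forall (i : nat) (s1 : state), 1 <= i <= n -> state_wf w s1 ->
    same_cells 2 0 p s1 -> [/\ reg s1 0 = n, reg s1 1 = w & reg s1 2 = i] ->
    exists (t : nat) (s2 : state), [/\ run w (Const 0 0) s1 t s2, t <= 1,
      same_cells 2 0 p s2 & reg s2 0 = 0].
  move=> i t1 _ _ _ _; exists 1, (set_reg t1 0 (0 %% 2 ^ w)).
  by split=> //; [exact: run_const | rewrite /= mod0n].
have dregs x : x \in assigned_regs (Const 0 0) -> x < fresh.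
  by rewrite inE => /eqP->; exact: leq_trans F4.
have dmem a : input_array a \notin written_arrays (Const 0 0) by [].
have rdp : ready fresh w n 0 p p by split=> //; rewrite ?pt0 ?pt1 ?s0 ?s1.
have [|ta [sa [ra la va fa rda]]] :=
  comp_run w0 F3 input_array_inj am2 dregs dmem dspec (c := param_prog e) (t := 2) isT _ rdp.
  by [].
have [|tc [sc [rc lc vc fc rdc]]] :=
  comp_run w0 F3 input_array_inj am2 dregs dmem dspec (c := copy_prog) (t := 2) isT _ rda.
  by [].
set d := digit_size e w; set h := up_log 2 w.
have d_ltn : d < w by exact: digit_size_ltn.
have d0 : 0 < d by rewrite /d /digit_size addn1.
have hw : h < w by exact: up_log_word_ltn.
have [|[an aw ak am] [ad aD anch anw anwT] [ah aS anS]] :=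
  @param_prog_exec e w n k m (oracle n (fun=> 0)) (view fresh input_array p) e1 w1 nw kw mw n0 m0.
  by rewrite /= !pv.
rewrite -va -/d in ad aD anch anw anwT ah aS anS an aw ak am.
have [ct cp] := @copy_prog_exec w k (num_words w m) (num_words w n)
  (oracle n (fun=> 0)) (view fresh input_array sa) dict (And3 ak anw anwT).
rewrite -vc in ct cp.
have regc x : x < 12 -> reg (view fresh input_array sc) x = reg (view fresh input_array sa) x.
  by move=> x12; rewrite vc hexec_reg // !inE; move: x12; do 12?[case: x => [//|x]].
have mem_sa a : a < 2 -> Defs.mem (view fresh input_array sa) a = Defs.mem s a.
  move=> a2; rewrite va hexec_mem; last by case: a a2 => [|[|]].
  by rewrite /= /input_array a2 pm.
have mem_in a : a < 2 -> Defs.mem sc a = Defs.mem s a.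
  move=> a2; rewrite -mem_sa //.
  transitivity (Defs.mem (view fresh input_array sc) a); first by rewrite /= /input_array a2.
  by rewrite vc hexec_mem //; case: a a2 => [|[|]].
have [scwf _ sc0 sc1] := rdc.
set sd1 := set_reg sc 0 (reg sc (rtmp fresh 0)).
set sd := set_reg sd1 1 (reg sd1 (rtmp fresh 1)).
have rd1 : run w (Op 0 OOr (rtmp fresh 0) (rtmp fresh 0)) sc 1 sd1 by exact: run_copy.
have rd2 : run w (Op 1 OOr (rtmp fresh 1) (rtmp fresh 1)) sd1 1 sd by exact: run_copy.
have sdF x : fresh <= x -> reg sd x = reg sc x.
  move=> Fx; rewrite (run_regs rd2) ?(run_regs rd1) //= inE.
    by apply/eqP; lia.
  by apply/eqP; lia.
have sdT : sa_input w T sd.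
  split.
  - exact: run_wf rd2 (run_wf w0 rd1 scwf).
  - by rewrite /= sc0.
  - rewrite -[RHS]sc1 /sd [LHS]/= ifN //.
    by rewrite /rtmp; lia.
  - move=> j jl; have -> : Defs.mem sd = Defs.mem sc by [].
    by rewrite mem_in ?sT.
have [tb' [len [sb [rb lb ans]]]] := bld sd sdT.
have regF x : fresh <= x -> reg sb x = reg sc x.
  move=> Fx; rewrite (run_regs rb) ?sdF //; apply/negP => xb.
  by have := @ltn_fresh x; rewrite !mem_cat xb ltnNge Fx => /(_ isT).
have memF a : fresh <= a -> Defs.mem sb a = Defs.mem sc a.
  move=> Fa; rewrite (run_mem rb) //; apply/negP => ab.
  by have := @ltn_fresh a; rewrite !mem_cat ab !orbT ltnNge Fa => /(_ isT).
have sbwf : state_wf w sb by apply: run_wf rb _; case: sdT.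
have tF t : fresh <= rtmp fresh t by rewrite /rtmp leq_addr.
have rdb : ready fresh w n len sb sb by split; rewrite ?regF.
have wa2 a : work_array a != 2 by rewrite /work_array; lia.
have qregs x : x \in assigned_regs query -> x < fresh.
  by move=> xq; apply: ltn_fresh; rewrite !mem_cat xq orbT.
have qmem a : work_array a \notin written_arrays query.
  apply/negP => aq; have := @ltn_fresh (work_array a).
  by rewrite !mem_cat aq !orbT ltnNge leq_addr => /(_ isT).
have qspec : forall (i : nat) (s1 : state), 1 <= i <= n -> state_wf w s1 ->
    same_cells 2 len sb s1 -> [/\ reg s1 0 = n, reg s1 1 = w & reg s1 2 = i] ->
    exists (t : nat) (s2 : state), [/\ run w query s1 t s2, t <= tq,
      same_cells 2 len sb s2 & reg s2 0 = suffix_array T i].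
  by move=> i t1 *; apply: ans.
have [|tf [sf [rf lf vf ff rdf]]] :=
  comp_run w0 F3 work_array_inj wa2 qregs qmem qspec (c := solve_prog) (t := 2) isT _ rdb.
  by [].
set V := view fresh work_array sb in lf vf.
have regV x : x < 12 -> reg V x = reg (view fresh input_array sa) x.
  by move=> x12; rewrite -regc //= regF // /rvar leq_addr.
(* [input_array] and [work_array] agree from 2 on, and [build] does not touch those arrays, so the
   copies are seen unchanged after it. *)
have memV a : 2 <= a -> Defs.mem V a = Defs.mem (view fresh input_array sc) a.
  by move=> a2; rewrite /= /work_array memF ?leq_addr // /input_array ltnNge a2.
have Tn : size T = n by exact: size_tuple.
have sz : sizes w n k m d ((m - 1) %/ d + 1) (num_words w m) h T P.
  have e1' := divn_eq (m - 1) d; have e2' := ltn_pmod (m - 1) d0.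
  constructor => //.
  - by rewrite addn1.
  - by rewrite mulnDl mul1n; lia.
  - by rewrite addnK; lia.
  - by move=> i ik; rewrite -[i]/(val (Ordinal ik)) PE size_tuple.
have := @solve_prog_exec w n k m d ((m - 1) %/ d + 1) (num_words w m) h
  (n %/ 2 ^ h + 1) T P V sz.
rewrite !regV // -vf => /(_ (And4 an aw ak am) (And4 ad aD anch anw) (And3 ah aS anS)) H.
exists (6 + (ta + (tc + (1 + (1 + (tb' + (tf + 1))))))), (set_reg sf 0 (reg sf (rvar fresh 15))).
split.
- apply: run_seq rp _; apply: run_seq ra _; apply: run_seq rc _.
  apply: run_seq rd1 _; apply: run_seq rd2 _; apply: run_seq rb _.
  by apply: run_seq rf _; exact: run_copy.
- have {}la : ta <= hcost 1 r (param_prog e).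
    apply: leq_trans la _; rewrite (@hcost_eq _ _ r) // => x.
    by rewrite inE => /eqP->; rewrite /= pv.
  have {}lc : tc <= hcost 1 r copy_prog.
    apply: leq_trans lc _; rewrite (@hcost_eq _ _ r) // => x.
    by rewrite !inE => /or3P[]/eqP->; rewrite ?anwT ?ak ?anw.
  have {}lf : tf <= hcost tq r solve_prog.
    apply: leq_trans lf _; rewrite (@hcost_eq _ _ r) // => x.
    have : all (fun y => y \in [:: 2; 5; 6; 9; 11]) (loop_bounds solve_prog) by [].
    move/allP => H1 /H1; rewrite !inE.
    by case/or4P => [||| /orP[]] /eqP->; rewrite regV ?ak ?aD ?anch ?ah ?anS.
  by rewrite /dm_cost -/r; lia.
- rewrite [LHS]/= -[reg sf _]/(reg (view fresh work_array sf) 15).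
  have nnS : n < (n %/ 2 ^ h + 1) * 2 ^ h.
    have h2 : 0 < 2 ^ h by rewrite expn_gt0.
    have := divn_eq n (2 ^ h); have := ltn_pmod n h2.
    by rewrite mulnDl mul1n; lia.
  have iq (i : 'I_k) : i * num_words w m + num_words w m <= k * num_words w m.
    by rewrite -mulSnr leq_mul2r ltn_ord orbT.
  have stT : stored w a_text 0 T V.
    by move=> j jl; rewrite memV // ct ?mem_sa ?sT // -[n]Tn.
  have stPi (i : 'I_k) : stored w a_pat (i * num_words w m) (P i) V.
    move=> j; rewrite PE => jl; rewrite memV //.
    have jm : j < num_words w m by move: jl; rewrite size_tuple.
    by rewrite cp ?mem_sa ?sD //; apply: leq_trans (iq i); rewrite ltn_add2l.
  have stP i (ik : i < k) := stPi (Ordinal ik).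
  rewrite /dm_answer; case: (H nnS stT stP) => [[-> [i ik inf]]|[-> none]].
    by case: existsP => // [] []; exists (Ordinal ik); rewrite -PE.
  by case: existsP => // -[i]; rewrite -PE (negPf (none _ _)).
Qed.
End Assembly.

(** * Running time *)

Section BigO.
Variable X : Type.
Implicit Types f g W V : X -> nat.

(** The bound holds on the whole index type, without exceptions for small arguments, so sums and
    products need no thresholds. The index will range over the admissible parameters [(n, k, m)]. *)
Definition bigo f W : Prop := exists C, forall x, f x <= C * W x.

Lemma bigo_const (c : nat) W : (forall x, 0 < W x) -> bigo (fun=> c) W.
Proof. by move=> W0; exists c => x; rewrite leq_pmulr. Qed.

Lemma bigo_add f g W : bigo f W -> bigo g W -> bigo (fun x => f x + g x) W.
Proof. by move=> [C fC] [D gD]; exists (C + D) => x; rewrite mulnDl leq_add. Qed.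

Lemma bigo_mul f g V W : bigo f V -> bigo g W ->
  bigo (fun x => f x * g x) (fun x => V x * W x).
Proof. by move=> [C fC] [D gD]; exists (C * D) => x; rewrite mulnACA leq_mul. Qed.

Lemma bigo_max f g W : bigo f W -> bigo g W -> bigo (fun x => maxn (f x) (g x)) W.
Proof.
move=> Hf Hg; have [C H] := bigo_add Hf Hg; exists C => x.
by apply: leq_trans (H x); rewrite geq_max leq_addr leq_addl.
Qed.

Lemma bigo_leq f V W : bigo f V -> (forall x, V x <= W x) -> bigo f W.
Proof.
by move=> [C fC] VW; exists C => x; apply: leq_trans (fC x) _; rewrite leq_mul2l VW orbT.
Qed.

Variables (tq : X -> nat) (r : X -> nat -> nat).

Definition cost (c : hcmd) (x : X) : nat := hcost (tq x) (r x) c.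

Fixpoint straight (c : hcmd) : bool :=
  match c with
  | HSkip | HSet _ _ | HStore _ _ _ => true
  | HSeq c1 c2 | HIf _ c1 c2 => straight c1 && straight c2
  | HFor _ _ _ | HQuery _ _ => false
  end.

Lemma cost_straight (c : hcmd) W : straight c -> (forall x, 0 < W x) -> bigo (cost c) W.
Proof.
move=> + W0; elim: c => //=.
- by move=> _; apply: bigo_const.
- by move=> y e _; apply: bigo_const.
- by move=> a e e' _; apply: bigo_const.
- by move=> c1 IH1 c2 IH2 /andP[/IH1 H1 /IH2 H2]; apply: bigo_add.
- move=> e c1 IH1 c2 IH2 /andP[/IH1 H1 /IH2 H2].
  by apply: bigo_add; [apply: bigo_const | apply: bigo_max].
Qed.

Lemma cost_seq (c1 c2 : hcmd) W :
  bigo (cost c1) W -> bigo (cost c2) W -> bigo (cost (HSeq c1 c2)) W.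
Proof. exact: bigo_add. Qed.

Lemma cost_if (e : expr) (c1 c2 : hcmd) W : (forall x, 0 < W x) ->
  bigo (cost c1) W -> bigo (cost c2) W -> bigo (cost (HIf e c1 c2)) W.
Proof. by move=> W0 H1 H2; apply: bigo_add; [apply: bigo_const | apply: bigo_max]. Qed.

Lemma cost_query (y : nat) (e : expr) W : (forall x, tq x < W x) ->
  bigo (cost (HQuery y e)) W.
Proof.
move=> tW; have W0 x : 0 < W x by apply: leq_ltn_trans (tW x).
apply: bigo_add; last exact: bigo_const.
apply: bigo_add; first exact: bigo_const.
by exists 1 => x; rewrite mul1n ltnW.
Qed.

Lemma cost_for (x y : nat) (c : hcmd) V W : (forall x, 0 < V x) -> (forall x, 0 < W x) ->
  bigo (fun i => r i y) V -> bigo (cost c) W ->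
  bigo (cost (HFor x y c)) (fun i => V i * W i).
Proof.
move=> V0 W0 HV HW; apply: bigo_add.
  by apply: bigo_const => i; rewrite muln_gt0 V0 W0.
by apply: bigo_mul => //; apply: bigo_add => //; apply: bigo_const.
Qed.

End BigO.

Lemma sqr_leq_exp (K : nat) : K * K <= 2 * 2 ^ K.
Proof.
elim: K => // K IH; have : K < 2 ^ K by exact: ltn_expl.
by rewrite expnS; lia.
Qed.

(** The upper bound on the digit size limits the number of buckets, the lower bound [digit_size_geq]
    the number of digits. *)
Lemma digit_size_leq (e w : nat) : digit_size e w <= w %/ 2 ^ e + 1.
Proof.
rewrite /digit_size leq_add2r; case: (ltnP e w) => ew.
  by rewrite modn_small // ltn_exp2l.
suff -> : 2 ^ e %% 2 ^ w = 0 by rewrite divn0.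
by apply/eqP; rewrite -/(dvdn _ _) dvdn_exp2l.
Qed.

Lemma digit_size_geq (e w : nat) : w <= digit_size e w * 2 ^ e.
Proof.
rewrite /digit_size; case: (ltnP e w) => ew.
  rewrite modn_small ?ltn_exp2l // mulnDl mul1n.
  have e0 : 0 < 2 ^ e by rewrite expn_gt0.
  by have := divn_eq w (2 ^ e); have := ltn_pmod w e0; lia.
have -> : 2 ^ e %% 2 ^ w = 0 by apply/eqP; rewrite -/(dvdn _ _) dvdn_exp2l.
rewrite divn0 mul1n; apply: leq_trans (ltnW (ltn_expl w (ltnSn 1))) _.
by rewrite leq_exp2l.
Qed.

(** * Step counts of the algorithm *)

Section Cost.
Variables (X : Type) (w n k m K tq : X -> nat) (c1 e : nat).
Hypothesis K_ge2 : forall x, 2 <= K x.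
Hypothesis K_leq : forall x, K x <= w x.
Hypothesis w_leq : forall x, w x <= c1 * K x.
Hypothesis n_geq : forall x, 2 ^ K x <= 2 * n x.
Hypothesis k_leq : forall x, k x * K x <= c1 * n x.
Hypothesis m_leq : forall x, m x <= c1 * K x.
Hypothesis e_geq : 4 * c1 <= 2 ^ e.

Let r x := loop_sizes e (w x) (n x) (k x) (m x).
(** The units of the estimates: [u] stands for [n / log n], [L] for [log log n] and [t] for one
    query; the added 1 keeps [u] and [t] positive. *)
Let u x := n x %/ K x + 1.
Let L x := up_log 2 (K x).
Let t x := tq x + 1.

Let K_gt0 x : 0 < K x. Proof. by apply: leq_trans (K_ge2 x). Qed.
Let u_gt0 x : 0 < u x. Proof. by rewrite /u addn1. Qed.
Let L_gt0 x : 0 < L x. Proof. by rewrite /L up_log_gt0 K_ge2. Qed.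
Let t_gt0 x : 0 < t x. Proof. by rewrite /t addn1. Qed.

Lemma bigo_blocks (C : nat) (f : X -> nat) :
  (forall x, f x * K x <= C * n x) -> bigo f u.
Proof.
move=> H; exists C => x.
rewrite -(leq_pmul2r (K_gt0 x)); apply: leq_trans (H x) _.
rewrite -mulnA leq_mul2l; apply/orP; right.
by have := divn_eq (n x) (K x); have := ltn_pmod (n x) (K_gt0 x); rewrite /u mulnDl mul1n; lia.
Qed.

Lemma bigo_num_patterns : bigo (fun x => r x 2) u.
Proof. exact: (bigo_blocks k_leq). Qed.

Lemma bigo_word : bigo (fun x => r x 1) u.
Proof.
apply: (@bigo_blocks (c1 * 4)) => x; rewrite -mulnA.
apply: leq_trans (leq_mul (w_leq x) (leqnn _)) _.
rewrite -mulnA leq_mul2l; apply/orP; right.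
by have := sqr_leq_exp (K x); have := n_geq x; lia.
Qed.

(** From [4 * c1 <= 2 ^ e] follows [w / 2 ^ e <= K / 4], so there are at most [2 * 2 ^ (K / 4)]
    buckets. Multiplied by [K <= 2 * 2 ^ (K / 2)], this is still [O(2 ^ K) = O(n)]. *)
Lemma bigo_buckets : bigo (fun x => r x 5) u.
Proof.
apply: (@bigo_blocks 8) => x; rewrite /r /=.
set q := w x %/ 2 ^ e.
have q4 : 4 * q <= K x.
  have : q * 2 ^ e <= w x by exact: leq_trunc_div.
  move=> H; have {}H := leq_trans H (w_leq x).
  have : q * (4 * c1) <= c1 * K x by apply: leq_trans H; rewrite leq_mul2l e_geq orbT.
  case: (posnP c1) => c10; last by rewrite mulnA mulnC leq_pmul2l // mulnC.
  by have := K_leq x; have := w_leq x; have := K_gt0 x; rewrite c10; lia.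
have D : 2 ^ digit_size e (w x) <= 2 * 2 ^ q.
  by rewrite -expnS leq_exp2l // -addn1; exact: digit_size_leq.
have K2 : K x <= 2 * 2 ^ (K x)./2.
  by have := ltn_expl (K x)./2 (ltnSn 1); lia.
apply: leq_trans (leq_mul D K2) _.
have -> : 2 * 2 ^ q * (2 * 2 ^ (K x)./2) = 4 * 2 ^ (q + (K x)./2).
  by rewrite expnD; lia.
apply: (@leq_trans (4 * 2 ^ K x)); last by have := n_geq x; lia.
by rewrite leq_mul2l leq_exp2l //; lia.
Qed.

(** [m <= c1 * K <= c1 * w <= c1 * d * 2 ^ e], so a pattern has at most [c1 * 2 ^ e + 1] digits.
    Comparisons and the number of sorting passes are bounded for this reason. *)
Lemma bigo_digits : bigo (fun x => r x 6) (fun=> 1).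
Proof.
exists (c1 * 2 ^ e + 1) => x; rewrite /r /= muln1 leq_add2r.
set d := digit_size e (w x).
have d0 : 0 < d by rewrite /d /digit_size addn1.
rewrite -ltnS ltn_divLR // mulSn.
have H : K x <= d * 2 ^ e by apply: leq_trans (K_leq x) (digit_size_geq _ _).
have : c1 * K x <= c1 * (d * 2 ^ e) by rewrite leq_mul2l H orbT.
by have := m_leq x; lia.
Qed.

Lemma bigo_pattern_words : bigo (fun x => r x 7) (fun=> 1).
Proof.
exists (c1 + 1) => x; rewrite /r /= muln1 /num_words.
have w0 : 0 < w x by apply: leq_trans (K_leq x).
rewrite -ltnS ltn_divLR // !mulSn mulnDl mul1n.
have : c1 * K x <= c1 * w x by rewrite leq_mul2l K_leq orbT.
by have := m_leq x; lia.
Qed.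

Lemma bigo_text_words : bigo (fun x => r x 8) u.
Proof.
exists 1 => x; rewrite mul1n /r /= /num_words /u.
have w0 : 0 < w x by apply: leq_trans (K_leq x).
have H : n x %/ w x <= n x %/ K x by apply: leq_div2l.
apply: leq_trans (_ : n x %/ w x + 1 <= _); last by rewrite leq_add2r.
rewrite -ltnS ltn_divLR //.
by have := divn_eq (n x) (w x); have := ltn_pmod (n x) w0; lia.
Qed.

Lemma bigo_stride_log : bigo (fun x => r x 9) L.
Proof.
exists (up_log 2 c1 + 1) => x; rewrite /r /= mulnDl mul1n.
apply: (@leq_trans (up_log 2 c1 + L x)); last by rewrite leq_add2r leq_pmulr.
apply: up_log_min => //; rewrite expnD; apply: leq_trans (w_leq x) _.
by apply: leq_mul; exact: up_logP.
Qed.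

Lemma bigo_strides : bigo (fun x => r x 11) u.
Proof.
exists 1 => x; rewrite mul1n /r /= leq_add2r; apply: leq_div2l => //.
by apply: leq_trans (K_leq x) _; exact: up_logP.
Qed.

Lemma bigo_compare : bigo (cost tq r compare_prog) (fun=> 1).
Proof.
apply: cost_seq; first exact: cost_straight.
apply: (bigo_leq (V := fun=> 1 * 1)) => //.
by apply: cost_for => //; [exact: bigo_digits | exact: cost_straight].
Qed.

Lemma bigo_probe : bigo (cost tq r probe_prog) t.
Proof.
apply: cost_seq; first exact: cost_straight.
apply: cost_if => //; first exact: cost_straight.
apply: cost_seq; first by apply: cost_query => x; rewrite /t addn1.
apply: cost_seq; first exact: cost_straight.
apply: cost_seq; first exact: cost_straight.
apply: cost_seq; last exact: cost_straight.
by apply: bigo_leq bigo_compare _.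
Qed.

Let W x := L x * t x.
Let W_gt0 x : 0 < W x. Proof. by rewrite muln_gt0 L_gt0 t_gt0. Qed.
Let t_leqW x : t x <= W x. Proof. by rewrite leq_pmull. Qed.

(** Each step is charged with a whole binary search of [O(L)] queries, even if it only moves the
    pointer; with [O(u)] steps this gives the total [u * L * t]. *)
Lemma bigo_step : bigo (cost tq r step_prog) W.
Proof.
have probe : bigo (cost tq r probe_prog) W by apply: bigo_leq bigo_probe _.
apply: cost_if => //; last exact: cost_straight.
do 3![apply: cost_seq; first exact: cost_straight].
apply: cost_seq => //; apply: cost_if => //; first exact: cost_straight.
apply: cost_seq; last exact: cost_straight.
apply: cost_seq; last by apply: cost_seq => //; exact: cost_straight.
apply: cost_for => //; first exact: bigo_stride_log.
apply: cost_seq; first exact: cost_straight.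
by apply: cost_seq; [exact: bigo_probe | exact: cost_straight].
Qed.

Lemma bigo_sort : bigo (cost tq r sort_prog) u.
Proof.
have loop y z c : bigo (fun x => r x z) u -> straight c -> bigo (cost tq r (HFor y z c)) u.
  move=> rz sc; apply: (bigo_leq (V := fun x => u x * 1)) => [|x]; last by rewrite muln1.
  by apply: cost_for => //; exact: cost_straight.
have D := bigo_buckets; have k_ := bigo_num_patterns.
apply: cost_seq; first exact: loop.
apply: (bigo_leq (V := fun x => 1 * u x)) => [|x]; last by rewrite mul1n.
apply: cost_for => //; first exact: bigo_digits.
apply: cost_seq.
  apply: cost_seq; first exact: loop.
  apply: cost_seq; first exact: cost_straight.
  apply: cost_seq; first exact: loop.
  apply: cost_seq; first exact: cost_straight.
  exact: loop.
by apply: cost_seq; exact: loop.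
Qed.

Lemma bigo_solve : bigo (cost tq r solve_prog) (fun x => u x * W x).
Proof.
have uW x : u x <= u x * W x by rewrite leq_pmulr.
have uW0 x : 0 < u x * W x by rewrite muln_gt0 u_gt0 W_gt0.
apply: cost_seq.
  apply: bigo_leq uW; apply: cost_seq; first exact: cost_straight.
  apply: (bigo_leq (V := fun x => u x * 1)) => [|x]; last by rewrite muln1.
  by apply: cost_for => //; [exact: bigo_buckets | exact: cost_straight].
apply: cost_seq; first by apply: bigo_leq bigo_sort uW.
do 3![apply: cost_seq; first exact: cost_straight].
apply: cost_seq; apply: cost_for => //; try exact: bigo_step.
- exact: bigo_strides.
- exact: bigo_num_patterns.
Qed.

Lemma bigo_param : bigo (fun x => hcost 1 (r x) (param_prog e)) u.
Proof.
rewrite -[fun x => _]/(cost (fun=> 1) r (param_prog e)).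
do 6![apply: cost_seq; first exact: cost_straight].
apply: cost_seq; last exact: cost_straight.
apply: (bigo_leq (V := fun x => u x * 1)) => [|x]; last by rewrite muln1.
by apply: cost_for => //; [exact: bigo_word | exact: cost_straight].
Qed.

Lemma bigo_copy : bigo (fun x => hcost 1 (r x) copy_prog) u.
Proof.
rewrite -[fun x => _]/(cost (fun=> 1) r copy_prog).
apply: (bigo_leq (V := fun x => u x * 1)) => [|x]; last by rewrite muln1.
apply: cost_seq; apply: cost_for => //.
- exact: bigo_text_words.
- exact: cost_straight.
- exact: bigo_num_patterns.
apply: (bigo_leq (V := fun=> 1 * 1)) => //.
by apply: cost_for => //; [exact: bigo_pattern_words | exact: cost_straight].
Qed.

Lemma dm_cost_leq : exists C, forall (x : X) (tb : nat),
  dm_cost e (w x) (n x) (k x) (m x) tb (tq x) <= tb + C * (u x * (L x * t x)).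
Proof.
have uW x : u x <= u x * W x by rewrite leq_pmulr.
have uW0 x : 0 < u x * W x by rewrite muln_gt0 u_gt0 W_gt0.
have [C H] := bigo_add (bigo_add (bigo_add (bigo_const 9 uW0) (bigo_leq bigo_param uW))
  (bigo_leq bigo_copy uW)) bigo_solve.
exists C => x tb; have := H x; rewrite /dm_cost /cost -/(r x); cbv beta.
move: (hcost _ _ (param_prog e)) (hcost _ _ copy_prog) (hcost _ _ solve_prog).
by move=> p c s; rewrite -/(W x); lia.
Qed.

End Cost.

(** * Asymptotic notation over the reals *)

Local Open Scope classical_set_scope.
Local Open Scope ring_scope.

Lemma little_oP (R : realType) (f : nat -> nat) (g : nat -> R) :
  little_o f g <->
  forall eps : R, 0 < eps -> exists N, forall n, (N <= n)%N ->
    (f n)%:R <= eps * `|g n|.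
Proof.
rewrite /little_o; split.
  move=> /eqoP H eps eps0; have [N _ HN] := H eps eps0.
  by exists N => n Nn; have := HN n Nn; rewrite /= normr_nat.
move=> H; apply/eqoP => eps eps0; have [N HN] := H eps eps0.
by exists N => // n Nn; rewrite /= normr_nat; exact: HN.
Qed.

Lemma big_O_bound (R : realType) (f : nat -> nat) (g : nat -> R) :
  big_O f g -> exists (C : R) (N : nat), 0 < C /\ forall n, (N <= n)%N ->
    (f n)%:R <= C * `|g n|.
Proof.
rewrite /big_O => /eqO_exP[C C0 [N _ HN]].
by exists C, N; split => // n Nn; have := HN n Nn; rewrite /= normr_nat.
Qed.

(** * Binary logarithms and the word size *)

Section WordSize.
Variable R : realType.
Implicit Types c x y : R.

Lemma ln2_gt0 : 0 < ln (2 : R).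
Proof. by rewrite ln_gt0 // ltr1n. Qed.

Lemma log2_expn (j : nat) : log2 ((2 ^ j)%N%:R : R) = j%:R.
Proof.
rewrite /log2 /logb natrX lnXn ?ltr0n // -[ln 2 *+ j]mulr_natl mulfK //.
by rewrite gt_eqF // ln2_gt0.
Qed.

Lemma ler_log2 x y : 0 < x -> x <= y -> log2 x <= log2 y.
Proof.
move=> x0 xy; rewrite /log2 /logb ler_pM2r ?invr_gt0 ?ln2_gt0 //.
by rewrite ler_ln // posrE // (lt_le_trans x0).
Qed.

Lemma ltr_log2 x y : 0 < x -> x < y -> log2 x < log2 y.
Proof.
move=> x0 xy; rewrite /log2 /logb ltr_pM2r ?invr_gt0 ?ln2_gt0 //.
by rewrite ltr_ln // posrE // (lt_trans x0).
Qed.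

Variable n : nat.
Hypothesis n_ge2 : (2 <= n)%N.
Let l : R := log2 n%:R.

Lemma log2_ge1 : 1 <= l.
Proof.
have <- : log2 (2%:R : R) = 1 by exact: (log2_expn 1).
by rewrite ler_log2 ?ltr0n // ler_nat.
Qed.

Lemma log2_leq_up_log : l <= (up_log 2 n)%:R.
Proof.
by rewrite -log2_expn ler_log2 ?ltr0n ?ler_nat ?up_logP //; exact: ltnW.
Qed.

Lemma up_log_lt_log2 : (up_log 2 n)%:R < l + 1.
Proof.
have u0 : (0 < up_log 2 n)%N by rewrite up_log_gt0.
rewrite -(prednK u0) -natr1 ltrD2r -log2_expn ltr_log2 ?ltr0n ?expn_gt0 //.
by rewrite ltr_nat up_log_gtn.
Qed.

Lemma log2_leq_ceil_log : l <= (ceil_log n)%:R.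
Proof. by apply: le_trans log2_leq_up_log _; rewrite ler_nat leq_maxr. Qed.

Lemma ceil_log_leq_log2 : (ceil_log n)%:R <= 2 * l.
Proof.
have := up_log_lt_log2; have := log2_ge1; rewrite /ceil_log.
by case: (leqP 2 (up_log 2 n)) => _; lra.
Qed.

Lemma word_size_ge c : 0 <= c -> c * l <= (word_size c n)%:R.
Proof.
move=> c0; rewrite /word_size natr_absz; apply: le_trans (ceil_ge _) _.
by rewrite ler_int ler_norm.
Qed.

Lemma word_size_lt c : 0 <= c -> (word_size c n)%:R < c * l + 1.
Proof.
move=> c0; have cl : 0 <= c * l by have := log2_ge1; nra.
rewrite /word_size natr_absz ger0_norm; last first.
  by rewrite ceil_ge0 (lt_le_trans _ cl) // ltrN10.
by rewrite -ltrBlDr -[1]/(1%:~R) -intrB; exact: ceilB1_lt.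
Qed.

Lemma ceil_log_leq_word_size c : 2 <= c -> (ceil_log n <= word_size c n)%N.
Proof.
move=> c2; rewrite -(ler_nat R); have c0 : 0 <= c by lra.
by have := word_size_ge c0; have := ceil_log_leq_log2; have := log2_ge1; nra.
Qed.

(** If [up_log 2 n] is at least 2, then [log n > 1] and [w >= 2 log n > log n + 1], which exceeds
    it; if it is at most 1, then [w >= 2] suffices. *)
Lemma n_ltn_word c : 2 <= c -> (n < 2 ^ word_size c n)%N.
Proof.
move=> c2; have c0 : 0 <= c by lra.
apply: leq_ltn_trans (up_logP n (ltnSn 1)) _; rewrite ltn_exp2l //.
have := ceil_log_leq_word_size c2; rewrite /ceil_log geq_max => /andP[w2 _].
case: (leqP (up_log 2 n) 1) => u2; first exact: leq_ltn_trans u2 w2.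
rewrite -(ltr_nat R); move: u2; rewrite -(ltr_nat R).
by have := word_size_ge c0; have := up_log_lt_log2; have := log2_ge1; nra.
Qed.

Lemma exp_ceil_log : (2 ^ ceil_log n <= 2 * n)%N.
Proof.
rewrite /ceil_log; case: (leqP 2 (up_log 2 n)) => u2.
  have := up_log_gtn (ltnSn 1) n_ge2.
  by rewrite -[in X in _ -> X](prednK (ltnW u2)) expnS ltn_neqAle => /andP[_]; rewrite leq_pmul2l.
by rewrite -[(2 ^ 2)%N]/(2 * 2)%N leq_pmul2l.
Qed.

Lemma ceil_log_leq : (ceil_log n <= n)%N.
Proof.
rewrite /ceil_log geq_max n_ge2 /= up_log_min //.
exact: ltnW (ltn_expl n (ltnSn 1)).
Qed.

End WordSize.

(** * The reduction and its running time *)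

Lemma dm_params_cost (R : realType) (c a b : R) (tq : nat -> nat) :
  2 <= c -> 0 < a -> a <= b -> exists e C : nat, (1 < e)%N /\
  forall (n k m tb : nat), dm_params c a b n k m ->
  (dm_cost e (word_size c n) n k m tb (tq n) <=
   tb + C * ((n %/ ceil_log n + 1) * (up_log 2 (ceil_log n) * (tq n + 1))))%N.
Proof.
move=> c2 a0 ab.
have c0 : 0 <= c by lra.
have b0 : 0 < b by lra.
(* One constant for three ratios: [w / K] is at most [c + 1], [k * K / n] at most [2 * b], and
   [m / K] at most [b]. *)
pose c1 := Num.bound (c + 2 * b + 1).
have c1P : c + 2 * b + 1 < c1%:R by apply: archi_boundP; lra.
(* Taking all admissible triples as indices makes the constant uniform in [k] and [m]. *)
pose X := {x : nat * nat * nat | dm_params c a b x.1.1 x.1.2 x.2}.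
pose n (x : X) := (sval x).1.1; pose k (x : X) := (sval x).1.2.
pose m (x : X) := (sval x).2; pose w x := word_size c (n x).
pose K x := ceil_log (n x).
have n2 x : (2 <= n x)%N by case: (svalP x) => -[].
have l1 x := log2_ge1 R (n2 x).
have lK x : log2 (n x)%:R <= (K x)%:R :> R := log2_leq_ceil_log R (n2 x).
have Kl x : (K x)%:R <= 2 * log2 (n x)%:R :> R := ceil_log_leq_log2 R (n2 x).
(* The exponent [4 * c1 + 2] is above 1 and satisfies [4 * c1 <= 2 ^ e]. *)
have [||||||| C HC] := @dm_cost_leq X w n k m K (fun x => tq (n x)) c1 (4 * c1 + 2).
- by move=> x; exact: leq_maxl.
- by move=> x; exact: ceil_log_leq_word_size.
- move=> x; rewrite -(ler_nat R) natrM.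
  have := word_size_lt (n2 x) c0; have := lK x; have := l1 x; rewrite -/(w x).
  have K1 : 1 <= (K x)%:R :> R by rewrite ler1n; exact: leq_trans (leq_maxl _ _).
  nra.
- by move=> x; exact: exp_ceil_log.
- move=> x; rewrite -(ler_nat R) !natrM.
  case: (svalP x) => _ [[/andP[_ kb] _] _].
  apply: le_trans (_ : b * ((n x)%:R / log2 (n x)%:R) * (2 * log2 (n x)%:R) <= _).
    by apply: ler_pM.
  have l0 : log2 (n x)%:R != 0 :> R by rewrite gt_eqF // (lt_le_trans ltr01).
  have -> : b * ((n x)%:R / log2 (n x)%:R) * (2 * log2 (n x)%:R) = 2 * b * (n x)%:R.
    by field.
  by apply: ler_wpM2r => //; lra.
- move=> x; rewrite -(ler_nat R) natrM.
  case: (svalP x) => _ [[_ /andP[_ mb]] _].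
  apply: le_trans mb _; apply: ler_pM; [lra | | lra | exact: lK].
  exact: le_trans ler01 (l1 x).
- exact: leq_trans (leq_addr _ _) (ltnW (ltn_expl _ (ltnSn 1))).
exists (4 * c1 + 2)%N, C; split; first by rewrite addn2.
move=> n' k' m' tb nkm; exact: (HC (exist _ (n', k', m') nkm) tb).
Qed.

Lemma divnS_mul_leq (n K : nat) : (K <= n)%N -> ((n %/ K + 1) * K <= 2 * n)%N.
Proof. by move=> Kn; rewrite mulnDl mul1n; have := leq_trunc_div n K; lia. Qed.

(** Besides the construction, the time is [O(n / K)] times the number of queries per step times the
    query time. The latter product is [o(sqrt K)], which leaves [o(n / sqrt K)], and [sqrt K] is at
    least [sqrt (log n)]. *)
Lemma dm_solvable_of_sa (R : realType) (c a b : R) (space qtime : nat -> R) :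
  2 <= c -> 0 < a -> a <= b ->
  (forall eps : R, 0 < eps -> exists N, forall n, (N <= n)%N ->
     (`|qtime n| + 1) * (up_log 2 (ceil_log n))%:R
     <= eps * Num.sqrt (ceil_log n)%:R) ->
  sa_constructible c space qtime -> dm_solvable c a b.
Proof.
move=> c2 a0 ab Hq [build [query [tb [sb [tq [[tbo _ tqO] H]]]]]].
have [e [C [e1 HC]]] := dm_params_cost tq c2 a0 ab.
exists (dm_program build query e).
exists (fun n => tb n + C * ((n %/ ceil_log n + 1) *
  (up_log 2 (ceil_log n) * (tq n + 1))))%N; split; last first.
  move=> n k m nkm T D s inp.
  have [[n2 k1 m1] [_ [kw mw dict]]] := nkm.
  have [||||t [s' [rn tl ans]]] := @dm_program_run build query e (word_size c n) n k m (tb n) (tq n) T D s e1 _ _ _ kw m1 mw dict _ inp.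
  - exact: leq_trans (leq_maxl _ _) (ceil_log_leq_word_size n2 c2).
  - exact: ltnW.
  - exact: n_ltn_word.
  - move=> s0 inp0; have [t [len [s' [rb tl _ ans]]]] := H n n2 T s0 inp0.
    by exists t, len, s'.
  exists t, s'; split => //; exact: leq_trans tl (HC n k m (tb n) nkm).
apply/little_oP => eps eps0.
have [C1 [N1 [C10 HN1]]] := big_O_bound tqO.
have /little_oP tbo' := tbo.
have [N2 HN2] := tbo' _ (divr_gt0 eps0 (ltr0Sn R 1)).
(* The factor 4 pays for halving [eps] between construction and search and for
   [n / K + 1 <= 2 * n / K]; [C + 1] absorbs the cost constant, and [C1 + 1] the bound of [tq n + 1]
   by a multiple of [|qtime n| + 1]. *)
pose d := eps / (4 * (C%:R + 1) * (C1 + 1)).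
have C_ge0 : 0 <= C%:R :> R by [].
have den : 0 < 4 * (C%:R + 1) * (C1 + 1) by apply: mulr_gt0; lra.
have d0 : 0 < d by exact: divr_gt0.
have [N3 HN3] := Hq d d0.
exists (maxn 2 (maxn N1 (maxn N2 N3))) => n; rewrite !geq_max => /and4P[n2 n_1 n_2 n_3].
have l1 := log2_ge1 R n2; set l : R := log2 n%:R in l1 *.
have lK : l <= (ceil_log n)%:R := log2_leq_ceil_log R n2.
set K := ceil_log n in lK *; set L := up_log 2 K.
have Kn : (K <= n)%N := ceil_log_leq n2.
have sl0 : 0 < Num.sqrt l by rewrite sqrtr_gt0; lra.
have sK0 : 0 < Num.sqrt (K%:R : R) by rewrite sqrtr_gt0; lra.
have K0 : (0 < K)%N by exact: leq_trans (leq_maxl _ _).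
have gE : `|n_over_sqrt_log R n| = n%:R / Num.sqrt l.
  by rewrite /n_over_sqrt_log ger0_norm // divr_ge0 // ltW.
rewrite gE natrD.
have -> : eps * (n%:R / Num.sqrt l) = eps / 2 * (n%:R / Num.sqrt l) + eps / 2 * (n%:R / Num.sqrt l).
  by field; rewrite gt_eqF.
apply: lerD; first by have := HN2 n n_2; rewrite gE.
have q1 : (tq n + 1)%:R * L%:R <= (C1 + 1) * d * Num.sqrt K%:R :> R.
  have := HN3 n n_3; have := HN1 n n_1; rewrite -/K -/L => h1 h2.
  rewrite -mulrA; apply: le_trans (ler_wpM2l _ h2); last by lra.
  rewrite mulrA; apply: ler_wpM2r => //; rewrite natrD.
  by have := normr_ge0 (qtime n); nra.
have u1 : (n %/ K + 1)%:R <= 2 * (n%:R / K%:R) :> R.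
  have : (n %/ K + 1)%:R * K%:R <= 2 * n%:R :> R.
    by rewrite -!natrM ler_nat divnS_mul_leq.
  by rewrite -ler_pdivlMr ?ltr0n // mulrA.
have sqK : K%:R = Num.sqrt K%:R * Num.sqrt K%:R :> R.
  by rewrite -expr2 sqr_sqrtr.
have main : C%:R * ((n %/ K + 1)%:R * (L%:R * (tq n + 1)%:R)) <=
    C%:R * (2 * (n%:R / K%:R) * ((C1 + 1) * d * Num.sqrt K%:R)) :> R.
  by apply: ler_wpM2l => //; apply: ler_pM => //; rewrite mulrC.
rewrite !natrM; apply: le_trans main _.
have -> : C%:R * (2 * (n%:R / K%:R) * ((C1 + 1) * d * Num.sqrt K%:R))
    = eps / 2 * (C%:R / (C%:R + 1)) * (n%:R / Num.sqrt K%:R).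
  rewrite {1}sqK /d; field; rewrite !gt_eqF //; lra.
apply: ler_pM.
- by apply: mulr_ge0; [lra | apply: divr_ge0; lra].
- by apply: divr_ge0 => //; exact: ltW.
- rewrite -[leRHS]mulr1; apply: ler_wpM2l; first lra.
  by rewrite ler_pdivrMr; lra.
- by apply: ler_wpM2l => //; rewrite lef_pV2 ?posrE // ler_wsqrtr.
Qed.

(** * The five query times *)

Section QueryTimes.
Variable R : realType.

(* The factor [up_log 2 (ceil_log n)] is, up to a constant, the number of
   queries spent on a pattern. *)
Definition negligible_query (q : nat -> R) : Prop :=
  forall eps : R, 0 < eps -> exists N, forall n, (N <= n)%N ->
    (`|q n| + 1) * (up_log 2 (ceil_log n))%:R <= eps * Num.sqrt (ceil_log n)%:R.

(** The logarithm of a positive number is below the number; apply this to [x ^ d]. *)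
Lemma ln_leq_powR (x d : R) : 0 < d -> 0 < x -> ln x <= x `^ d / d.
Proof.
move=> d0 x0; rewrite ler_pdivlMr // mulrC -ln_powR.
by apply: ltW; apply: ln_sublinear; exact: powR_gt0.
Qed.

Lemma ceil_log_ge1 (n : nat) : 1 <= (ceil_log n)%:R :> R.
Proof. by rewrite ler1n; exact: leq_trans (leq_maxl _ _). Qed.

Lemma ceil_log_unbounded (M : R) :
  exists N, forall n, (N <= n)%N -> M <= (ceil_log n)%:R.
Proof.
exists (2 ^ Num.bound M)%N => n Mn.
have [M0|M0] := lerP M 0; first exact: le_trans M0 (ler0n _ _).
apply: ltW; apply: lt_le_trans (archi_boundP (ltW M0)) _; rewrite ler_nat.
apply: leq_trans (leq_maxr _ _); rewrite -(leq_exp2l _ _ (ltnSn 1)).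
exact: leq_trans Mn (up_logP n (ltnSn 1)).
Qed.

Lemma log2_ceil_log_ge1 (n : nat) : 1 <= log2 ((ceil_log n)%:R : R).
Proof. by apply: log2_ge1; exact: leq_maxl. Qed.

Lemma up_log_leq_log2 (n : nat) :
  (up_log 2 (ceil_log n))%:R <= 2 * log2 ((ceil_log n)%:R : R).
Proof.
have K2 : (2 <= ceil_log n)%N by exact: leq_maxl.
by have := up_log_lt_log2 R K2; have := log2_ge1 R K2; lra.
Qed.

Lemma log2_leq_powR (d : R) : 0 < d -> exists2 A : R, 0 < A &
  forall n, log2 ((ceil_log n)%:R : R) <= A * (ceil_log n)%:R `^ d.
Proof.
move=> d0; have l2 := ln2_gt0 R.
exists ((d * ln 2)^-1) => [|n]; first by rewrite invr_gt0 mulr_gt0.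
rewrite /log2 /logb ler_pdivrMr //.
have := @ln_leq_powR (ceil_log n)%:R d d0 (lt_le_trans ltr01 (ceil_log_ge1 n)).
by congr (_ <= _); field; rewrite !gt_eqF.
Qed.

Lemma powR_ceil_log_ge1 (n : nat) (d : R) : 0 <= d -> 1 <= (ceil_log n)%:R `^ d :> R.
Proof.
by move=> d0; have := ler_powR (ceil_log_ge1 n) d0; rewrite powRr0.
Qed.

(** With [d] half the gap between [alpha] and [1 / 2], [sqrt K] is [K ^ alpha * K ^ d * K ^ d]: the
    first factor covers the query time, the second the logarithm, and the third outgrows all
    constants once it exceeds [M]. *)
Lemma negligible_power (q : nat -> R) (alpha A : R) (N0 : nat) :
  0 <= alpha < 1 / 2 ->
  (forall n, (N0 <= n)%N -> `|q n| <= A * (ceil_log n)%:R `^ alpha) ->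
  negligible_query q.
Proof.
move=> /andP[al0 al12] Hq eps eps0.
pose d := (1 / 2 - alpha) / 2; have d0 : 0 < d by rewrite /d; lra.
have [B B0 HB] := log2_leq_powR d0.
pose M := 2 * (`|A| + 1) * B / eps.
have M0 : 0 <= M.
  by rewrite /M; apply: divr_ge0; [|exact: ltW]; apply: mulr_ge0; [|exact: ltW];
     have := normr_ge0 A; lra.
have [N1 HN1] := ceil_log_unbounded (M `^ d^-1).
exists (maxn N0 N1) => n; rewrite geq_max => /andP[n0 n1].
set K : R := (ceil_log n)%:R.
have K1 : 1 <= K by exact: ceil_log_ge1.
have K0 : 0 < K by exact: lt_le_trans ltr01 K1.
have Ka : 1 <= K `^ alpha by exact: powR_ceil_log_ge1.
have Kd : M <= K `^ d.
  have := HN1 n n1; rewrite -/K => H.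
  have := @ge0_ler_powR R d (ltW d0) _ _ (powR_ge0 _ _) (ltW K0) H.
  by rewrite -powRrM mulVf ?gt_eqF // powRr1.
have h1 : `|q n| + 1 <= (`|A| + 1) * K `^ alpha.
  have := Hq n n0; rewrite -/K mulrDl mul1r => h; apply: lerD => //.
  by apply: le_trans h _; apply: ler_wpM2r; [exact: powR_ge0 | exact: ler_norm].
have h2 : (up_log 2 (ceil_log n))%:R <= 2 * B * K `^ d.
  apply: le_trans (up_log_leq_log2 n) _; rewrite -mulrA ler_pM2l //; exact: HB.
have sK : Num.sqrt K = K `^ alpha * K `^ d * K `^ d.
  rewrite -powR12_sqrt ?(ltW K0) // -!powRD ?(gt_eqF K0) ?implybT //.
  by congr (_ `^ _); rewrite /d; field.
apply: (@le_trans _ _ ((`|A| + 1) * K `^ alpha * (2 * B * K `^ d))).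
  by apply: ler_pM => //; have := normr_ge0 (q n); lra.
rewrite sK; set x := K `^ alpha in Ka *; set y := K `^ d in Kd *.
have xy0 : 0 <= x * y by apply: mulr_ge0; exact: powR_ge0.
have My : 2 * (`|A| + 1) * B <= eps * y by rewrite -ler_pdivrMl // mulrC.
have -> : (`|A| + 1) * x * (2 * B * y) = (x * y) * (2 * (`|A| + 1) * B) by ring.
have -> : eps * (x * y * y) = (x * y) * (eps * y) by ring.
exact: ler_wpM2l.
Qed.

Lemma negligible_log2 (q : nat -> R) (N0 : nat) (C : R) :
  (forall n, (N0 <= n)%N -> `|q n| <= C * log2 (ceil_log n)%:R) ->
  negligible_query q.
Proof.
move=> Hq; have [|B B0 HB] := @log2_leq_powR (1 / 4); first lra.
apply: (@negligible_power q (1 / 4) (`|C| * B) N0); first by apply/andP; split; lra.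
move=> n n0; apply: le_trans (Hq n n0) _.
have l1 := log2_ceil_log_ge1 n.
apply: le_trans (_ : `|C| * log2 (ceil_log n)%:R <= _).
  by apply: ler_wpM2r; [lra | exact: ler_norm].
by rewrite -mulrA; apply: ler_wpM2l.
Qed.

Lemma logb_bounds (B K : nat) : (2 <= B <= K)%N ->
  1 <= logb (B%:R : R) K%:R <= log2 K%:R.
Proof.
move=> /andP[B2 BK]; have l2 := ln2_gt0 R.
have B0 : 0 < B%:R :> R by rewrite ltr0n; exact: ltnW.
have K0 : 0 < K%:R :> R by rewrite ltr0n; apply: leq_trans BK; exact: ltnW.
have lB : ln 2 <= ln (B%:R : R) by rewrite ler_ln ?posrE // ler_nat.
have lK : ln (B%:R : R) <= ln (K%:R : R) by rewrite ler_ln ?posrE // ler_nat.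
rewrite /log2 /logb; apply/andP; split.
  by rewrite ler_pdivlMr ?mul1r //; lra.
apply: ler_wpM2l; first lra.
by rewrite lef_pV2 ?posrE //; lra.
Qed.

(** The hypothesis on [B] leaves no room for two logarithms, so the cases are split at
    [K ^ (1 / 4)]. Below, the query time is at most [K ^ (1 / 4) * log K], far under [sqrt K].
    Above, [log_B K] is at most 4, and the single remaining logarithm is the one that
    [B = o(sqrt K / log K)] allows. *)
Lemma negligible_tradeoff (B : nat -> nat) :
  (forall n, (2 <= n)%N -> (2 <= B n <= ceil_log n)%N) ->
  little_o B (fun n => Num.sqrt (ceil_log n)%:R / log2 ((ceil_log n)%:R : R)) ->
  negligible_query (fun n => (B n)%:R * logb (B n)%:R (ceil_log n)%:R).
Proof.
move=> HB /little_oP Bo eps eps0.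
have [|A A0 HA] := @log2_leq_powR (1 / 8); first lra.
pose q n : R := (ceil_log n)%:R `^ (1 / 4) * log2 (ceil_log n)%:R.
have qn : negligible_query q.
  apply: (@negligible_power q (3 / 8) A 0) => [|n _]; first by apply/andP; split; lra.
  have l1 := log2_ceil_log_ge1 n; have p0 := powR_ge0 (ceil_log n)%:R (1 / 4 : R).
  rewrite ger0_norm; last by apply: mulr_ge0 => //; lra.
  apply: le_trans (ler_wpM2l p0 (HA n)) _.
  have K0 : (ceil_log n)%:R != 0 :> R.
    by rewrite gt_eqF // (lt_le_trans ltr01) // ceil_log_ge1.
  rewrite mulrCA -powRD ?K0 ?implybT //.
  have -> : 1 / 4 + 1 / 8 = 3 / 8 :> R by field.
  exact: lexx.
have [N1 HN1] := qn eps eps0.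
(* For large [B] the query time plus 1 is at most [4 * B + 1 <= 8 * B], and [up_log] contributes at
   most [2 * log2 K]; hence the 16. *)
have [|N2 HN2] := Bo (eps / 16); first by apply: divr_gt0.
exists (maxn 2 (maxn N1 N2)) => n; rewrite !geq_max => /and3P[n2 n1 n2'].
have /andP[b1 bl] := logb_bounds (HB n n2).
have l1 := log2_ceil_log_ge1 n; have ul := up_log_leq_log2 n.
have /andP[B2 BK] := HB n n2.
set K : R := (ceil_log n)%:R in b1 bl l1 ul *.
set b : R := (B n)%:R in b1 bl *.
have b2 : 2 <= b by rewrite ler_nat.
have K0 : 0 < K by rewrite (lt_le_trans ltr01) // ceil_log_ge1.
have bK : b <= K by rewrite ler_nat.
rewrite ger0_norm; last by apply: mulr_ge0; lra.
case: (lerP b (K `^ (1 / 4))) => bq.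
  apply: le_trans (HN1 n n1); apply: ler_wpM2r => //; apply: lerD => //.
  rewrite /q ger0_norm; last by apply: mulr_ge0; [exact: powR_ge0 | rewrite -/K; lra].
  by apply: ler_pM => //; lra.
have lb : logb b K <= 4.
  have b0 : 0 < b by lra.
  have : ln (K `^ (1 / 4)) <= ln b by rewrite ler_ln ?posrE ?powR_gt0 // ltW.
  rewrite ln_powR => h; rewrite /logb ler_pdivrMr; first lra.
  by rewrite ln_gt0 //; lra.
have := HN2 n n2'; rewrite -/b -/K ger0_norm; last by apply: divr_ge0; [exact: sqrtr_ge0 | lra].
rewrite mulrA ler_pdivlMr; last lra.
move=> h; apply: (@le_trans _ _ (8 * b * (2 * log2 K))); last by lra.
by apply: ler_pM => //; nra.
Qed.

End QueryTimes.

Theorem corollary8p7 (R : realType) (c : R) (hc : 2 <= c)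
    (a b : R) (ha : 0 < a) (hab : a <= b) (no_dm : ~ dm_solvable c a b) :
  [/\ (forall B : nat -> nat,
         (forall n, (2 <= n)%N -> (2 <= B n <= ceil_log n)%N) ->
         little_o B (fun n => Num.sqrt (ceil_log n)%:R
                              / log2 ((ceil_log n)%:R : R)) ->
         ~ sa_constructible c
             (fun n => n%:R * logb (B n)%:R (ceil_log n)%:R)
             (fun n => (B n)%:R * logb (B n)%:R (ceil_log n)%:R)),
      (forall B : nat -> nat,
         (forall n, (2 <= n)%N -> (2 <= B n <= ceil_log n)%N) ->
         ~ sa_constructible c
             (fun n => (B n)%:R * n%:R * logb (B n)%:R (ceil_log n)%:R)
             (fun n => logb (B n)%:R (ceil_log n)%:R)),
      ~ sa_constructible c
          (fun n => n%:R * (1 + log2 (log2 n%:R)))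
          (fun n => 1 + log2 (log2 n%:R)),
      (forall eps : R, 0 < eps < 1 / 2 ->
         ~ sa_constructible c
             (fun n => n%:R)
             (fun n => log2 n%:R `^ eps)) &
      (forall eps : R, 0 < eps < 1 ->
         ~ sa_constructible c
             (fun n => n%:R * (log2 n%:R `^ eps))
             (fun n => 1))].
Proof.
have reduce space qtime : negligible_query qtime -> ~ sa_constructible c space qtime.
  by move=> Hq sa; apply: no_dm; exact: (dm_solvable_of_sa hc ha hab Hq sa).
have log2n n : (2 <= n)%N -> 1 <= log2 (n%:R : R) <= (ceil_log n)%:R.
  by move=> n2; rewrite log2_ge1 // log2_leq_ceil_log.
split.
- by move=> B HB Bo; apply: reduce; exact: negligible_tradeoff.
- move=> B HB; apply: reduce; apply: (@negligible_log2 _ _ 2 1) => n n2.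
  have /andP[b1 bl] := logb_bounds R (HB n n2).
  by rewrite mul1r ger0_norm // (le_trans ler01).
(* The factor 2 covers the summands 1 and [log2 (log2 n)], each at most [log2 K]. *)
- apply: reduce; apply: (@negligible_log2 _ _ 2 2) => n n2.
  have /andP[l1 lK] := log2n n n2; have K1 := log2_ceil_log_ge1 R n.
  have ll : log2 (log2 (n%:R : R)) <= log2 (ceil_log n)%:R.
    by apply: ler_log2 => //; exact: lt_le_trans l1.
  have l0 : 0 <= log2 (log2 (n%:R : R)).
    by rewrite /log2 /logb; apply: divr_ge0; apply: ln_ge0 => //; rewrite ler1n.
  by rewrite ger0_norm; lra.
- move=> eps /andP[eps0 eps1]; apply: reduce.
  apply: (@negligible_power _ _ eps 1 2) => [|n n2]; first by rewrite ltW.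
  have /andP[l1 lK] := log2n n n2.
  rewrite mul1r ger0_norm ?powR_ge0 // ge0_ler_powR ?nnegrE //.
  + exact: ltW.
  + exact: le_trans l1.
- move=> eps _; apply: reduce; apply: (@negligible_log2 _ _ 2 1) => n n2.
  by rewrite mul1r normr1 log2_ceil_log_ge1.
Qed.
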